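(* Let $k\geq 1$ and let $Z=(X^+,X^-)_\Sigma$ be a planar Filippov system, in coordinates with $h(x,y)=y$, having a $\Sigma$-polycycle $\Gamma$ of type $(b)$ through a unique $\Sigma$-singularity $p=(0,0)$, a visible regular-tangential singularity of multiplicity $2k$ of $X^+$, and satisfying: (b.1) $X_1^+(p)>0$; (b.2) the trajectory of $Z$ through $p$ crosses $\Sigma$ transversally $m$ times, at $q_1,\dots,q_m$, and for each $i=0,\dots,m$ there exists $t_i>0$ with $\varphi_Z(t_i,q_i)=q_{i+1}$, where $q_0=q_{m+1}=p$; moreover $\Gamma\cap\Sigma=\{q_1,\dots,q_m,p\}$; (b.3) $W^s_{\pitchfork}(p)\cup W^u_t(p)\subset\Gamma$, i.e. $X^-h(p)>0$. Let $n\geq 2k-1$, let $\Phi\in C^{n-1}_{ST}$, and let $Z_\varepsilon^\Phi$ be the $\Phi$-regularization of $Z$. Then, for $\varepsilon>0$ sufficiently small, $Z_\varepsilon^\Phi$ admits at least one limit cycle $\Gamma_\varepsilon$. Moreover, $\Gamma_\varepsilon$ converges to $\Gamma$ as $\varepsilon\to 0$.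
   Context: **Filippov systems.** Let $\mathcal D\subset\mathbb R^2$ be open and $h:\mathcal D\to\mathbb R$ a $C^\infty$ function having $0$ as a regular value; $\Sigma=h^{-1}(0)$ is connected and separates $\mathcal D$ into $\Sigma^+=\{h>0\}$ and $\Sigma^-=\{h<0\}$. $Z=(X^+,X^-)_\Sigma$ is the piecewise smooth vector field equal to $X^\pm$ on $\Sigma^\pm$, where $X^\pm=(X_1^\pm,X_2^\pm)$ are of class $C^{2k}$ up to $\Sigma$ (extendable across it). $X^\pm h=\langle\nabla h,X^\pm\rangle$, $(X^\pm)^ih=X^\pm((X^\pm)^{i-1}h)$. The flow of $X^\pm$ is $\varphi_{X^\pm}$. Crossing region: $\Sigma^c=\{q\in\Sigma: X^+h(q)\,X^-h(q)>0\}$, where trajectories of $X^+$ and $X^-$ are concatenated. Sliding region: $\Sigma^s=\{q\in\Sigma:X^+h(q)X^-h(q)<0\}$, where trajectories follow the sliding vector field $Z^s=\frac{X^-h\,X^+-X^+h\,X^-}{X^-h-X^+h}$. $\varphi_Z$ denotes the resulting (Filippov) trajectories. $\Sigma$-singularities include the zeros of $Z^s$ and the tangential points $\{q\in\Sigma: X^+h(q)X^-h(q)=0\}$. **Visible regular-tangential singularity of multiplicity $2k$ (of $X^+$)** at $p\in\Sigma$: $X^+h(p)=\dots=(X^+)^{2k-1}h(p)=0$, $(X^+)^{2k}h(p)>0$, and $X^-h(p)\neq0$. **Separatrices.** With $\delta_u=1$, $\delta_s=-1$, and $I(q)$ the open interval with endpoints $0$ and $t(q)$: $W^{s,u}_t(p)$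 is the set of $q=\varphi_{X^+}(t(q),p)$ with $\varphi_{X^+}(I(q),p)\subset\Sigma^+$ and $\delta_{s,u}t(q)>0$; $W^{s,u}_{\pitchfork}(p)$ is the set of $q=\varphi_{X^-}(t(q),p)$ with $\varphi_{X^-}(I(q),p)\subset\Sigma^-$ and $\delta_{s,u}t(q)>0$. **$\Sigma$-polycycles.** A regular orbit of $Z$ is a piecewise smooth curve $\gamma$ such that $\gamma\cap\Sigma^\pm$ are unions of regular orbits of $X^\pm$ and $\gamma\cap\Sigma\subset\Sigma^c$. A $\Sigma$-polycycle $\Gamma$ is a closed curve composed of finitely many $\Sigma$-singularities $p_1,\dots,p_N\in\Sigma$ and finitely many regular orbits $\gamma_1,\dots,\gamma_N$, $\gamma_i$ having ending points $p_i$ and $p_{i+1}$ (cyclically), such that $\Gamma$ is an $S^1$-immersion oriented by increasing time along the regular orbits, and there is a non-constant first return map $\pi_\Gamma$ defined on at least one side of $\Gamma$. A $\Sigma$-polycycle with a unique $\Sigma$-singularity $p$, visible regular-tangential of multiplicity $2k$, is of *type $(b)$* if $W^s_{\pitchfork}(p)\cup W^u_t(p)\subset\Gamma$ or $W^u_{\pitchfork}(p)\cup W^s_t(p)\subset\Gamma$. **Regularization.** For an integer $r\ge0$, a $C^r$-monotonic transition function is $\Phi(s)=\phi(s)$ for $|s|\le1$, $\Phi(s)=\mathrm{sign}(s)$ for $|s|\ge1$, where $\phi:\mathbb R\to\mathbb R$ is $C^\infty$, $\phi(\pm1)=\pm1$, $\phi^{(i)}(\pm1)=0$ for $i=1,\dots,r$,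 and $\phi'(s)>0$ on $(-1,1)$. $C^r_{ST}$ is the set of such $\Phi$ that are not $C^{r+1}$ at $\pm1$. For $\varepsilon>0$, $Z_\varepsilon^\Phi=\frac{1+\Phi(h/\varepsilon)}{2}X^++\frac{1-\Phi(h/\varepsilon)}{2}X^-$. **Convergence.** $\Gamma_\varepsilon$ converges to $\Gamma$ if for every open set $\mathcal U\supset\Gamma$ one has $\Gamma_\varepsilon\subset\mathcal U$ for all $\varepsilon>0$ small enough. *)

(* Defs.v *)
From Stdlib Require Import Reals List.
From Coquelicot Require Import Coquelicot.
Import ListNotations.
Open Scope R_scope.

Definition pt : Type := (R * R)%type.
Definition set2 : Type := pt -> Prop.

Definition subset (A B : set2) : Prop := forall q, A q -> B q.
Definition union (A B : set2) : set2 := fun q => A q \/ B q.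

Definition connected (A : set2) : Prop :=
  forall U V : set2, open U -> open V ->
    subset A (union U V) ->
    (exists q, A q /\ U q) -> (exists q, A q /\ V q) ->
    exists q, A q /\ U q /\ V q.

Definition d1 (f : pt -> R) : pt -> R :=
  fun q => Derive (fun x => f (x, snd q)) (fst q).
Definition d2 (f : pt -> R) : pt -> R :=
  fun q => Derive (fun y => f (fst q, y)) (snd q).

Definition Ck_on (r : nat) (U : set2) (f : pt -> R) : Prop :=
  forall q, U q -> ex_diff_n (fun x y => f (x, y)) r (fst q) (snd q).

Definition Ck_field_on (r : nat) (U : set2) (X : pt -> pt) : Prop :=
  Ck_on r U (fun q => fst (X q)) /\ Ck_on r U (fun q => snd (X q)).

Definition lie (X : pt -> pt) (f : pt -> R) : pt -> R :=
  fun q => fst (X q) * d1 f q + snd (X q) * d2 f q.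

Definition lie_iter (X : pt -> pt) (i : nat) (f : pt -> R) : pt -> R :=
  Nat.iter i (lie X) f.

Definition velocity (g : R -> pt) (t : R) (v : pt) : Prop :=
  is_derive (fun s => fst (g s)) t (fst v) /\
  is_derive (fun s => snd (g s)) t (snd v).

(** All fields are total functions; values of [h] outside [dom], and of [Xp]
    (resp. [Xm]) away from a neighbourhood of [{h >= 0}] (resp. [{h <= 0}]) in
    [dom], are irrelevant. *)
Record filippov : Type := Filippov {
  dom : set2;
  h : pt -> R;
  Xp : pt -> pt;
  Xm : pt -> pt
}.

Section System.
Variable Z : filippov.

Definition Sigma : set2 := fun q => dom Z q /\ h Z q = 0.
Definition Sigma_p : set2 := fun q => dom Z q /\ 0 < h Z q.
Definition Sigma_m : set2 := fun q => dom Z q /\ h Z q < 0.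

(** Class [C^r] up to [Sigma]: [Xp] is [C^r] on some open set containing
    [Sigma_p] and [Sigma], hence extends across [Sigma]; likewise [Xm]. *)
Definition filippov_class (r : nat) : Prop :=
  open (dom Z) /\
  (forall i, Ck_on i (dom Z) (h Z)) /\
  (forall q, Sigma q -> ~ (d1 (h Z) q = 0 /\ d2 (h Z) q = 0)) /\
  connected Sigma /\
  (exists U : set2, open U /\ subset (union Sigma_p Sigma) U /\
                    Ck_field_on r U (Xp Z)) /\
  (exists U : set2, open U /\ subset (union Sigma_m Sigma) U /\
                    Ck_field_on r U (Xm Z)).

Definition Xph : pt -> R := lie (Xp Z) (h Z).
Definition Xmh : pt -> R := lie (Xm Z) (h Z).

Definition Sigma_c : set2 := fun q => Sigma q /\ Xph q * Xmh q > 0.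
Definition Sigma_s : set2 := fun q => Sigma q /\ Xph q * Xmh q < 0.
Definition tangential : set2 := fun q => Sigma q /\ Xph q * Xmh q = 0.

Definition Zs (q : pt) : pt :=
  ((Xmh q * fst (Xp Z q) - Xph q * fst (Xm Z q)) / (Xmh q - Xph q),
   (Xmh q * snd (Xp Z q) - Xph q * snd (Xm Z q)) / (Xmh q - Xph q)).

Definition Sigma_singularity : set2 :=
  fun q => tangential q \/ (Sigma_s q /\ Zs q = (0, 0)).

(** A Filippov trajectory on [[a, b]]: a continuous curve which, between
    finitely many times, lies in [Sigma_p], [Sigma_m] or [Sigma_s] and follows
    [Xp], [Xm] or [Zs] there.  Continuity leaves no freedom at a crossing
    point: the only way to pass through it is to concatenate an orbit of one
    field with an orbit of the other. *)
Definition follows (X : pt -> pt) (A : set2) (g : R -> pt) (a b : R) : Prop :=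
  forall t, a < t < b -> A (g t) /\ velocity g t (X (g t)).

Definition trajectory (g : R -> pt) (a b : R) : Prop :=
  (forall t, a <= t <= b -> dom Z (g t) /\ continuous g t) /\
  exists (N : nat) (s : nat -> R),
    s 0%nat = a /\ s N = b /\
    forall i, (i < N)%nat ->
      s i < s (S i) /\
      (follows (Xp Z) Sigma_p g (s i) (s (S i)) \/
       follows (Xm Z) Sigma_m g (s i) (s (S i)) \/
       follows Zs Sigma_s g (s i) (s (S i))).

Definition visible_regular_tangential (k : nat) (p : pt) : Prop :=
  Sigma p /\
  (forall i, (1 <= i <= 2 * k - 1)%nat -> lie_iter (Xp Z) i (h Z) p = 0) /\
  lie_iter (Xp Z) (2 * k) (h Z) p > 0 /\
  Xmh p <> 0.

Definition delta_u : R := 1.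
Definition delta_s : R := -1.

Definition separatrix (X : pt -> pt) (A : set2) (delta : R) (p : pt) : set2 :=
  fun q => exists (g : R -> pt) (t : R),
    delta * t > 0 /\ g 0 = p /\ g t = q /\
    (forall s, Rmin 0 t <= s <= Rmax 0 t ->
       dom Z (g s) /\ velocity g s (X (g s))) /\
    (forall s, Rmin 0 t < s < Rmax 0 t -> A (g s)).

Definition W_t (delta : R) (p : pt) : set2 := separatrix (Xp Z) Sigma_p delta p.
Definition W_pf (delta : R) (p : pt) : set2 := separatrix (Xm Z) Sigma_m delta p.

(** A regular orbit, parametrized by time on the open interval [(a, b)].
    Crossing points are isolated in time, which rules out curves running along
    [Sigma_c]. *)
Definition regular_orbit (g : R -> pt) (a b : Rbar) : Prop :=
  forall t : R, Rbar_lt a t -> Rbar_lt t b ->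
    dom Z (g t) /\ continuous g t /\
    (Sigma_p (g t) -> velocity g t (Xp Z (g t)) /\ Xp Z (g t) <> (0, 0)) /\
    (Sigma_m (g t) -> velocity g t (Xm Z (g t)) /\ Xm Z (g t) <> (0, 0)) /\
    (Sigma (g t) ->
       Sigma_c (g t) /\
       exists d, 0 < d /\
         forall s, 0 < Rabs (s - t) < d -> ~ Sigma (g s)).

(** [c] runs through the regular orbit [g], defined on [(a, b)], as its own
    argument increases from [u] to [v]. *)
Definition runs_through (c : R -> pt) (u v : R)
    (g : R -> pt) (a b : Rbar) : Prop :=
  exists theta : R -> R,
    (forall s s', u < s -> s < s' -> s' < v -> theta s < theta s') /\
    (forall s, u < s < v ->
       Rbar_lt a (theta s) /\ Rbar_lt (theta s) b /\ c s = g (theta s)) /\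
    (forall t : R, Rbar_lt a t -> Rbar_lt t b ->
       exists s, u < s < v /\ theta s = t).

Definition first_return_in (U S : set2) (q q' : pt) : Prop :=
  exists (g : R -> pt) (T : R),
    0 < T /\ trajectory g 0 T /\ g 0 = q /\ g T = q' /\ S q' /\
    (forall t, 0 < t < T -> ~ S (g t)) /\
    (forall t, 0 <= t <= T -> U (g t)).

(** The section is [{q + s v : |s| < eta}], transversal to [Gamma] at a point
    [q] outside [Sigma]; the side of [Gamma] is [{s > 0}] (the sign of [v] is
    free).  The map is defined for small [s > 0] by trajectories close to
    [Gamma], and non-constant means non-constant as a germ at [0]. *)
Definition has_nonconstant_return_map (Gamma : set2) : Prop :=
  exists (q v : pt) (eta : R) (pi : R -> R),
    let sigma s := (fst q + s * fst v, snd q + s * snd v) in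
    let transversal X := fst (X q) * snd v - snd (X q) * fst v <> 0 in
    let section := fun z => exists s, Rabs s < eta /\ z = sigma s in
    Gamma q /\
    ((Sigma_p q /\ transversal (Xp Z)) \/ (Sigma_m q /\ transversal (Xm Z))) /\
    0 < eta /\
    (forall U : set2, open U -> subset Gamma U ->
       exists d, 0 < d < eta /\
         forall s, 0 < s < d ->
           Rabs (pi s) < eta /\
           first_return_in U section (sigma s) (sigma (pi s))) /\
    filterlim pi (at_right 0) (locally 0) /\
    (forall d, 0 < d ->
       exists s s', 0 < s < d /\ 0 < s' < d /\ pi s <> pi s').

(** [ps] lists the singularities [p_1, ..., p_N]; the curve is parametrized by
    an [N]-periodic [c] with [c i = p_(i+1)], the [i]-th regular orbit being
    run through for arguments in [(i, i+1)].  As orbits have corners on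
    [Sigma_c], immersion is meant topologically: [c] is locally injective. *)
Definition sigma_polycycle (ps : list pt) (Gamma : set2) : Prop :=
  ps <> [] /\
  (forall p, In p ps -> Sigma_singularity p) /\
  (exists c : R -> pt,
     (forall s, continuous c s) /\
     (forall s, c (s + INR (length ps)) = c s) /\
     (forall s, exists d, 0 < d /\
        forall s1 s2, Rabs (s1 - s) < d -> Rabs (s2 - s) < d ->
          c s1 = c s2 -> s1 = s2) /\
     (forall i, (i < length ps)%nat ->
        c (INR i) = nth i ps (0, 0) /\
        exists (g : R -> pt) (a b : Rbar),
          Rbar_lt a b /\ regular_orbit g a b /\
          runs_through c (INR i) (INR i + 1) g a b) /\
     (forall q, Gamma q <-> exists s, c s = q)) /\
  has_nonconstant_return_map Gamma.

Definition polycycle_type_b (k : nat) (p : pt) (Gamma : set2) : Prop :=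
  sigma_polycycle [p] Gamma /\
  visible_regular_tangential k p /\
  (subset (union (W_pf delta_s p) (W_t delta_u p)) Gamma \/
   subset (union (W_pf delta_u p) (W_t delta_s p)) Gamma).

End System.

Definition monotonic_transition (r : nat) (Phi : R -> R) : Prop :=
  exists phi : R -> R,
    (forall i x, ex_derive_n phi i x) /\
    phi 1 = 1 /\ phi (-1) = -1 /\
    (forall i, (1 <= i <= r)%nat ->
       Derive_n phi i 1 = 0 /\ Derive_n phi i (-1) = 0) /\
    (forall s, -1 < s < 1 -> Derive phi s > 0) /\
    (forall s, Rabs s <= 1 -> Phi s = phi s) /\
    (forall s, Rabs s >= 1 -> Phi s = sign s).

Definition Ck_at (r : nat) (f : R -> R) (x : R) : Prop :=
  exists d, 0 < d /\
    forall t, Rabs (t - x) < d ->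
      forall i, (i <= r)%nat ->
        ex_derive_n f i t /\ continuous (Derive_n f i) t.

Definition C_ST (r : nat) (Phi : R -> R) : Prop :=
  monotonic_transition r Phi /\
  ~ Ck_at (S r) Phi 1 /\ ~ Ck_at (S r) Phi (-1).

Definition regularization (Z : filippov) (Phi : R -> R) (eps : R) : pt -> pt :=
  fun q =>
    let lp := (1 + Phi (h Z q / eps)) / 2 in
    let lm := (1 - Phi (h Z q / eps)) / 2 in
    (lp * fst (Xp Z q) + lm * fst (Xm Z q),
     lp * snd (Xp Z q) + lm * snd (Xm Z q)).

Definition periodic_orbit (D : set2) (F : pt -> pt) (G : set2) : Prop :=
  exists (g : R -> pt) (T : R),
    0 < T /\
    (forall t, D (g t) /\ velocity g t (F (g t))) /\
    (forall t, g (t + T) = g t) /\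
    (exists t, g t <> g 0) /\
    (forall q, G q <-> exists t, g t = q).

(** A limit cycle is an isolated periodic orbit: no other periodic orbit meets
    some neighbourhood of it. *)
Definition limit_cycle (D : set2) (F : pt -> pt) (G : set2) : Prop :=
  periodic_orbit D F G /\
  exists U : set2, open U /\ subset G U /\
    forall G' : set2, periodic_orbit D F G' ->
      (exists q, G' q /\ U q) ->
      forall q, G' q <-> G q.

Definition converges_to (Geps : R -> set2) (Gamma : set2) : Prop :=
  forall U : set2, open U -> subset Gamma U ->
    exists eps1, 0 < eps1 /\
      forall eps, 0 < eps < eps1 -> subset (Geps eps) U.

(* Main.v *)
(* Near p the shear u = x - al y makes u increase along both fields, so that
   orbits of the regularized system are graphs of solutions of a scalar
   equation dy/du = F(u, y).  Since Xm points up and Xp is nearly horizontal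
   there, F is one-sided Lipschitz in y uniformly in eps, and translating a
   solution in u shows that the passage near p contracts by a factor tending
   to 0 with eps.  Along the rest of Gamma, the Lipschitz constant of order
   1/eps in the strip |y| < eps is compensated by the O(eps) time spent there
   at a crossing, so orbits are close to Gamma and the time maps are Lipschitz
   uniformly in eps.  The first return map on a section below p is therefore a
   contraction: its fixed point is the limit cycle, and it tends to Gamma. *)
Require Import Defs.
From Stdlib Require Import Reals List Lra Lia Psatz ZArith Classical IndefiniteDescription.
From Coquelicot Require Import Coquelicot.
Open Scope R_scope.

(** * Gronwall inequalities *)

(** The obstacle is the slope of order 1/eps of the transition weight: a plain Gronwall estimate
    through the strip would cost a factor exp(C/eps). Near p this large derivative has a favourable
    sign: as y increases, weight moves from [Xm] to [Xp], whose slope is smaller, so the weight only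
    lowers F, and the one-sided bound sees just the eps-free variation of the two fields. The order
    of choices matters. The Lipschitz constants of the transit along Gamma and of the projection
    onto the section are fixed first; the contraction factor at p is then half the inverse of their
    product. This is why the passage near p must contract by any prescribed factor. The fields are
    controlled near Gamma only. For each eps the regularization is therefore replaced by a complete
    field that agrees with it near Gamma. The speed bound of this field is uniform in eps; its
    Lipschitz constant is not, and it serves only for uniqueness, for the flow property and for
    choosing small scales, never in a final estimate. *)

Ltac le_min :=
  first [ apply Rle_refl
        | eapply Rle_trans; [apply Rmin_l|le_min]
        | eapply Rle_trans; [apply Rmin_r|le_min] ].

Lemma is_derive_continuity_pt (f : R -> R) (x l : R) :
  is_derive f x l -> continuity_pt f x.
Proof.
  intros H. apply continuity_pt_filterlim.
  apply (ex_derive_continuous f). exists l. exact H.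
Qed.

Lemma derive_nonpos_le (f df : R -> R) (a b : R) :
  a <= b ->
  (forall x, a <= x <= b -> is_derive f x (df x)) ->
  (forall x, a < x < b -> df x <= 0) -> f b <= f a.
Proof.
  intros Hab Hd Hn.
  destruct (Rle_lt_or_eq_dec _ _ Hab) as [Hlt| ->]; [|lra].
  destruct (MVT_cor2 f df a b Hlt) as [x [Hx Hx']].
  - intros x Hx. apply is_derive_Reals. auto.
  - specialize (Hn x Hx'). nra.
Qed.

Lemma derive_ge_increase (f df : R -> R) (a b c : R) :
  a <= b ->
  (forall x, a <= x <= b -> is_derive f x (df x)) ->
  (forall x, a < x < b -> c <= df x) -> f a + c * (b - a) <= f b.
Proof.
  intros Hab Hd Hc.
  destruct (Rle_lt_or_eq_dec _ _ Hab) as [Hlt| ->]; [|lra].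
  destruct (MVT_cor2 f df a b Hlt) as [x [Hx Hx']].
  - intros x Hx. apply is_derive_Reals. auto.
  - specialize (Hc x Hx'). nra.
Qed.

Lemma derive_le_increase (f df : R -> R) (a b c : R) :
  a <= b ->
  (forall x, a <= x <= b -> is_derive f x (df x)) ->
  (forall x, a < x < b -> df x <= c) -> f b <= f a + c * (b - a).
Proof.
  intros Hab Hd Hc.
  destruct (Rle_lt_or_eq_dec _ _ Hab) as [Hlt| ->]; [|lra].
  destruct (MVT_cor2 f df a b Hlt) as [x [Hx Hx']].
  - intros x Hx. apply is_derive_Reals. auto.
  - specialize (Hc x Hx'). nra.
Qed.

(** Compactness of [a, b] in the form used throughout: [P] only has to pass from some [s1] just left
    of any [s] to every [s2] just right of it, so openness and closedness are handled by a single
    hypothesis. *)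
Lemma interval_induction (P : R -> Prop) (a b : R) :
  a <= b -> P a ->
  (forall s, a <= s <= b -> exists d, 0 < d /\
     forall s1 s2, s - d < s1 <= s -> s <= s2 < s + d -> a <= s1 -> s2 <= b ->
       P s1 -> P s2) ->
  P b.
Proof.
  intros Hab Ha Hstep.
  destruct (completeness (fun x => a <= x <= b /\ P x)) as [m [Hub Hlub]].
  - exists b. intros x [Hx _]. lra.
  - exists a. split; [lra|exact Ha].
  - assert (Ham : a <= m) by (apply Hub; split; [lra|exact Ha]).
    assert (Hmb : m <= b) by (apply Hlub; intros x [Hx _]; lra).
    destruct (Hstep m (conj Ham Hmb)) as [d [Hd Hs]].
    assert (Hx : exists x, m - d < x /\ a <= x <= b /\ P x).
    { apply NNPP. intros Hn.
      assert (m <= m - d); [|lra].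
      apply Hlub. intros x Hx. apply Rnot_lt_le. intros Hlt.
      apply Hn. exists x. split; [exact Hlt|exact Hx]. }
    destruct Hx as [x [Hx1 [Hx2 Hx3]]].
    assert (Hxm : x <= m) by (apply Hub; split; assumption).
    (* The step across the supremum [m] either lands at [m + d / 2], which is impossible, or is cut
       off at [b], which is the claim. *)
    assert (HP : P (Rmin b (m + d / 2))).
    { apply (Hs x).
      - lra.
      - unfold Rmin; destruct Rle_dec; lra.
      - lra.
      - apply Rmin_l.
      - exact Hx3. }
    assert (Hle : Rmin b (m + d / 2) <= m).
    { apply Hub. split; [|exact HP]. split; [|apply Rmin_l].
      unfold Rmin; destruct Rle_dec; lra. }
    revert HP Hle. unfold Rmin. destruct Rle_dec; [auto|lra].
Qed.

Lemma intermediate_value (f : R -> R) (a b y : R) :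
  a <= b -> (forall x, a <= x <= b -> continuity_pt f x) ->
  f a <= y <= f b -> exists x, a <= x <= b /\ f x = y.
Proof.
  intros Hab Hc Hy.
  destruct (Rle_lt_or_eq_dec _ _ Hab) as [Hlt| ->].
  2: { exists b. lra. }
  destruct (Req_dec (f a) y) as [Ea|Na]; [exists a; lra|].
  destruct (Req_dec (f b) y) as [Eb|Nb]; [exists b; lra|].
  destruct (Ranalysis5.IVT_interv (fun x => f x - y) a b) as [x [Hx Hx']].
  - intros x Hx. apply continuity_pt_minus; [auto|].
    apply continuity_pt_const. intros u v; reflexivity.
  - exact Hlt.
  - lra.
  - lra.
  - exists x. lra.
Qed.

Lemma is_derive_exp_neg (M u0 x : R) :
  is_derive (fun u => exp (- M * (u - u0))) x (- M * exp (- M * (x - u0))).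
Proof. auto_derive; [auto|]. unfold Rminus. ring. Qed.

(* Only the part of the curve after the last zero of D matters, so the
   differential inequality is required where D > 0 only. *)
Lemma gronwall_one_sided (D dD : R -> R) (u0 u1 M e : R) :
  0 <= M -> 0 <= e ->  u0 <= u1 ->
  (forall u, u0 <= u <= u1 -> is_derive D u (dD u)) ->
  (forall u, u0 <= u <= u1 -> 0 < D u -> dD u <= M * D u + e) ->
  D u1 <= (Rmax (D u0) 0 + e * (u1 - u0)) * exp (M * (u1 - u0)).
Proof.
  intros HM He Hu Hd Hi.
  assert (HE : 1 <= exp (M * (u1 - u0))).
  { rewrite <- exp_0. destruct (Rle_lt_or_eq_dec 0 (M * (u1 - u0))) as [H|H].
    nra. left; apply exp_increasing; auto. rewrite <- H; lra. }
  assert (Hm0 : 0 <= Rmax (D u0) 0) by apply Rmax_r.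
  assert (Hm1 : D u0 <= Rmax (D u0) 0) by apply Rmax_l.
  assert (He' : 0 <= e * (u1 - u0)) by nra.
  destruct (Rle_lt_dec (D u1) 0) as [Hneg|Hpos].
  { nra. }
  assert (Hs : exists s, u0 <= s <= u1 /\ D s <= Rmax (D u0) 0 /\
     forall u, s < u <= u1 -> 0 < D u).
  { destruct (classic (forall u, u0 <= u <= u1 -> 0 < D u)) as [Hall|Hn].
    { exists u0. split; [lra|split; [auto|]]. intros u Hu'; apply Hall; lra. }
    apply not_all_ex_not in Hn. destruct Hn as [v Hv].
    apply imply_to_and in Hv. destruct Hv as [Hv Hv'].
    apply Rnot_lt_le in Hv'.
    destruct (completeness (fun x => u0 <= x <= u1 /\ D x <= 0)) as [s [Hub Hlub]].
    - exists u1. intros x [Hx _]; lra.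
    - exists v. auto.
    - assert (Hvs : v <= s) by (apply Hub; auto).
      assert (Hsu : s <= u1) by (apply Hlub; intros x [Hx _]; lra).
      assert (Hafter : forall u, s < u <= u1 -> 0 < D u).
      { intros u Hu'. apply Rnot_le_lt. intros Hle.
        assert (u <= s); [|lra]. apply Hub. split; [lra|exact Hle]. }
      exists s. split; [lra|]. split; [|exact Hafter].
      assert (D s <= 0); [|lra].
      apply Rnot_lt_le. intros Hlt.
      assert (Hc : continuity_pt D s).
      { apply (is_derive_continuity_pt _ _ (dD s)). apply Hd. lra. }
      destruct (Hc (D s) Hlt) as [al [Hal Hc']].
      assert (s <= s - al); [|lra].
      apply Hlub. intros x [Hx Hx']. apply Rnot_lt_le. intros Hlt'.
      assert (Hxs : x <= s) by (apply Hub; auto).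
      destruct (Req_dec x s) as [->|Hne]; [lra|].
      specialize (Hc' x). simpl in Hc'. unfold Rdist in Hc'.
      assert (Rabs (D x - D s) < D s).
      { apply Hc'. split. split; [exact I|auto].
        rewrite Rabs_left1; lra. }
      apply Rabs_def2 in H. lra. }
  destruct Hs as [s [Hs1 [Hs2 Hs3]]].
  (* Integrating factor for [M]. The forcing [e] is subtracted undamped, which is harmless because
     the exponential is at most 1 to the right of [s]. *)
  set (K := fun u => D u * exp (- M * (u - s)) - e * (u - s)).
  assert (HK : K u1 <= K s).
  { apply (derive_nonpos_le K
      (fun u => dD u * exp (- M * (u - s)) + D u * (- M * exp (- M * (u - s))) - e)).
    - lra.
    - intros x Hx. unfold K.
      apply (is_derive_minus (V := R_NormedModule)).
      + apply (is_derive_mult (K := R_AbsRing) D (fun u => exp (- M * (u - s)))).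
        apply Hd; lra. apply is_derive_exp_neg. intros; apply Rmult_comm.
      + auto_derive; [auto|ring].
    - intros x Hx.
      assert (0 < exp (- M * (x - s))) by apply exp_pos.
      assert (exp (- M * (x - s)) <= 1).
      { rewrite <- exp_0. destruct (Rle_lt_or_eq_dec (- M * (x - s)) 0) as [h1|h1].
        nra. left; apply exp_increasing; auto. rewrite h1; lra. }
      assert (dD x <= M * D x + e) by (apply Hi; [lra|apply Hs3; lra]).
      nra. }
  unfold K in HK. replace (s - s) with 0 in HK by ring.
  rewrite !Rmult_0_r, exp_0 in HK.
  assert (E1 : exp (- M * (u1 - s)) * exp (M * (u1 - s)) = 1).
  { rewrite <- exp_plus. rewrite <- exp_0. f_equal. ring. }
  assert (Hpe : 0 < exp (M * (u1 - s))) by apply exp_pos.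
  assert (E2 : exp (M * (u1 - s)) <= exp (M * (u1 - u0))).
  { destruct (Rle_lt_or_eq_dec (M * (u1 - s)) (M * (u1 - u0))) as [h1|h1].
    nra. left; apply exp_increasing; auto. rewrite h1; lra. }
  assert (H3 : D u1 = D u1 * exp (- M * (u1 - s)) * exp (M * (u1 - s))).
  { rewrite Rmult_assoc, E1. ring. }
  rewrite H3.
  apply Rle_trans with ((Rmax (D u0) 0 + e * (u1 - u0)) * exp (M * (u1 - s))).
  - apply Rmult_le_compat_r; [lra|]. nra.
  - apply Rmult_le_compat_l; [lra|exact E2].
Qed.

(** * Euclidean distance and curves in the plane *)

(** Euclidean, unlike the balls of the product space, which use the larger of the two coordinate
    distances: with Cauchy-Schwarz the distance of two curves then grows at most at the rate of the
    distance of their velocities, with constant 1. [open_dst] and [dst_open] translate between the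
    two. *)
Definition dst (p q : pt) : R :=
  sqrt ((fst p - fst q) ^ 2 + (snd p - snd q) ^ 2).

Lemma dst_arg_nonneg (p q : pt) : 0 <= (fst p - fst q) ^ 2 + (snd p - snd q) ^ 2.
Proof. apply Rplus_le_le_0_compat; apply pow2_ge_0. Qed.

Lemma dst_nonneg (p q : pt) : 0 <= dst p q.
Proof. apply sqrt_pos. Qed.

Lemma dst_sqr (p q : pt) : dst p q ^ 2 = (fst p - fst q) ^ 2 + (snd p - snd q) ^ 2.
Proof. unfold dst. rewrite pow2_sqrt; [reflexivity|apply dst_arg_nonneg]. Qed.

Lemma dst_sym (p q : pt) : dst p q = dst q p.
Proof. unfold dst. f_equal. ring. Qed.

Lemma dst_refl (p : pt) : dst p p = 0.
Proof.
  unfold dst. replace (_ + _) with 0 by ring. apply sqrt_0.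
Qed.

Lemma dst_eq0 (p q : pt) : dst p q <= 0 -> p = q.
Proof.
  intros H. pose proof (dst_nonneg p q). pose proof (dst_sqr p q) as E.
  replace (dst p q) with 0 in E by lra.
  pose proof (pow2_ge_0 (fst p - fst q)) as H1.
  pose proof (pow2_ge_0 (snd p - snd q)) as H2.
  destruct p as [p1 p2], q as [q1 q2]; cbn [fst snd] in *.
  assert (E1 : Rsqr (p1 - q1) = 0) by (rewrite Rsqr_pow2; lra).
  assert (E2 : Rsqr (p2 - q2) = 0) by (rewrite Rsqr_pow2; lra).
  apply Rsqr_0_uniq in E1. apply Rsqr_0_uniq in E2. f_equal; lra.
Qed.

Lemma dst_fst (p q : pt) : Rabs (fst p - fst q) <= dst p q.
Proof.
  apply Rsqr_incr_0_var; [|apply dst_nonneg].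
  rewrite <- Rsqr_abs. rewrite !Rsqr_pow2, dst_sqr.
  pose proof (pow2_ge_0 (fst p - fst q)). pose proof (pow2_ge_0 (snd p - snd q)). lra.
Qed.

Lemma dst_snd (p q : pt) : Rabs (snd p - snd q) <= dst p q.
Proof.
  apply Rsqr_incr_0_var; [|apply dst_nonneg].
  rewrite <- Rsqr_abs. rewrite !Rsqr_pow2, dst_sqr.
  pose proof (pow2_ge_0 (fst p - fst q)). pose proof (pow2_ge_0 (snd p - snd q)). lra.
Qed.

Lemma dst_le_sum (p q : pt) :
  dst p q <= Rabs (fst p - fst q) + Rabs (snd p - snd q).
Proof.
  pose proof (Rabs_pos (fst p - fst q)). pose proof (Rabs_pos (snd p - snd q)).
  apply Rsqr_incr_0_var; [|lra].
  rewrite !Rsqr_pow2, dst_sqr.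
  rewrite <- (pow2_abs (fst p - fst q)), <- (pow2_abs (snd p - snd q)). nra.
Qed.

Lemma sqrt_sum_triangle (a b c d : R) :
  sqrt ((a + c) ^ 2 + (b + d) ^ 2) <= sqrt (a ^ 2 + b ^ 2) + sqrt (c ^ 2 + d ^ 2).
Proof.
  pose proof (sqrt_pos (a ^ 2 + b ^ 2)). pose proof (sqrt_pos (c ^ 2 + d ^ 2)).
  assert (Ea : sqrt (a ^ 2 + b ^ 2) ^ 2 = a ^ 2 + b ^ 2) by (apply pow2_sqrt; nra).
  assert (Ec : sqrt (c ^ 2 + d ^ 2) ^ 2 = c ^ 2 + d ^ 2) by (apply pow2_sqrt; nra).
  assert (Hcs : a * c + b * d <= sqrt (a ^ 2 + b ^ 2) * sqrt (c ^ 2 + d ^ 2)).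
  { apply Rle_trans with (Rabs (a * c + b * d)); [apply Rle_abs|].
    apply Rsqr_incr_0_var; [|nra].
    rewrite <- Rsqr_abs, !Rsqr_pow2, Rpow_mult_distr, Ea, Ec.
    pose proof (pow2_ge_0 (a * d - b * c)). nra. }
  apply Rsqr_incr_0_var; [|lra].
  rewrite !Rsqr_pow2, pow2_sqrt; [nra|].
  pose proof (pow2_ge_0 (a + c)). pose proof (pow2_ge_0 (b + d)). lra.
Qed.

Lemma dst_triangle (p q r : pt) : dst p r <= dst p q + dst q r.
Proof.
  unfold dst. eapply Rle_trans; [|apply sqrt_sum_triangle].
  right. f_equal. ring.
Qed.

Lemma dst_lt_of_abs (p q : pt) (e : R) :
  Rabs (fst p - fst q) < e / 2 -> Rabs (snd p - snd q) < e / 2 -> dst p q < e.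
Proof. intros. pose proof (dst_le_sum p q). lra. Qed.

Lemma open_dst (U : set2) (q : pt) :
  open U -> U q -> exists r, 0 < r /\ forall z, dst z q < r -> U z.
Proof.
  intros HU Hq. destruct (HU q Hq) as [e He].
  exists e. split; [apply cond_pos|]. intros z Hz. apply He.
  split; simpl; unfold ball; simpl; unfold AbsRing_ball, abs, minus, plus, opp; simpl.
  - pose proof (dst_fst z q). unfold Rminus in *. lra.
  - pose proof (dst_snd z q). unfold Rminus in *. lra.
Qed.

Lemma dst_open (U : set2) :
  (forall q, U q -> exists r, 0 < r /\ forall z, dst z q < r -> U z) -> open U.
Proof.
  intros H q Hq. destruct (H q Hq) as [r [Hr Hz]].
  assert (Hr2 : 0 < r / 2) by lra.
  exists (mkposreal _ Hr2). intros z [H1 H2]. apply Hz.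
  unfold ball in H1, H2; simpl in H1, H2.
  apply dst_lt_of_abs; assumption.
Qed.

Lemma continuous_dst (g : R -> pt) (t e : R) :
  continuous g t -> 0 < e ->
  exists d, 0 < d /\ forall s, Rabs (s - t) < d -> dst (g s) (g t) < e.
Proof.
  intros Hg He.
  assert (He2 : 0 < e / 2) by lra.
  destruct (Hg (fun z => ball (g t) (mkposreal _ He2) z)) as [d Hd].
  { exists (mkposreal _ He2). auto. }
  exists d. split; [apply cond_pos|]. intros s Hs.
  destruct (Hd s Hs) as [H1 H2]. unfold ball in H1, H2; simpl in H1, H2.
  apply dst_lt_of_abs; assumption.
Qed.

Lemma velocity_continuous (g : R -> pt) (t : R) (v : pt) :
  velocity g t v -> forall e, 0 < e ->
  exists d, 0 < d /\ forall s, Rabs (s - t) < d -> dst (g s) (g t) < e.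
Proof.
  intros [H1 H2] e He.
  apply is_derive_continuity_pt in H1. apply is_derive_continuity_pt in H2.
  assert (He2 : 0 < e / 2) by lra.
  destruct (H1 _ He2) as [d1 [Hd1 H1']]. destruct (H2 _ He2) as [d2 [Hd2 H2']].
  exists (Rmin d1 d2). split; [apply Rmin_glb_lt; auto|].
  intros s Hs.
  assert (Rabs (s - t) < d1 /\ Rabs (s - t) < d2) as [Ha Hb].
  { split; eapply Rlt_le_trans; eauto; [apply Rmin_l|apply Rmin_r]. }
  destruct (Req_dec s t) as [->|Hne]; [rewrite dst_refl; lra|].
  apply dst_lt_of_abs.
  - apply (H1' s). split; [split; [exact I|auto]|exact Ha].
  - apply (H2' s). split; [split; [exact I|auto]|exact Hb].
Qed.

Lemma velocity_const (z : pt) (t : R) : velocity (fun _ => z) t (0, 0).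
Proof. split; simpl; apply (is_derive_const (V := R_NormedModule)). Qed.

Lemma velocity_shift (g : R -> pt) (a t : R) (v : pt) :
  velocity g (a + t) v -> velocity (fun s => g (a + s)) t v.
Proof.
  intros [H1 H2]. split.
  - evar_last. apply (is_derive_comp (fun s => fst (g s)) (fun s => a + s)).
    exact H1. auto_derive; auto. unfold scal; simpl; unfold mult; simpl; ring.
  - evar_last. apply (is_derive_comp (fun s => snd (g s)) (fun s => a + s)).
    exact H2. auto_derive; auto. unfold scal; simpl; unfold mult; simpl; ring.
Qed.

Lemma velocity_reverse (g : R -> pt) (a t : R) (v : pt) :
  velocity g (a - t) v -> velocity (fun s => g (a - s)) t (- fst v, - snd v).
Proof.
  intros [H1 H2]. split; simpl.
  - evar_last. apply (is_derive_comp (fun s => fst (g s)) (fun s => a - s)).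
    exact H1. auto_derive; auto. unfold scal; simpl; unfold mult; simpl; ring.
  - evar_last. apply (is_derive_comp (fun s => snd (g s)) (fun s => a - s)).
    exact H2. auto_derive; auto. unfold scal; simpl; unfold mult; simpl; ring.
Qed.

Lemma velocity_ext (g g' : R -> pt) (t : R) (v : pt) (d : R) :
  0 < d -> (forall s, Rabs (s - t) < d -> g s = g' s) ->
  velocity g t v -> velocity g' t v.
Proof.
  intros Hd He [H1 H2].
  split; [apply (is_derive_ext_loc (fun s => fst (g s)))|
          apply (is_derive_ext_loc (fun s => snd (g s)))]; auto;
  exists (mkposreal d Hd); intros s Hs; simpl; f_equal; apply He; exact Hs.
Qed.

Lemma velocity_unique (g : R -> pt) (t : R) (v w : pt) :
  velocity g t v -> velocity g t w -> v = w.
Proof.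
  intros [H1 H2] [H3 H4].
  apply is_derive_unique in H1, H2, H3, H4.
  destruct v, w; simpl in *; congruence.
Qed.

Lemma is_derive_sum_sqr (f1 f2 g1 g2 : R -> R) (d t a1 a2 b1 b2 : R) :
  is_derive f1 t a1 -> is_derive f2 t a2 ->
  is_derive g1 t b1 -> is_derive g2 t b2 ->
  is_derive (fun t => (f1 t - f2 t) ^ 2 + (g1 t - g2 t) ^ 2 + d ^ 2) t
    (2 * ((f1 t - f2 t) * (a1 - a2) + (g1 t - g2 t) * (b1 - b2))).
Proof.
  intros H1 H2 H3 H4. auto_derive.
  - repeat split; eexists; eauto.
  - apply is_derive_unique in H1, H2, H3, H4.
    change (fun x : R => f1 x) with f1. change (fun x : R => f2 x) with f2.
    change (fun x : R => g1 x) with g1. change (fun x : R => g2 x) with g2.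
    rewrite H1, H2, H3, H4.
    ring.
Qed.

(** Cauchy-Schwarz. The left side is the derivative of the smoothed distance of two curves at p and
    q with velocities v and w. *)
Lemma dst_derive_bound (p q v w : pt) (d : R) : 0 < d ->
  ((fst p - fst q) * (fst v - fst w) + (snd p - snd q) * (snd v - snd w)) /
    sqrt (dst p q ^ 2 + d ^ 2) <= dst v w.
Proof.
  intros Hd.
  assert (Hp : 0 < sqrt (dst p q ^ 2 + d ^ 2)).
  { apply sqrt_lt_R0. pose proof (dst_nonneg p q). nra. }
  apply Rle_div_l; [exact Hp|].
  set (a := fst p - fst q). set (b := snd p - snd q).
  set (c := fst v - fst w). set (e := snd v - snd w).
  assert (Ea : sqrt (dst p q ^ 2 + d ^ 2) ^ 2 = a ^ 2 + b ^ 2 + d ^ 2).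
  { rewrite pow2_sqrt, dst_sqr. reflexivity. pose proof (dst_nonneg p q). nra. }
  assert (Ec : dst v w ^ 2 = c ^ 2 + e ^ 2) by apply dst_sqr.
  pose proof (dst_nonneg v w).
  apply Rle_trans with (Rabs (a * c + b * e)); [apply Rle_abs|].
  apply Rsqr_incr_0_var; [|nra].
  rewrite <- Rsqr_abs, !Rsqr_pow2, Rpow_mult_distr, Ea, Ec.
  pose proof (pow2_ge_0 (a * e - b * c)).
  assert (0 <= d ^ 2 * (c ^ 2 + e ^ 2)) by nra. nra.
Qed.

Lemma exp_nonneg_ge1 (x : R) : 0 <= x -> 1 <= exp x.
Proof.
  intros H. rewrite <- exp_0. destruct (Rle_lt_or_eq_dec _ _ H) as [h1| <-].
  left; apply exp_increasing; auto. lra.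
Qed.

Lemma exp_le (x y : R) : x <= y -> exp x <= exp y.
Proof.
  intros H. destruct (Rle_lt_or_eq_dec _ _ H) as [h1| ->].
  left; apply exp_increasing; auto. lra.
Qed.

Lemma derive_nonneg_mono (f df : R -> R) (a b : R) :
  a <= b ->
  (forall x, a <= x <= b -> is_derive f x (df x)) ->
  (forall x, a <= x <= b -> 0 <= df x) -> f a <= f b.
Proof.
  intros Hab Hd Hc. pose proof (derive_ge_increase f df a b 0 Hab Hd).
  assert (f a + 0 * (b - a) <= f b); [|lra]. apply H. intros; apply Hc; lra.
Qed.

(* The distance is not differentiable at 0, so it is replaced by
   sqrt (dst^2 + d^2) with d -> 0. *)
Lemma gronwall_plane (x1 x2 v1 v2 : R -> pt) (A dA e de : R -> R) (t0 t1 : R) :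
  t0 <= t1 ->
  (forall t, t0 <= t <= t1 -> velocity x1 t (v1 t)) ->
  (forall t, t0 <= t <= t1 -> velocity x2 t (v2 t)) ->
  (forall t, t0 <= t <= t1 -> is_derive A t (dA t) /\ 0 <= dA t) ->
  (forall t, t0 <= t <= t1 -> is_derive e t (de t) /\ 0 <= de t) ->
  (forall t, t0 <= t <= t1 ->
     dst (v1 t) (v2 t) <= dA t * dst (x1 t) (x2 t) + de t) ->
  dst (x1 t1) (x2 t1) <=
    exp (A t1 - A t0) * (dst (x1 t0) (x2 t0) + (e t1 - e t0)).
Proof.
  intros Ht Hx1 Hx2 HA He Hv.
  assert (HAm : forall t, t0 <= t <= t1 -> A t0 <= A t).
  { intros t Ht'. apply (derive_nonneg_mono A dA); [lra| |];
    intros x Hx; apply HA; lra. }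
  assert (Hd : forall d, 0 < d ->
    dst (x1 t1) (x2 t1) <= exp (A t1 - A t0) * (dst (x1 t0) (x2 t0) + d + (e t1 - e t0))).
  { intros d Hd.
    set (Q := fun t => dst (x1 t) (x2 t) ^ 2 + d ^ 2).
    assert (HQ : forall t, 0 < Q t).
    { intros t. unfold Q. pose proof (dst_nonneg (x1 t) (x2 t)). nra. }
    set (IP := fun t => (fst (x1 t) - fst (x2 t)) * (fst (v1 t) - fst (v2 t)) +
                        (snd (x1 t) - snd (x2 t)) * (snd (v1 t) - snd (v2 t))).
    assert (HQd : forall t, t0 <= t <= t1 -> is_derive Q t (2 * IP t)).
    { intros t Ht'. destruct (Hx1 t Ht') as [A1 A2]. destruct (Hx2 t Ht') as [B1 B2].
      apply (is_derive_ext
        (fun t => (fst (x1 t) - fst (x2 t)) ^ 2 + (snd (x1 t) - snd (x2 t)) ^ 2 + d ^ 2)).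
      { intros s. unfold Q. rewrite dst_sqr. reflexivity. }
      exact (is_derive_sum_sqr _ _ _ _ d t _ _ _ _ A1 B1 A2 B2). }
    set (N := fun t => sqrt (Q t)).
    assert (HN : forall t, t0 <= t <= t1 -> is_derive N t (IP t / N t)).
    { intros t Ht'. unfold N. evar_last. apply is_derive_sqrt.
      apply HQd; auto. apply HQ. field.
      apply Rgt_not_eq, sqrt_lt_R0, HQ. }
    assert (HNd : forall t, dst (x1 t) (x2 t) <= N t).
    { intros t. unfold N. apply Rsqr_incr_0_var; [|apply sqrt_pos].
      rewrite !Rsqr_pow2, pow2_sqrt; [unfold Q; nra|left; apply HQ]. }
    (* [A] is an antiderivative of the Lipschitz rate, so a rate that is very large for a short time
       costs only its integral. *)
    set (K := fun t => N t * exp (- (A t - A t0)) - e t).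
    assert (HK : K t1 <= K t0).
    { apply (derive_nonpos_le K (fun t => IP t / N t * exp (- (A t - A t0)) +
        N t * (- dA t * exp (- (A t - A t0))) - de t)).
      - exact Ht.
      - intros t Ht'. unfold K. apply (is_derive_minus (V := R_NormedModule)).
        + apply (is_derive_mult (K := R_AbsRing) N (fun t => exp (- (A t - A t0)))).
          apply HN; auto.
          * destruct (HA t Ht') as [h1 _].
            auto_derive. eexists; eauto.
            apply is_derive_unique in h1. change (fun x : R => A x) with A. rewrite h1.
            unfold Rminus. ring.
          * intros; apply Rmult_comm.
        + apply He; auto.
      - intros t Ht'.
        assert (Ht'' : t0 <= t <= t1) by lra.
        assert (h1 : IP t / N t <= dst (v1 t) (v2 t)) by (apply dst_derive_bound; auto).
        specialize (Hv t Ht''). specialize (HNd t).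
        destruct (HA t Ht'') as [_ h2]. destruct (He t Ht'') as [_ h3].
        specialize (HAm t Ht'').
        assert (h4 : 0 < exp (- (A t - A t0))) by apply exp_pos.
        assert (h5 : exp (- (A t - A t0)) <= 1).
        { rewrite <- exp_0. apply exp_le. lra. }
        assert (h6 : IP t / N t <= dA t * N t + de t) by nra.
        nra. }
    unfold K in HK. replace (A t0 - A t0) with 0 in HK by ring.
    rewrite Ropp_0, exp_0, Rmult_1_r in HK.
    assert (E1 : exp (- (A t1 - A t0)) * exp (A t1 - A t0) = 1).
    { rewrite <- exp_plus. rewrite <- exp_0. f_equal. ring. }
    assert (HN0 : N t0 <= dst (x1 t0) (x2 t0) + d).
    { unfold N. pose proof (dst_nonneg (x1 t0) (x2 t0)).
      apply Rsqr_incr_0_var; [|lra].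
      rewrite !Rsqr_pow2, pow2_sqrt; [unfold Q; nra|left; apply HQ]. }
    assert (hp : 0 < exp (A t1 - A t0)) by apply exp_pos.
    apply Rle_trans with (N t1); [apply HNd|].
    replace (N t1) with (N t1 * exp (- (A t1 - A t0)) * exp (A t1 - A t0)).
    2: { rewrite Rmult_assoc, E1. ring. }
    rewrite (Rmult_comm (exp (A t1 - A t0))).
    apply Rmult_le_compat_r; lra. }
  (* The limit d -> 0: with d = gap / (2 E) a positive excess [gap] would be at most gap / 2. *)
  apply Rnot_lt_le. intros Hlt.
  set (E := exp (A t1 - A t0)) in *.
  assert (hp : 0 < E) by apply exp_pos.
  set (gap := dst (x1 t1) (x2 t1) - E * (dst (x1 t0) (x2 t0) + (e t1 - e t0))).
  assert (Hg : 0 < gap) by (unfold gap; lra).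
  assert (Hd2 : 0 < gap / (2 * E)) by (apply Rdiv_lt_0_compat; lra).
  specialize (Hd _ Hd2).
  assert (E * (gap / (2 * E)) = gap / 2) by (field; lra).
  unfold gap in *. nra.
Qed.

(** * Global solutions of Lipschitz equations *)

Definition lipR (K : R) (f : R -> R) : Prop :=
  forall s t, Rabs (f t - f s) <= K * Rabs (t - s).

Definition lip2 (L : R) (G : pt -> pt) : Prop :=
  forall z w, dst (G z) (G w) <= L * dst z w.

Definition bounded2 (B : R) (G : pt -> pt) : Prop :=
  forall z, dst (G z) (0, 0) <= B.

(** Coordinates are indexed by a boolean so that each Picard estimate is proved once for both. *)
Definition coord (i : bool) (z : pt) : R := if i then fst z else snd z.

Lemma dst_coord (i : bool) (z w : pt) : Rabs (coord i z - coord i w) <= dst z w.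
Proof. destruct i; [apply dst_fst|apply dst_snd]. Qed.

Lemma dst_le_coords (z w : pt) (e : R) :
  (forall i, Rabs (coord i z - coord i w) <= e) -> dst z w <= 2 * e.
Proof.
  intros H. pose proof (H true) as h1. pose proof (H false) as h2.
  pose proof (dst_le_sum z w). unfold coord in *. lra.
Qed.

Lemma coord_ext (z w : pt) : (forall i, coord i z = coord i w) -> z = w.
Proof.
  intros H. pose proof (H true) as h1. pose proof (H false) as h2.
  destruct z, w; unfold coord in *; simpl in *; congruence.
Qed.

Lemma bounded2_coord (B : R) (G : pt -> pt) (i : bool) (z : pt) :
  bounded2 B G -> Rabs (coord i (G z)) <= B.
Proof.
  intros H. pose proof (dst_coord i (G z) (0, 0)) as h.
  replace (coord i (0, 0)) with 0 in h by (destruct i; reflexivity).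
  rewrite Rminus_0_r in h. specialize (H z). lra.
Qed.

Lemma lipR_continuous (K : R) (f : R -> R) : lipR K f -> forall t, continuous f t.
Proof.
  intros H t. apply continuity_pt_filterlim.
  intros e He. exists (e / (Rabs K + 1)).
  assert (hK : 0 < Rabs K + 1) by (pose proof (Rabs_pos K); lra).
  split; [apply Rdiv_lt_0_compat; auto|].
  intros x [_ Hx]. simpl in *. unfold Rdist in *.
  eapply Rle_lt_trans; [apply H|].
  apply Rlt_div_r in Hx; [|auto]. pose proof (Rle_abs K). pose proof (Rabs_pos (x - t)). nra.
Qed.

Lemma is_derive_RInt_cont (f : R -> R) (t : R) :
  (forall s, continuous f s) -> is_derive (fun t => RInt f 0 t) t (f t).
Proof.
  intros Hf. apply (is_derive_RInt f (fun t => RInt f 0 t) 0 t).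
  - apply filter_forall. intros y. apply (RInt_correct f).
    apply (ex_RInt_continuous (V := R_CompleteNormedModule)). intros; apply Hf.
  - apply Hf.
Qed.

Lemma is_derive_cst_RInt (c : R) (f : R -> R) (t : R) :
  (forall s, continuous f s) -> is_derive (fun t => c + RInt f 0 t) t (f t).
Proof.
  intros Hf. evar_last.
  apply (is_derive_plus (V := R_NormedModule)).
  apply (is_derive_const (V := R_NormedModule)).
  apply is_derive_RInt_cont; exact Hf. apply Rplus_0_l.
Qed.

Lemma derive_bound_lipR (f df : R -> R) (B : R) :
  (forall t, is_derive f t (df t)) -> (forall t, Rabs (df t) <= B) -> lipR B f.
Proof.
  intros Hd Hb.
  assert (H : forall s t, s <= t -> Rabs (f t - f s) <= B * (t - s)).
  { intros s t Hst. apply Rabs_le. split.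
    - pose proof (derive_ge_increase f df s t (- B) Hst (fun x _ => Hd x)).
      assert (f s + - B * (t - s) <= f t); [|lra]. apply H. intros x _.
      specialize (Hb x). apply Rabs_le_between in Hb. lra.
    - pose proof (derive_le_increase f df s t B Hst (fun x _ => Hd x)).
      assert (f t <= f s + B * (t - s)); [|lra]. apply H. intros x _.
      specialize (Hb x). apply Rabs_le_between in Hb. lra. }
  intros s t. destruct (Rle_lt_dec s t) as [h|h].
  - rewrite (Rabs_right (t - s)) by lra. apply H; exact h.
  - rewrite Rabs_minus_sym, (Rabs_minus_sym t s), (Rabs_right (s - t)) by lra.
    apply H; lra.
Qed.

Definition lip_curve (B : R) (x : R -> pt) : Prop :=
  forall i, lipR B (fun t => coord i (x t)).

Lemma lip_curve_comp (L B : R) (G : pt -> pt) (x : R -> pt) (i : bool) :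
  0 <= L -> lip2 L G -> lip_curve B x -> forall t, continuous (fun t => coord i (G (x t))) t.
Proof.
  intros HL HG Hx. apply (lipR_continuous (L * (2 * B))). intros s t.
  eapply Rle_trans; [apply dst_coord|]. eapply Rle_trans; [apply HG|].
  rewrite !Rmult_assoc. apply Rmult_le_compat_l; [exact HL|].
  apply dst_le_coords. intros j. apply (Hx j).
Qed.

Fixpoint picard (G : pt -> pt) (z0 : pt) (n : nat) (t : R) : pt :=
  match n with
  | O => z0
  | S n => (fst z0 + RInt (fun s => fst (G (picard G z0 n s))) 0 t,
            snd z0 + RInt (fun s => snd (G (picard G z0 n s))) 0 t)
  end.

Lemma picard_succ (G : pt -> pt) (z0 : pt) (n : nat) (t : R) (i : bool) :
  coord i (picard G z0 (S n) t) =
    coord i z0 + RInt (fun s => coord i (G (picard G z0 n s))) 0 t.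
Proof. destruct i; reflexivity. Qed.

Lemma picard_lip_curve (G : pt -> pt) (L B : R) (z0 : pt) (n : nat) :
  0 <= L -> 0 <= B -> lip2 L G -> bounded2 B G -> lip_curve B (picard G z0 n).
Proof.
  intros HL HB HG Hb. induction n as [|n IH]; intros i.
  - intros s t; simpl; rewrite Rminus_diag, Rabs_R0. apply Rmult_le_pos; auto; apply Rabs_pos.
  - apply (derive_bound_lipR _ (fun s => coord i (G (picard G z0 n s)))).
    + intros t. eapply is_derive_ext; [intros; symmetry; apply picard_succ|].
      apply is_derive_cst_RInt. apply (lip_curve_comp L B); auto.
    + intros; apply bounded2_coord, Hb.
Qed.

Lemma derive_dominated (f g df dg : R -> R) (t : R) :
  0 <= t -> (forall s, 0 <= s <= t -> is_derive f s (df s)) ->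
  (forall s, 0 <= s <= t -> is_derive g s (dg s)) ->
  (forall s, 0 <= s <= t -> Rabs (df s) <= dg s) ->
  Rabs (f t - f 0) <= g t - g 0.
Proof.
  intros Ht Hf Hg H. apply Rabs_le. split.
  - pose proof (derive_nonneg_mono (fun s => f s + g s) (fun s => df s + dg s) 0 t Ht).
    assert (f 0 + g 0 <= f t + g t); [|lra]. apply H0.
    + intros x Hx. apply (is_derive_plus (V := R_NormedModule)); auto.
    + intros x Hx. specialize (H x Hx). apply Rabs_le_between in H. lra.
  - pose proof (derive_nonneg_mono (fun s => g s - f s) (fun s => dg s - df s) 0 t Ht).
    assert (g 0 - f 0 <= g t - f t); [|lra]. apply H0.
    + intros x Hx. apply (is_derive_minus (V := R_NormedModule)); auto.
    + intros x Hx. specialize (H x Hx). apply Rabs_le_between in H. lra.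
Qed.

Lemma RInt_difference_bound (f g : R -> R) (c L t : R) :
  0 < L -> 0 <= t ->
  (forall s, continuous f s) -> (forall s, continuous g s) -> 0 <= c ->
  (forall s, 0 <= s <= t -> Rabs (f s - g s) <= 4 * L * c * exp (4 * L * s)) ->
  Rabs (RInt f 0 t - RInt g 0 t) <= c * exp (4 * L * t).
Proof.
  intros HL Ht Hf Hg Hc H.
  pose proof (derive_dominated (fun t => RInt f 0 t - RInt g 0 t)
    (fun t => c * exp (4 * L * t)) (fun s => f s - g s)
    (fun s => 4 * L * c * exp (4 * L * s)) t Ht) as h.
  simpl in h. rewrite !RInt_point in h.
  replace (RInt f 0 t - RInt g 0 t) with (RInt f 0 t - RInt g 0 t - (zero - zero)).
  2: { unfold zero; simpl. ring. }
  eapply Rle_trans; [apply h|].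
  - intros s _. apply (is_derive_minus (V := R_NormedModule)); apply is_derive_RInt_cont; auto.
  - intros s _. auto_derive; auto. ring.
  - exact H.
  - rewrite Rmult_0_r, exp_0. lra.
Qed.

(** The weight exp(4 L t) makes the iteration contract on the whole half-line. Passing from
    coordinates to [dst] loses a factor 2, so a step is bounded by 2 L times the previous one;
    integrating against exp(4 L t) divides by 4 L, and the ratio is 1/2. *)
Lemma picard_step (G : pt -> pt) (L B : R) (z0 : pt) (n : nat) (t : R) (i : bool) :
  0 < L -> 0 <= B -> lip2 L G -> bounded2 B G -> 0 <= t ->
  Rabs (coord i (picard G z0 (S n) t) - coord i (picard G z0 n t)) <=
    B / (4 * L) * / 2 ^ n * exp (4 * L * t).
Proof.
  intros HL HB HG Hb. revert t i.
  assert (HL' : 0 <= L) by lra.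
  induction n as [|n IH]; intros t i Ht; rewrite picard_succ.
  - assert (He : 4 * L * t <= exp (4 * L * t)).
    { pose proof (exp_ineq1_le (4 * L * t)). lra. }
    simpl. rewrite RInt_const. unfold scal; simpl; unfold mult; simpl.
    replace (_ + _ - _) with (coord i (G z0) * t) by ring.
    rewrite Rabs_mult, (Rabs_right t) by lra.
    apply Rle_trans with (B * t).
    + apply Rmult_le_compat_r; [lra|]. apply bounded2_coord, Hb.
    + replace (B * t) with (B / (4 * L) * (4 * L * t)) by (field; lra).
      rewrite Rinv_1, Rmult_1_r. apply Rmult_le_compat_l; [|exact He].
      apply Rdiv_le_0_compat; lra.
  - rewrite picard_succ.
    match goal with |- Rabs (?a + ?b - (?a + ?c)) <= _ =>
      replace (a + b - (a + c)) with (b - c) by ring end.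
    apply RInt_difference_bound; auto.
    + apply (lip_curve_comp L B); auto. apply (picard_lip_curve G L); auto.
    + apply (lip_curve_comp L B); auto. apply (picard_lip_curve G L); auto.
    + apply Rmult_le_pos. apply Rdiv_le_0_compat; lra.
      left; apply Rinv_0_lt_compat, pow_lt; lra.
    + intros s Hs. eapply Rle_trans; [apply dst_coord|]. eapply Rle_trans; [apply HG|].
      assert (h : dst (picard G z0 (S n) s) (picard G z0 n s) <=
        2 * (B / (4 * L) * / 2 ^ n * exp (4 * L * s))).
      { apply dst_le_coords. intros j. apply IH. lra. }
      apply Rmult_le_compat_l with (r := L) in h; auto.
      eapply Rle_trans; [exact h|]. right. simpl pow. rewrite Rinv_mult. field.
      split; [apply pow_nonzero|]; lra.
Qed.

Lemma geometric_limit (u : nat -> R) (C : R) :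
  (forall n, Rabs (u (S n) - u n) <= C * / 2 ^ n) ->
  forall n, Rabs (real (Lim_seq u) - u n) <= 2 * C * / 2 ^ n.
Proof.
  intros H.
  assert (HC : 0 <= C).
  { specialize (H 0%nat). simpl in H. rewrite Rinv_1 in H.
    pose proof (Rabs_pos (u 1%nat - u 0%nat)). lra. }
  assert (Hinv : forall n, 0 < / 2 ^ n).
  { intros n. apply Rinv_0_lt_compat, pow_lt. lra. }
  assert (Hk : forall n k, Rabs (u (n + k)%nat - u n) <= 2 * C * (/ 2 ^ n - / 2 ^ (n + k))).
  { intros n k. induction k as [|k IH].
    - rewrite Nat.add_0_r, !Rminus_diag, Rabs_R0. lra.
    - rewrite Nat.add_succ_r.
      replace (u (S (n + k)) - u n) with
        ((u (S (n + k)) - u (n + k)%nat) + (u (n + k)%nat - u n)) by ring.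
      eapply Rle_trans; [apply Rabs_triang|].
      specialize (H (n + k)%nat). simpl pow. rewrite Rinv_mult.
      pose proof (Hinv (n + k)%nat). lra. }
  assert (Hk' : forall n m, (n <= m)%nat -> Rabs (u m - u n) <= 2 * C * / 2 ^ n).
  { intros n m Hnm. replace m with (n + (m - n))%nat by lia.
    eapply Rle_trans; [apply Hk|]. pose proof (Hinv (n + (m - n))%nat). nra. }
  assert (Hex : ex_finite_lim_seq u).
  { apply ex_lim_seq_cauchy_corr. intros e.
    assert (Hlim : is_lim_seq (fun n => 4 * C * / 2 ^ n) 0).
    { replace (Finite 0) with (Rbar_mult (4 * C) 0) by (simpl; f_equal; ring).
      apply is_lim_seq_scal_l.
      apply is_lim_seq_ext with (fun n => (/ 2) ^ n).
      intros n. rewrite pow_inv; reflexivity.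
      apply is_lim_seq_geom. rewrite Rabs_right; lra. }
    apply is_lim_seq_spec in Hlim. destruct (Hlim e) as [N HN].
    exists N. intros n m Hn Hm.
    replace (u n - u m) with ((u n - u N) - (u m - u N)) by ring.
    eapply Rle_lt_trans; [apply Rabs_triang|]. rewrite Rabs_Ropp.
    pose proof (Hk' N n Hn). pose proof (Hk' N m Hm).
    specialize (HN N (le_n _)). rewrite Rminus_0_r in HN.
    apply Rabs_lt_between in HN. lra. }
  destruct Hex as [l Hl]. rewrite (is_lim_seq_unique _ _ Hl). simpl.
  intros n.
  assert (Hl' : is_lim_seq (fun m => Rabs (u (m + n)%nat - u n)) (Rabs (l - u n))).
  { apply (is_lim_seq_abs _ (Finite (l - u n))).
    apply is_lim_seq_minus'.
    apply (is_lim_seq_incr_n u n); exact Hl. apply is_lim_seq_const. }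
  apply (is_lim_seq_le (fun m => Rabs (u (m + n)%nat - u n)) (fun _ => 2 * C * / 2 ^ n)
     (Rabs (l - u n)) (2 * C * / 2 ^ n)); auto.
  - intros m. apply Hk'. lia.
  - apply is_lim_seq_const.
Qed.

Lemma le_geometric_0 (x K : R) : (forall n, x <= K * / 2 ^ n) -> x <= 0.
Proof.
  intros H.
  assert (Hlim : is_lim_seq (fun n => K * / 2 ^ n) 0).
  { replace (Finite 0) with (Rbar_mult K 0) by (simpl; f_equal; ring).
    apply is_lim_seq_scal_l.
    apply is_lim_seq_ext with (fun n => (/ 2) ^ n).
    intros n. rewrite pow_inv; reflexivity.
    apply is_lim_seq_geom. rewrite Rabs_right; lra. }
  apply (is_lim_seq_le (fun _ => x) (fun n => K * / 2 ^ n) x 0); auto.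
  apply is_lim_seq_const.
Qed.

(** The estimates hold for nonnegative times; evaluating at |t| still gives a Lipschitz curve on the
    whole line, so the integrands are continuous everywhere, while the integral equation is claimed
    for t >= 0 only. *)
Definition picard_limit (G : pt -> pt) (z0 : pt) (t : R) : pt :=
  (real (Lim_seq (fun n => fst (picard G z0 n (Rabs t)))),
   real (Lim_seq (fun n => snd (picard G z0 n (Rabs t))))).

Lemma coord_picard_limit (G : pt -> pt) (z0 : pt) (t : R) (i : bool) :
  coord i (picard_limit G z0 t) = real (Lim_seq (fun n => coord i (picard G z0 n (Rabs t)))).
Proof. destruct i; reflexivity. Qed.

Lemma picard_limit_spec (G : pt -> pt) (L B : R) (z0 : pt) :
  0 < L -> 0 <= B -> lip2 L G -> bounded2 B G ->
  let x := picard_limit G z0 in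
  lip_curve B x /\ x 0 = z0 /\
  forall t i, 0 <= t -> coord i (x t) = coord i z0 + RInt (fun s => coord i (G (x s))) 0 t.
Proof.
  intros HL HB HG Hb x.
  assert (HL' : 0 <= L) by lra.
  set (b := B / (4 * L)).
  assert (Hb0 : 0 <= b) by (apply Rdiv_le_0_compat; lra).
  assert (A : forall i t n, Rabs (coord i (x t) - coord i (picard G z0 n (Rabs t))) <=
     2 * (b * exp (4 * L * Rabs t)) * / 2 ^ n).
  { intros i t. unfold x. rewrite coord_picard_limit. apply geometric_limit. intros n.
    pose proof (picard_step G L B z0 n (Rabs t) i HL HB HG Hb (Rabs_pos t)). unfold b. lra. }
  assert (X : lip_curve B x).
  { intros i s t. apply Rnot_lt_le. intros Hlt.
    set (Cs := 2 * (b * exp (4 * L * Rabs s))) in *.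
    set (Ct := 2 * (b * exp (4 * L * Rabs t))) in *.
    assert (Rabs (coord i (x t) - coord i (x s)) - B * Rabs (t - s) <= 0); [|lra].
    apply (le_geometric_0 _ (Cs + Ct)). intros n.
    pose proof (A i s n) as h1. pose proof (A i t n) as h2.
    pose proof (picard_lip_curve G L B z0 n HL' HB HG Hb i (Rabs s) (Rabs t)) as h0. cbv beta in h0.
    assert (h3 : Rabs (Rabs t - Rabs s) <= Rabs (t - s)) by apply Rabs_triang_inv2.
    assert (h4 : B * Rabs (Rabs t - Rabs s) <= B * Rabs (t - s)) by (apply Rmult_le_compat_l; auto).
    fold Cs in h1. fold Ct in h2.
    set (u := coord i (x t)) in *. set (v := coord i (x s)) in *.
    set (pu := coord i (picard G z0 n (Rabs t))) in *.
    set (pv := coord i (picard G z0 n (Rabs s))) in *.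
    replace (u - v) with ((u - pu) + (pu - pv) - (v - pv)) by ring.
    pose proof (Rabs_triang ((u - pu) + (pu - pv)) (- (v - pv))) as h5.
    pose proof (Rabs_triang (u - pu) (pu - pv)) as h6.
    rewrite Rabs_Ropp in h5. unfold Rminus in *. lra. }
  assert (Hint : forall t i, 0 <= t ->
    coord i (x t) = coord i z0 + RInt (fun s => coord i (G (x s))) 0 t).
  { intros t i Ht. apply Rminus_diag_uniq, Rabs_eq_0.
    apply Rle_antisym; [|apply Rabs_pos].
    apply (le_geometric_0 _ (2 * (b * exp (4 * L * t)))). intros n.
    pose proof (A i t (S n)) as h1. rewrite (Rabs_right t) in h1 by lra.
    rewrite picard_succ in h1. simpl pow in h1. rewrite Rinv_mult in h1.
    assert (h2 : Rabs (RInt (fun s => coord i (G (picard G z0 n s))) 0 t -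
                       RInt (fun s => coord i (G (x s))) 0 t) <= b * / 2 ^ n * exp (4 * L * t)).
    { apply RInt_difference_bound; auto.
      - apply (lip_curve_comp L B); auto. apply (picard_lip_curve G L); auto.
      - apply (lip_curve_comp L B); auto.
      - apply Rmult_le_pos; auto. left; apply Rinv_0_lt_compat, pow_lt; lra.
      - intros s Hs. eapply Rle_trans; [apply dst_coord|]. rewrite dst_sym.
        eapply Rle_trans; [apply HG|].
        assert (h : dst (x s) (picard G z0 n s) <= 2 * (2 * (b * exp (4 * L * s)) * / 2 ^ n)).
        { apply dst_le_coords. intros j. pose proof (A j s n) as h. rewrite (Rabs_right s) in h by lra. exact h. }
        apply Rmult_le_compat_l with (r := L) in h; auto. lra. }
    set (i1 := RInt (fun s => coord i (G (picard G z0 n s))) 0 t) in *.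
    set (i2 := RInt (fun s => coord i (G (x s))) 0 t) in *.
    replace (coord i (x t) - (coord i z0 + i2)) with
      ((coord i (x t) - (coord i z0 + i1)) + (i1 - i2)) by ring.
    eapply Rle_trans; [apply Rabs_triang|]. lra. }
  split; [exact X|split; [|exact Hint]].
  apply coord_ext. intros i. rewrite Hint by lra. rewrite RInt_point. apply Rplus_0_r.
Qed.

Lemma eq_of_derive_eq (f g d : R -> R) (t : R) :
  0 <= t -> (forall s, 0 <= s <= t -> is_derive f s (d s)) ->
  (forall s, 0 <= s <= t -> is_derive g s (d s)) -> f 0 = g 0 -> f t = g t.
Proof.
  intros Ht Hf Hg H0.
  pose proof (derive_dominated (fun s => f s - g s) (fun _ => 0) (fun s => d s - d s)
    (fun _ => 0) t Ht) as h. simpl in h.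
  assert (Rabs (f t - g t - (f 0 - g 0)) <= 0 - 0).
  { apply h.
    - intros s Hs. apply (is_derive_minus (V := R_NormedModule)); auto.
    - intros. apply (is_derive_const (V := R_NormedModule)).
    - intros. rewrite Rminus_diag, Rabs_R0. lra. }
  rewrite H0, Rminus_diag, Rminus_0_r, Rminus_0_r in H.
  assert (f t - g t = 0); [|lra].
  apply Rabs_eq_0. pose proof (Rabs_pos (f t - g t)). lra.
Qed.

(** The forward solution of [G] and the reversed forward solution of -[G] are joined at time 0. The
    joined curve satisfies the integral equation on the whole line, which gives a two-sided
    derivative at 0 as well. *)
Lemma ode_global_solution (G : pt -> pt) (L B : R) (z0 : pt) :
  0 < L -> 0 <= B -> lip2 L G -> bounded2 B G ->
  exists x : R -> pt, x 0 = z0 /\ forall t, velocity x t (G (x t)).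
Proof.
  intros HL HB HG Hb.
  assert (HL' : 0 <= L) by lra.
  set (G' := fun z => (- fst (G z), - snd (G z))).
  assert (HG' : lip2 L G').
  { intros z w. unfold G'. eapply Rle_trans; [|apply (HG z w)].
    right. unfold dst; simpl. f_equal. ring. }
  assert (Hb' : bounded2 B G').
  { intros z. unfold G'. eapply Rle_trans; [|apply (Hb z)].
    right. unfold dst; simpl. f_equal. ring. }
  assert (HGc : forall i z, coord i (G' z) = - coord i (G z)) by (intros [|] z; reflexivity).
  destruct (picard_limit_spec G L B z0 HL HB HG Hb) as [P1 [P2 P3]].
  destruct (picard_limit_spec G' L B z0 HL HB HG' Hb') as [Q1 [Q2 Q3]].
  set (xp := picard_limit G z0) in *. set (xm := picard_limit G' z0) in *.
  set (x := fun t => if Rle_dec 0 t then xp t else xm (- t)).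
  assert (xpos : forall t, 0 <= t -> x t = xp t).
  { intros t Ht. unfold x. destruct (Rle_dec 0 t); [auto|lra]. }
  assert (xneg : forall t, t <= 0 -> x t = xm (- t)).
  { intros t Ht. unfold x. destruct (Rle_dec 0 t); [|auto].
    replace t with 0 by lra. rewrite Ropp_0. congruence. }
  assert (X : lip_curve B x).
  { intros i.
    assert (X1 : forall t s, s <= t -> Rabs (coord i (x t) - coord i (x s)) <= B * (t - s)).
    { assert (X0 : forall t s, 0 <= s <= t \/ s <= t <= 0 ->
        Rabs (coord i (x t) - coord i (x s)) <= B * (t - s)).
      { intros t s [H|H].
        - rewrite !xpos by lra. pose proof (P1 i s t) as h. cbv beta in h.
          rewrite (Rabs_right (t - s)) in h by lra. exact h.
        - rewrite !xneg by lra. pose proof (Q1 i (- s) (- t)) as h. cbv beta in h.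
          rewrite (Rabs_left1 (- t - - s)) in h by lra. lra. }
      intros t s H. destruct (Rle_lt_dec 0 s); [apply X0; lra|].
      destruct (Rle_lt_dec t 0); [apply X0; lra|].
      replace (coord i (x t) - coord i (x s)) with
        ((coord i (x t) - coord i (x 0)) + (coord i (x 0) - coord i (x s))) by ring.
      eapply Rle_trans; [apply Rabs_triang|].
      pose proof (X0 t 0). pose proof (X0 0 s). lra. }
    intros s t. destruct (Rle_lt_dec s t).
    - rewrite (Rabs_right (t - s)) by lra. apply X1; auto.
    - rewrite Rabs_minus_sym, (Rabs_left (t - s)) by lra. replace (- (t - s)) with (s - t) by ring.
      apply X1; lra. }
  pose proof (fun i => lip_curve_comp L B G x i HL' HG X) as C1.
  pose proof (fun i => lip_curve_comp L B G' xm i HL' HG' Q1) as C2.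
  assert (HE : forall i t, coord i (x t) = coord i z0 + RInt (fun s => coord i (G (x s))) 0 t).
  { intros i t. destruct (Rle_lt_dec 0 t) as [Ht|Ht].
    - rewrite xpos, P3 by auto. f_equal. apply RInt_ext.
      intros s Hs. rewrite Rmin_left in Hs by auto. rewrite xpos by lra. reflexivity.
    - rewrite xneg, Q3 by lra. rewrite <- (Ropp_involutive t) at 2.
      apply (eq_of_derive_eq (fun t => coord i z0 + RInt (fun s => coord i (G' (xm s))) 0 t)
         (fun t => coord i z0 + RInt (fun s => coord i (G (x s))) 0 (- t))
         (fun s => coord i (G' (xm s)))).
      + lra.
      + intros s _. apply (is_derive_cst_RInt _ (fun s => coord i (G' (xm s)))). apply C2.
      + intros s Hs. evar_last.
        apply (is_derive_comp (fun t => coord i z0 + RInt (fun s => coord i (G (x s))) 0 t) (fun s => - s)).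
        apply (is_derive_cst_RInt _ (fun s => coord i (G (x s)))). apply C1.
        auto_derive; auto. unfold scal; simpl; unfold mult; simpl.
        rewrite HGc, xneg by lra. rewrite Ropp_involutive. ring.
      + rewrite Ropp_0, !RInt_point. reflexivity. }
  exists x. split; [rewrite xpos by lra; exact P2|].
  assert (V : forall i t, is_derive (fun t => coord i (x t)) t (coord i (G (x t)))).
  { intros i t. eapply is_derive_ext; [intros; symmetry; apply HE|].
    apply (is_derive_cst_RInt _ (fun s => coord i (G (x s)))). apply C1. }
  intros t. split; [apply (V true)|apply (V false)].
Qed.

(** * Passage through the strip near the tangency *)

(* dy/du = F u y is the regularized system near p, written as a graph over a
   coordinate u increasing along both fields; fp and fm are the slopes of
   Xp and Xm. *)
Record slope_box (a b c M B eps : R) (fm fp F : R -> R -> R) : Prop := SlopeBox {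
  sb_bound : forall u y, Rabs u <= a -> Rabs y <= b -> Rabs (F u y) <= B;
  sb_one_sided : forall u y1 y2, Rabs u <= a -> Rabs y1 <= b -> Rabs y2 <= b ->
    y1 <= y2 -> F u y2 - F u y1 <= M * (y2 - y1);
  sb_lip_u : forall u u' y, Rabs u <= a -> Rabs u' <= a -> Rabs y <= b ->
    F u y - F u' y <= M * Rabs (u - u');
  sb_above : forall u y, Rabs u <= a -> Rabs y <= b -> eps <= y -> F u y = fp u y;
  sb_below : forall u y, Rabs u <= a -> Rabs y <= b -> y <= - eps -> F u y = fm u y;
  sb_between : forall u y, Rabs u <= a -> Rabs y <= b -> fp u y <= F u y <= fm u y;
  sb_fm_pos : forall u y, Rabs u <= a -> Rabs y <= b -> c <= fm u y;
  sb_fm_lip : forall u y1 y2, Rabs u <= a -> Rabs y1 <= b -> Rabs y2 <= b ->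
    Rabs (fm u y1 - fm u y2) <= M * Rabs (y1 - y2);
  sb_fp_lip : forall u y1 y2, Rabs u <= a -> Rabs y1 <= b -> Rabs y2 <= b ->
    Rabs (fp u y1 - fp u y2) <= M * Rabs (y1 - y2);
  sb_fp_small : forall u y, Rabs u <= a -> Rabs y <= b ->
    fp u y <= M * (Rabs u + Rabs y)
}.

Arguments sb_bound {a b c M B eps fm fp F}.
Arguments sb_one_sided {a b c M B eps fm fp F}.
Arguments sb_lip_u {a b c M B eps fm fp F}.
Arguments sb_above {a b c M B eps fm fp F}.
Arguments sb_below {a b c M B eps fm fp F}.
Arguments sb_between {a b c M B eps fm fp F}.
Arguments sb_fm_pos {a b c M B eps fm fp F}.
Arguments sb_fm_lip {a b c M B eps fm fp F}.
Arguments sb_fp_lip {a b c M B eps fm fp F}.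
Arguments sb_fp_small {a b c M B eps fm fp F}.

Definition solves (F : R -> R -> R) (b : R) (y : R -> R) (u0 u1 : R) : Prop :=
  forall u, u0 <= u <= u1 -> is_derive y u (F u (y u)) /\ Rabs (y u) <= b.

Lemma solves_sub (F : R -> R -> R) (b : R) (y : R -> R) (u0 u1 v0 v1 : R) :
  solves F b y u0 u1 -> u0 <= v0 -> v1 <= u1 -> solves F b y v0 v1.
Proof. intros H h1 h2 u Hu. apply H. lra. Qed.

(** The slope bound is required below the level [l] only: a curve that has not reached [l] is still
    subject to it, and slope [c] closes the gap within (l - f u0) / c. *)
Lemma hitting_time (f df : R -> R) (u0 u1 l c : R) :
  0 < c -> (forall u, u0 <= u <= u1 -> is_derive f u (df u)) ->
  (forall u, u0 <= u <= u1 -> f u <= l -> c <= df u) ->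
  f u0 <= l -> u0 + (l - f u0) / c <= u1 ->
  exists tau, 0 <= tau <= (l - f u0) / c /\ f (u0 + tau) = l.
Proof.
  intros Hc Hd Hs H0 H1.
  assert (Hnn : 0 <= (l - f u0) / c) by (apply Rdiv_le_0_compat; lra).
  set (T := (l - f u0) / c) in *.
  destruct (classic (exists v, u0 <= v <= u0 + T /\ l <= f v)) as [[v [Hv Hv']]|Hn].
  - destruct (intermediate_value f u0 v l) as [x [Hx Hx']].
    + lra.
    + intros x Hx. apply (is_derive_continuity_pt _ _ (df x)). apply Hd. lra.
    + lra.
    + exists (x - u0). split; [lra|]. replace (u0 + (x - u0)) with x by ring. exact Hx'.
  - exfalso. apply Hn. exists (u0 + T). split; [lra|].
    pose proof (derive_ge_increase f df u0 (u0 + T) c) as h.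
    assert (f u0 + c * (u0 + T - u0) <= f (u0 + T)).
    { apply h; [lra| |].
      - intros; apply Hd; lra.
      - intros x Hx. apply Hs; [lra|]. apply Rnot_lt_le. intros Hlt.
        apply Hn. exists x. lra. }
    replace (u0 + T - u0) with T in H by ring.
    unfold T in H at 1. replace (c * ((l - f u0) / c)) with (l - f u0) in H by (field; lra).
    lra.
Qed.

Section SlopeBox.
Context {a b c M B eps : R} {fm fp F : R -> R -> R}.
Context (HB : slope_box a b c M B eps fm fp F).

(** A one-sided Lipschitz bound is exactly what forward Gronwall needs, both for the order and for
    the growth of the gap. Nothing similar holds backwards in u, where the strip expands at a rate
    of order 1/eps. *)
Lemma slope_order_lipschitz (y1 y2 : R -> R) (u0 u1 : R) :
  0 <= M -> - a <= u0 -> u0 <= u1 -> u1 <= a ->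
  solves F b y1 u0 u1 -> solves F b y2 u0 u1 -> y1 u0 <= y2 u0 ->
  y1 u1 <= y2 u1 /\ y2 u1 - y1 u1 <= exp (M * (u1 - u0)) * (y2 u0 - y1 u0).
Proof.
  intros HM h0 h1 h2 S1 S2 Ho.
  assert (habs : forall u, u0 <= u <= u1 -> Rabs u <= a) by (intros; apply Rabs_le; lra).
  split.
  - pose proof (gronwall_one_sided (fun u => y1 u - y2 u)
      (fun u => F u (y1 u) - F u (y2 u)) u0 u1 M 0 HM (Rle_refl 0) h1) as G.
    cbv beta in G. rewrite (Rmax_right (y1 u0 - y2 u0) 0) in G by lra.
    assert (y1 u1 - y2 u1 <= (0 + 0 * (u1 - u0)) * exp (M * (u1 - u0))); [|lra].
    apply G.
    + intros u Hu. apply (is_derive_minus (V := R_NormedModule)); [apply S1|apply S2]; auto.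
    + intros u Hu Hp. rewrite Rplus_0_r.
      apply (sb_one_sided HB); auto; [apply S2|apply S1|lra]; auto.
  - pose proof (gronwall_one_sided (fun u => y2 u - y1 u)
      (fun u => F u (y2 u) - F u (y1 u)) u0 u1 M 0 HM (Rle_refl 0) h1) as G.
    cbv beta in G. rewrite (Rmax_left (y2 u0 - y1 u0) 0) in G by lra.
    rewrite Rmult_0_l, Rplus_0_r in G. rewrite Rmult_comm.
    apply G.
    + intros u Hu. apply (is_derive_minus (V := R_NormedModule)); [apply S2|apply S1]; auto.
    + intros u Hu Hp. rewrite Rplus_0_r.
      apply (sb_one_sided HB); auto; [apply S1|apply S2|lra]; auto.
Qed.

(** On the left, F <= fm bounds y from above by comparison with [Ym]. For the lower bound, y below
    Ym - eps forces y <= -eps because Ym <= 0, and there F = fm; hence only eps is lost. On the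
    right the roles are exchanged: F >= fp gives the lower bound, and y above Yp + eps lies where F
    = fp. [K1] and [K] are the accumulated constants of the left half and of both halves. *)
Lemma slope_closeness (Ym Yp y : R -> R) (r : R) :
  0 <= a -> 0 <= M -> 0 <= c -> 0 <= eps -> 0 <= r ->
  solves fm b Ym (- a) 0 -> Ym 0 = 0 ->
  solves fp b Yp 0 a -> Yp 0 = 0 -> (forall u, 0 <= u <= a -> 0 <= Yp u) ->
  solves F b y (- a) a -> Rabs (y (- a) - Ym (- a)) <= r ->
  let K1 := 1 + (1 + M * a) * exp (M * a) in
  let K := 1 + (K1 + M * a) * exp (M * a) in
  (forall u, - a <= u <= 0 -> Rabs (y u - Ym u) <= K * (r + eps)) /\
  (forall u, 0 <= u <= a -> Rabs (y u - Yp u) <= K * (r + eps)).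
Proof.
  intros Ha HM Hc He Hr SM M0 SP P0 Pp SY Hi K1 K.
  assert (HMa : 0 <= M * a) by nra.
  assert (HE1 : 1 <= exp (M * a)) by (apply exp_nonneg_ge1; auto).
  set (E := exp (M * a)) in *.
  assert (HK1 : 1 <= K1) by (unfold K1; nra).
  assert (HK : K1 <= K) by (unfold K; nra).
  assert (hE : forall u v, u <= v <= u + a -> exp (M * (v - u)) <= E).
  { intros u v Huv. apply exp_le. nra. }
  assert (Yneg : forall u, - a <= u <= 0 -> Ym u <= 0).
  { intros u Hu.
    pose proof (derive_nonneg_mono Ym (fun u => fm u (Ym u)) u 0) as h.
    rewrite M0 in h. apply h; [lra| |].
    - intros x Hx. apply SM. lra.
    - intros x Hx. apply Rle_trans with c; [auto|].
      apply (sb_fm_pos HB). apply Rabs_le; lra. apply SM; lra. }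
  apply Rabs_le_between in Hi.
  assert (left : forall u, - a <= u <= 0 -> Rabs (y u - Ym u) <= K1 * (r + eps)).
  { intros u Hu.
    assert (up : y u - Ym u <= (r + 0 * (u - - a)) * E).
    { pose proof (gronwall_one_sided (fun u => y u - Ym u)
        (fun u => F u (y u) - fm u (Ym u)) (- a) u M 0 HM (Rle_refl 0)) as G.
      cbv beta in G. eapply Rle_trans; [apply G|].
      - lra.
      - intros v Hv. apply (is_derive_minus (V := R_NormedModule)); [apply SY|apply SM]; lra.
      - intros v Hv Hp.
        destruct (SY v) as [_ y1]; [lra|]. destruct (SM v) as [_ y2]; [lra|].
        assert (av : Rabs v <= a) by (apply Rabs_le; lra).
        pose proof (sb_between HB v (y v) av y1).
        pose proof (sb_fm_lip HB v (y v) (Ym v) av y1 y2) as h.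
        rewrite (Rabs_right (y v - Ym v)) in h by lra. apply Rabs_le_between in h. lra.
      - rewrite !Rmult_0_l, !Rplus_0_r.
        apply Rle_trans with (r * exp (M * (u - - a))).
        + apply Rmult_le_compat_r; [left; apply exp_pos|]. apply Rmax_lub; lra.
        + apply Rmult_le_compat_l; [auto|]. apply hE. lra. }
    assert (lo : Ym u - y u - eps <= (r + M * eps * a) * E).
    { assert (HMe : 0 <= M * eps) by nra.
      pose proof (gronwall_one_sided (fun u => Ym u - y u - eps)
        (fun u => fm u (Ym u) - F u (y u) - 0) (- a) u M (M * eps) HM HMe) as G.
      cbv beta in G. eapply Rle_trans; [apply G|].
      - lra.
      - intros v Hv. apply (is_derive_minus (V := R_NormedModule)).
        apply (is_derive_minus (V := R_NormedModule)); [apply SM|apply SY]; lra.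
        apply (is_derive_const (V := R_NormedModule)).
      - intros v Hv Hp.
        destruct (SY v) as [_ y1]; [lra|]. destruct (SM v) as [_ y2]; [lra|].
        assert (av : Rabs v <= a) by (apply Rabs_le; lra).
        assert (Yneg' := Yneg v ltac:(lra)).
        rewrite (sb_below HB v (y v)) by (auto; lra).
        pose proof (sb_fm_lip HB v (Ym v) (y v) av y2 y1) as h.
        rewrite (Rabs_right (Ym v - y v)) in h by lra. apply Rabs_le_between in h. lra.
      - apply Rmult_le_compat; [| left; apply exp_pos | |apply hE; lra].
        + assert (0 <= Rmax (Ym (- a) - y (- a) - eps) 0) by apply Rmax_r.
          assert (0 <= M * eps * (u - - a)) by (apply Rmult_le_pos; lra). lra.
        + apply Rplus_le_compat. apply Rmax_lub; lra.
          apply Rmult_le_compat_l; lra. }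
    assert (0 <= E * r) by nra. assert (0 <= E * eps) by nra.
    assert (0 <= M * a * E * r) by (apply Rmult_le_pos; nra).
    assert (0 <= M * a * E * eps) by (apply Rmult_le_pos; nra).
    unfold K1. apply Rabs_le. split; lra. }
  assert (at0 : Rabs (y 0) <= K1 * (r + eps)).
  { specialize (left 0). rewrite M0, Rminus_0_r in left. apply left. lra. }
  apply Rabs_le_between in at0.
  assert (hK0 : 0 <= K1 * (r + eps)) by nra.
  split.
  { intros u Hu. eapply Rle_trans; [apply left; auto|]. nra. }
  intros u Hu.
  assert (lo : Yp u - y u <= K1 * (r + eps) * E).
  { pose proof (gronwall_one_sided (fun u => Yp u - y u)
      (fun u => fp u (Yp u) - F u (y u)) 0 u M 0 HM (Rle_refl 0)) as G.
    cbv beta in G. eapply Rle_trans; [apply G|].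
    - lra.
    - intros v Hv. apply (is_derive_minus (V := R_NormedModule)); [apply SP|apply SY]; lra.
    - intros v Hv Hp.
      destruct (SY v) as [_ y1]; [lra|]. destruct (SP v) as [_ y2]; [lra|].
      assert (av : Rabs v <= a) by (apply Rabs_le; lra).
      pose proof (sb_between HB v (y v) av y1).
      pose proof (sb_fp_lip HB v (Yp v) (y v) av y2 y1) as h.
      rewrite (Rabs_right (Yp v - y v)) in h by lra. apply Rabs_le_between in h. lra.
    - rewrite P0. rewrite Rmult_0_l, Rplus_0_r.
      apply Rmult_le_compat; [apply Rmax_r|left; apply exp_pos| |apply hE; lra].
      apply Rmax_lub; lra. }
  assert (up : y u - Yp u - eps <= (K1 * (r + eps) + M * eps * a) * E).
  { assert (HMe : 0 <= M * eps) by nra.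
    pose proof (gronwall_one_sided (fun u => y u - Yp u - eps)
      (fun u => F u (y u) - fp u (Yp u) - 0) 0 u M (M * eps) HM HMe) as G.
    cbv beta in G. eapply Rle_trans; [apply G|].
    - lra.
    - intros v Hv. apply (is_derive_minus (V := R_NormedModule)).
      apply (is_derive_minus (V := R_NormedModule)); [apply SY|apply SP]; lra.
      apply (is_derive_const (V := R_NormedModule)).
    - intros v Hv Hp.
      destruct (SY v) as [_ y1]; [lra|]. destruct (SP v) as [_ y2]; [lra|].
      assert (av : Rabs v <= a) by (apply Rabs_le; lra).
      assert (Pp' := Pp v ltac:(lra)).
      rewrite (sb_above HB v (y v)) by (auto; lra).
      pose proof (sb_fp_lip HB v (y v) (Yp v) av y1 y2) as h.
      rewrite (Rabs_right (y v - Yp v)) in h by lra. apply Rabs_le_between in h. lra.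
    - rewrite P0. apply Rmult_le_compat; [| left; apply exp_pos | |apply hE; lra].
      + assert (0 <= Rmax (y 0 - 0 - eps) 0) by apply Rmax_r.
        assert (0 <= M * eps * (u - 0)) by (apply Rmult_le_pos; lra). lra.
      + apply Rplus_le_compat. apply Rmax_lub; lra.
        apply Rmult_le_compat_l; lra. }
  assert (hh : 0 <= M * a * r * E).
  { apply Rmult_le_pos; [|lra]. apply Rmult_le_pos; lra. }
  assert (hKr : K * (r + eps) = (r + eps) + K1 * (r + eps) * E + M * a * (r + eps) * E).
  { unfold K. ring. }
  assert (0 <= M * a * eps * E).
  { apply Rmult_le_pos; [|lra]. apply Rmult_le_pos; lra. }
  apply Rabs_le. split; lra.
Qed.

End SlopeBox.

Lemma chain_increase (f : R -> R) (s tau kap : R) (n : nat) :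
  (forall j, (j < n)%nat -> f (s + INR j * tau) + kap <= f (s + INR j * tau + tau)) ->
  f s + INR n * kap <= f (s + INR n * tau).
Proof.
  induction n as [|n IH]; intros H.
  - simpl. rewrite !Rmult_0_l, !Rplus_0_r. lra.
  - assert (h1 : f s + INR n * kap <= f (s + INR n * tau)) by (apply IH; intros; apply H; lia).
    specialize (H n (Nat.lt_succ_diag_r n)).
    rewrite S_INR. replace (s + (INR n + 1) * tau) with (s + INR n * tau + tau) by ring. lra.
Qed.

Lemma exists_nat_steps (tau del : R) :
  0 < tau -> 0 < del -> exists n, del <= INR n * tau /\
    forall j, (j < n)%nat -> INR j * tau < del.
Proof.
  intros Ht Hd.
  assert (Hex : exists n, del <= INR n * tau).
  { destruct (INR_unbounded (del / tau)) as [n Hn]. exists n.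
    apply Rlt_div_l in Hn; auto. lra. }
  destruct Hex as [n Hn]. induction n as [|n IH].
  - simpl in Hn. lra.
  - destruct (Rle_lt_dec del (INR n * tau)) as [h|h]; [auto|].
    exists (S n). split; [auto|]. intros j Hj.
    apply Rle_lt_trans with (INR n * tau); [|auto].
    apply Rmult_le_compat_r; [lra|]. apply le_INR. lia.
Qed.

(* y1 moved back in u by tau nearly solves the same equation as y2 and agrees
   with it at u1, so y2 - y1 is close to y1(u + tau) - y1(u); the latter is
   small compared to tau somewhere, since y1 stays of order eps + eta del over
   a stretch of length del. *)
Lemma slope_contraction_local (a b c M B eps del eta : R) (fm fp F : R -> R -> R)
    (y1 y2 : R -> R) (u1 : R) :
  slope_box a b c M B eps fm fp F ->
  0 <= a -> 0 < c -> 0 <= M -> 0 <= B -> 0 < eps -> 0 < del -> 5 * del <= a ->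
  eps <= del -> M * (5 + 2 * B) * del <= eta ->
  solves F b y1 (- a) a -> solves F b y2 (- a) a ->
  - del <= u1 <= del -> y2 u1 = - eps -> y1 u1 <= - eps ->
  (y2 u1 - y1 u1) / c <= del ->
  0 <= y2 a - y1 a <= exp (2 * a * M) *
    (2 * M * del * exp (2 * a * M) + 3 * eps / del + 2 * eta) / c * (y2 u1 - y1 u1).
Proof.
  intros HB Ha Hc HM HB0 He Hdel Hda Hed Heta S1 S2 Hu1 Hy2 Hy1 Hw.
  assert (Habs : forall u, - a <= u <= a -> Rabs u <= a) by (intros; apply Rabs_le; lra).
  set (w := y2 u1 - y1 u1) in *.
  assert (Hw0 : 0 <= w) by (unfold w; lra).
  assert (Hexp1 : 1 <= exp (2 * a * M)) by (apply exp_nonneg_ge1; nra).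
  set (E := exp (2 * a * M)) in *.
  assert (Heta0 : 0 <= eta).
  { apply Rle_trans with (M * (5 + 2 * B) * del); [|exact Heta].
    apply Rmult_le_pos; [|lra]. apply Rmult_le_pos; lra. }
  assert (Hke : 0 <= 3 * eps / del) by (apply Rdiv_le_0_compat; lra).
  split.
  { assert (y1 a <= y2 a); [|lra].
    apply (slope_order_lipschitz HB y1 y2 u1 a); try lra;
    eapply solves_sub; eauto; lra. }
  (* [tau] is the delay in u with which [y1] reaches the lower edge of the strip after [y2]. Below
     the strip the slope is at least c, so [tau] is at most w / c. *)
  destruct (hitting_time y1 (fun u => F u (y1 u)) u1 a (- eps) c) as [tau [Ht Ht']].
  { exact Hc. }
  { intros; apply S1; lra. }
  { intros u Hu Hl. rewrite (sb_below HB); [|apply Habs; lra|apply S1; lra|exact Hl].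
    apply (sb_fm_pos HB). apply Habs; lra. apply S1; lra. }
  { exact Hy1. }
  { replace (- eps - y1 u1) with w by (unfold w; lra). lra. }
  replace (- eps - y1 u1) with w in Ht by (unfold w; lra).
  destruct (Req_dec tau 0) as [E0|Hne].
  { assert (Hww : w = 0) by (unfold w; rewrite E0, Rplus_0_r in Ht'; lra).
    destruct (slope_order_lipschitz HB y1 y2 u1 a) as [_ h]; try lra;
    try (eapply solves_sub; eauto; lra).
    fold w in h. rewrite Hww in *. lra. }
  assert (Htau : 0 < tau) by lra.
  set (s0 := u1 + tau) in *.
  assert (Hs0 : - del <= s0 <= 2 * del) by (unfold s0; lra).

  (* Above the strip the slope is [fp], which is at most [eta] this close to the tangency, so [y1]
     stays within 2 del eta above the upper edge. *)
  assert (Hup : forall u, s0 <= u <= s0 + 2 * del -> y1 u <= eps + 2 * del * eta).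
  { intros u Hu.
    pose proof (gronwall_one_sided (fun u => y1 u - eps) (fun u => F u (y1 u) - 0)
       s0 u 0 eta (Rle_refl 0) Heta0) as G.
    cbv beta in G. rewrite Rmult_0_l, exp_0, Rmult_1_r, Ht', Rmax_right in G by lra.
    assert (y1 u - eps <= 0 + eta * (u - s0)).
    { apply G; [lra| |].
      - intros v Hv. apply (is_derive_minus (V := R_NormedModule)). apply S1; lra.
        apply (is_derive_const (V := R_NormedModule)).
      - intros v Hv Hp.
        assert (av : Rabs v <= a) by (apply Habs; lra).
        assert (bv : Rabs (y1 v) <= b) by (apply S1; lra).
        rewrite (sb_above HB) by (auto; lra).
        pose proof (sb_fp_small HB v (y1 v) av bv).
        assert (hv : Rabs v <= 4 * del) by (apply Rabs_le; lra).
        assert (hy : y1 v <= - eps + B * (v - s0)).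
        { rewrite <- Ht'. apply (derive_le_increase y1 (fun u => F u (y1 u))); [lra| |].
          - intros x Hx; apply S1; lra.
          - intros x Hx. apply Rle_trans with (Rabs (F x (y1 x))); [apply Rle_abs|].
            apply (sb_bound HB). apply Habs; lra. apply S1; lra. }
        assert (hy' : Rabs (y1 v) <= (1 + 2 * B) * del).
        { rewrite Rabs_right by lra.
          assert (B * (v - s0) <= B * (2 * del)) by (apply Rmult_le_compat_l; lra). lra. }
        assert (M * (Rabs v + Rabs (y1 v)) <= M * (5 + 2 * B) * del).
        { rewrite Rmult_assoc. apply Rmult_le_compat_l; [auto|]. lra. }
        lra. }
    assert (eta * (u - s0) <= eta * (2 * del)) by (apply Rmult_le_compat_l; lra). lra. }
  (* Over a length [del], steps all rising by more than [kap * tau] would add up to at least 3 eps +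
     2 eta del, whereas [y1] starts at -eps and rises by at most 2 eps + 2 eta del. So some step of
     length [tau] rises little. *)
  set (kap := 3 * eps / del + 2 * eta).
  assert (Hu2 : exists u2, s0 <= u2 <= s0 + del /\ y1 (u2 + tau) - y1 u2 <= kap * tau).
  { apply NNPP. intros Hn.
    destruct (exists_nat_steps tau del Htau Hdel) as [n [Hn1 Hn2]].
    assert (Hch : y1 s0 + INR n * (kap * tau) <= y1 (s0 + INR n * tau)).
    { apply chain_increase. intros j Hj. apply Rnot_lt_le. intros Hlt.
      apply Hn. exists (s0 + INR j * tau). split; [|lra].
      specialize (Hn2 j Hj). assert (0 <= INR j * tau) by (apply Rmult_le_pos; [apply pos_INR|lra]).
      lra. }
    assert (Hntau : INR n * tau <= del + tau).
    { destruct n as [|n]; [simpl in *; lra|].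
      specialize (Hn2 n (Nat.lt_succ_diag_r n)). rewrite S_INR. lra. }
    rewrite Ht' in Hch.
    specialize (Hup (s0 + INR n * tau)).
    assert (y1 (s0 + INR n * tau) <= eps + 2 * del * eta) by (apply Hup; lra).
    assert (Hkap : 0 <= kap) by (unfold kap; lra).
    assert (kap * del <= kap * (INR n * tau)) by (apply Rmult_le_compat_l; lra).
    assert (kap * del = 3 * eps + 2 * eta * del) by (unfold kap; field; lra).
    lra. }
  destruct Hu2 as [u2 [Hu2 Hu2']].
  (* Both [y2] and the translated [y1] equal -eps at [u1]. The translate solves the equation up to a
     defect M tau, since F is Lipschitz in u uniformly in eps, and u2 - u1 is at most 2 del. *)
  assert (HD : y2 u2 - y1 (u2 + tau) <= 2 * M * del * E * tau).
  { assert (HMt : 0 <= M * tau) by nra.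
    pose proof (gronwall_one_sided (fun u => y2 u - y1 (u + tau))
      (fun u => F u (y2 u) - F (u + tau) (y1 (u + tau))) u1 u2 M (M * tau) HM HMt) as G.
    cbv beta in G. fold s0 in G. rewrite Ht', Hy2, Rminus_diag, Rmax_left in G by lra.
    eapply Rle_trans; [apply G|].
    - unfold s0 in *; lra.
    - intros u Hu. apply (is_derive_minus (V := R_NormedModule)).
      + apply S2. unfold s0 in *; lra.
      + evar_last. apply (is_derive_comp y1 (fun u => u + tau)).
        apply S1. unfold s0 in *; lra. auto_derive; auto.
        unfold scal; simpl; unfold mult; simpl; ring.
    - intros u Hu Hp.
      assert (a1 : Rabs u <= a) by (apply Habs; unfold s0 in *; lra).
      assert (a2 : Rabs (u + tau) <= a) by (apply Habs; unfold s0 in *; lra).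
      assert (b1 : Rabs (y1 (u + tau)) <= b) by (apply S1; unfold s0 in *; lra).
      assert (b2 : Rabs (y2 u) <= b) by (apply S2; unfold s0 in *; lra).
      pose proof (sb_one_sided HB u (y1 (u + tau)) (y2 u) a1 b1 b2).
      pose proof (sb_lip_u HB u (u + tau) (y1 (u + tau)) a1 a2 b1) as h.
      replace (u - (u + tau)) with (- tau) in h by ring.
      rewrite Rabs_Ropp, Rabs_right in h by lra. lra.
    - rewrite Rplus_0_l.
      replace (2 * M * del * E * tau) with (M * tau * (2 * del) * E) by ring.
      apply Rmult_le_compat.
      + apply Rmult_le_pos; unfold s0 in *; lra.
      + left; apply exp_pos.
      + apply Rmult_le_compat_l; unfold s0 in *; lra.
      + apply exp_le. assert (u2 - u1 <= 2 * a) by (unfold s0 in *; lra). nra. }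
  destruct (slope_order_lipschitz HB y1 y2 u1 u2) as [Hord _]; try (unfold s0 in *; lra);
    try (eapply solves_sub; eauto; unfold s0 in *; lra).
  destruct (slope_order_lipschitz HB y1 y2 u2 a) as [_ Hlast]; try (unfold s0 in *; lra);
    try (eapply solves_sub; eauto; unfold s0 in *; lra).
  eapply Rle_trans; [exact Hlast|].
  set (Q := 2 * M * del * E + 3 * eps / del + 2 * eta).
  assert (HQ : 0 <= 2 * M * del * E).
  { apply Rmult_le_pos; [|lra]. apply Rmult_le_pos; [lra|lra]. }
  (* The gap at [u2] splits into the comparison with the translate and the small rise of [y1] over
     one delay, both proportional to [tau]. *)
  assert (HwQ : y2 u2 - y1 u2 <= Q * (w / c)).
  { apply Rle_trans with (Q * tau); [|apply Rmult_le_compat_l; [unfold Q|]; lra].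
    unfold Q. unfold kap in Hu2'. lra. }
  replace (E * Q / c * w) with (E * (Q * (w / c))) by (field; lra).
  apply Rmult_le_compat; [left; apply exp_pos|lra| |exact HwQ].
  apply exp_le. assert (a - u2 <= 2 * a) by (unfold s0 in *; lra). nra.
Qed.

(** Once eps <= del^2, every term of the local contraction factor is at most a multiple of [del], so
    [del] proportional to the prescribed [L] is enough. The two reference curves serve to locate the
    passage through the strip near u = 0. *)
Lemma slope_strong_contraction (a b c M B : R) (fm fp : R -> R -> R) (Ym Yp : R -> R) (L : R) :
  0 < a -> 0 < c -> 0 <= M -> 0 <= B -> 0 < L ->
  solves fm b Ym (- a) 0 -> Ym 0 = 0 ->
  solves fp b Yp 0 a -> Yp 0 = 0 -> (forall u, 0 <= u <= a -> 0 <= Yp u) ->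
  exists r, 0 < r /\ forall eps F y1 y2, 0 < eps < r ->
    slope_box a b c M B eps fm fp F ->
    solves F b y1 (- a) a -> solves F b y2 (- a) a ->
    Rabs (y1 (- a) - Ym (- a)) <= r -> Rabs (y2 (- a) - Ym (- a)) <= r ->
    y1 (- a) <= y2 (- a) ->
    0 <= y2 a - y1 a <= L * (y2 (- a) - y1 (- a)).
Proof.
  intros Ha Hc HM HB HL SM M0 SP P0 Pp.
  assert (HE : 1 <= exp (2 * a * M)) by (apply exp_nonneg_ge1; nra).
  set (E := exp (2 * a * M)) in *.
  set (K1 := 1 + (1 + M * a) * exp (M * a)).
  set (K := 1 + (K1 + M * a) * exp (M * a)).
  assert (HMa : 0 <= M * a) by nra.
  assert (HE' : 1 <= exp (M * a)) by (apply exp_nonneg_ge1; auto).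
  assert (HK1 : 1 <= K1) by (unfold K1; nra).
  assert (HK : 1 <= K) by (unfold K; nra).
  set (Q := 2 * M * E + 3 + 2 * (M * (5 + 2 * B))).
  assert (HMB : 0 <= M * (5 + 2 * B)) by (apply Rmult_le_pos; lra).
  assert (HQ : 3 <= Q) by (unfold Q; nra).
  assert (HEQ : 0 < E * E * Q) by (repeat apply Rmult_lt_0_compat; lra).
  (* One factor [E] pays for the stretch from -a to the strip, the other for the stretch after it;
     [Q] collects the coefficients of [del] in the local factor. *)
  set (del := Rmin 1 (Rmin (a / 5) (L * c / (E * E * Q)))).
  assert (Hdel : 0 < del).
  { unfold del. repeat apply Rmin_glb_lt; try lra. apply Rdiv_lt_0_compat; nra. }
  assert (Hd1 : del <= 1) by le_min.
  assert (Hd2 : del <= a / 5) by le_min.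
  assert (Hd3 : del * (E * E * Q) <= L * c).
  { apply Rle_div_r; [exact HEQ|]. le_min. }
  (* The bound del^2 turns 3 eps / del into O(del). The second bound makes [y2] reach -eps for some
     u in [-del, del], because [Ym] lies below the line c u. The third keeps the delay, at most 2 r
     E / c, below [del]. *)
  set (r := Rmin (del * del) (Rmin (c * del / (2 * K + 2)) (c * del / (2 * E)))).
  assert (Hcd : 0 < c * del) by nra.
  assert (Hr : 0 < r).
  { unfold r. repeat apply Rmin_glb_lt; try nra; apply Rdiv_lt_0_compat; lra. }
  assert (Hr1 : r <= del * del) by le_min.
  assert (Hr2 : r * (2 * K + 2) <= c * del).
  { apply Rle_div_r; [lra|]. le_min. }
  assert (Hr3 : r * (2 * E) <= c * del).
  { apply Rle_div_r; [lra|]. le_min. }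
  exists r. split; [exact Hr|].
  intros eps F y1 y2 He HF S1 S2 Hi1 Hi2 Hord.
  destruct (slope_closeness HF Ym Yp y2 r) as [Hcl _]; auto; try lra.
  fold K1 in Hcl. fold K in Hcl.
  assert (HKr : K * (r + eps) < c * del - r).
  { assert (K * (r + eps) <= K * (2 * r)) by (apply Rmult_le_compat_l; lra). lra. }
  assert (Hder : forall u, - a <= u <= a -> is_derive y2 u (F u (y2 u))) by (intros; apply S2; auto).
  assert (Hslope : forall u, - a <= u <= a -> y2 u <= - eps -> c <= F u (y2 u)).
  { intros u Hu Hl. assert (Rabs u <= a) by (apply Rabs_le; lra).
    assert (Rabs (y2 u) <= b) by (apply S2; auto).
    rewrite (sb_below HF) by auto.
    apply (sb_fm_pos HF); auto. }
  assert (Ymc : forall u, - a <= u <= 0 -> Ym u <= c * u).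
  { intros u Hu. pose proof (derive_ge_increase Ym (fun u => fm u (Ym u)) u 0 c) as h.
    rewrite M0 in h. assert (Ym u + c * (0 - u) <= 0); [|lra]. apply h; [lra| |].
    - intros x Hx. apply SM. lra.
    - intros x Hx. apply (sb_fm_pos HF). apply Rabs_le; lra. apply SM; lra. }
  assert (Hsa : y2 (- a) <= - eps).
  { apply Rabs_le_between in Hi2. pose proof (Ymc (- a)).
    assert (Ym (- a) <= c * - a) by (apply H; lra).
    assert (c * del <= c * (a / 5)) by (apply Rmult_le_compat_l; lra).
    assert (2 * r <= K * (2 * r)) by nra. lra. }
  assert (Hu1 : exists u1, - a <= u1 <= del /\ y2 u1 = - eps).
  { specialize (Hcl 0). rewrite M0, Rminus_0_r in Hcl.
    assert (H0 : Rabs (y2 0) <= K * (r + eps)) by (apply Hcl; lra).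
    apply Rabs_le_between in H0.
    destruct (Rle_lt_dec (- eps) (y2 0)) as [h|h].
    - destruct (intermediate_value y2 (- a) 0 (- eps)) as [x [Hx Hx']]; try lra.
      + intros x Hx. apply (is_derive_continuity_pt _ _ (F x (y2 x))). apply Hder. lra.
      + exists x. split; [lra|auto].
    - assert (hT : (- eps - y2 0) / c <= del).
      { apply Rle_div_l; [auto|]. lra. }
      destruct (hitting_time y2 (fun u => F u (y2 u)) 0 a (- eps) c) as [t [Ht Ht']]; auto; try lra.
      + intros; apply Hder; lra.
      + intros u Hu Hl. apply Hslope; lra.
      + exists (0 + t). split; [lra|auto]. }
  destruct Hu1 as [u1 [Hu1 Hy2]].
  assert (Hu1' : - del <= u1).
  { destruct (Rle_lt_dec (- del) u1) as [h|h]; [auto|].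
    assert (h1 : Rabs (y2 u1 - Ym u1) <= K * (r + eps)) by (apply Hcl; lra).
    apply Rabs_le_between in h1. pose proof (Ymc u1) as h2.
    assert (Ym u1 <= c * u1) by (apply h2; lra).
    assert (c * u1 < c * - del) by (apply Rmult_lt_compat_l; lra). lra. }
  destruct (slope_order_lipschitz HF y1 y2 (- a) u1) as [h1 h2]; try lra;
    try (eapply solves_sub; eauto; lra).
  set (w0 := y2 (- a) - y1 (- a)) in *.
  assert (Hw0 : 0 <= w0 <= 2 * r).
  { unfold w0. apply Rabs_le_between in Hi1, Hi2. lra. }
  assert (HEu : exp (M * (u1 - - a)) <= E).
  { apply exp_le. assert (u1 - - a <= 2 * a) by lra. nra. }
  assert (Hw1 : y2 u1 - y1 u1 <= E * w0).
  { eapply Rle_trans; [exact h2|]. apply Rmult_le_compat_r; lra. }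
  set (eta := M * (5 + 2 * B) * del).
  assert (Hed : eps <= del * del) by lra.
  pose proof (slope_contraction_local a b c M B eps del eta fm fp F y1 y2 u1 HF) as Hloc.
  destruct Hloc as [Hl1 Hl2]; auto; try lra.
  { nra. }
  { unfold eta; lra. }
  { apply Rle_div_l; [auto|]. assert (E * w0 <= E * (2 * r)) by (apply Rmult_le_compat_l; lra). lra. }
  split; [exact Hl1|]. eapply Rle_trans; [exact Hl2|]. fold E.
  assert (H3 : 3 * eps / del <= 3 * del).
  { apply Rle_div_l; [auto|]. lra. }
  assert (Hfac : 2 * M * del * E + 3 * eps / del + 2 * eta <= Q * del).
  { unfold Q, eta. lra. }
  apply Rle_trans with (E * (Q * del) / c * (E * w0)).
  - apply Rmult_le_compat; [|lra| |exact Hw1].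
    + apply Rdiv_le_0_compat; [|auto]. apply Rmult_le_pos; [lra|].
      assert (0 <= 3 * eps / del) by (apply Rdiv_le_0_compat; lra).
      assert (0 <= 2 * M * del * E) by (apply Rmult_le_pos; [apply Rmult_le_pos; lra|lra]).
      assert (0 <= eta) by (unfold eta; nra). lra.
    + apply Rmult_le_compat_r; [left; apply Rinv_0_lt_compat; auto|].
      apply Rmult_le_compat_l; lra.
  - replace (E * (Q * del) / c * (E * w0)) with (del * (E * E * Q) / c * w0) by (field; lra).
    apply Rmult_le_compat_r; [lra|]. apply Rle_div_l; auto.
Qed.

(** * Uniqueness and flows *)

Definition lip_ball (W : pt -> pt) (q : pt) (rho L : R) : Prop :=
  forall z w, dst z q < rho -> dst w q < rho -> dst (W z) (W w) <= L * dst z w.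

Definition loc_lip (W : pt -> pt) (q : pt) : Prop :=
  exists rho L, 0 < rho /\ 0 <= L /\ lip_ball W q rho L.

Definition solution (W : pt -> pt) (x : R -> pt) (t0 t1 : R) : Prop :=
  forall t, t0 <= t <= t1 -> velocity x t (W (x t)).

Lemma solution_sub (W : pt -> pt) (x : R -> pt) (t0 t1 s0 s1 : R) :
  solution W x t0 t1 -> t0 <= s0 -> s1 <= t1 -> solution W x s0 s1.
Proof. intros H h1 h2 t Ht. apply H. lra. Qed.

Lemma gronwall_lipschitz (W : pt -> pt) (L : R) (x1 x2 : R -> pt) (t0 t1 : R) :
  0 <= L -> t0 <= t1 -> solution W x1 t0 t1 -> solution W x2 t0 t1 ->
  (forall t, t0 <= t <= t1 -> dst (W (x1 t)) (W (x2 t)) <= L * dst (x1 t) (x2 t)) ->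
  dst (x1 t1) (x2 t1) <= exp (L * (t1 - t0)) * dst (x1 t0) (x2 t0).
Proof.
  intros HL Ht H1 H2 Hl.
  pose proof (gronwall_plane x1 x2 (fun t => W (x1 t)) (fun t => W (x2 t))
    (fun t => L * t) (fun _ => L) (fun _ => 0) (fun _ => 0) t0 t1 Ht H1 H2) as G.
  cbv beta in G. replace (L * t1 - L * t0) with (L * (t1 - t0)) in G by ring.
  rewrite Rminus_diag, Rplus_0_r in G. apply G.
  - intros t _. split; [|auto]. auto_derive; auto. ring.
  - intros t _. split; [|lra]. apply (is_derive_const (V := R_NormedModule)).
  - intros t h. rewrite Rplus_0_r. auto.
Qed.

Lemma speed_bound (x v : R -> pt) (B t0 t1 : R) :
  0 <= B -> t0 <= t1 -> (forall t, t0 <= t <= t1 -> velocity x t (v t)) ->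
  (forall t, t0 <= t <= t1 -> dst (v t) (0, 0) <= B) ->
  dst (x t1) (x t0) <= B * (t1 - t0).
Proof.
  intros HB Ht Hx Hv.
  pose proof (gronwall_plane x (fun _ => x t0) v (fun _ => (0, 0))
    (fun _ => 0) (fun _ => 0) (fun t => B * t) (fun _ => B) t0 t1 Ht Hx) as G.
  cbv beta in G. rewrite Rminus_diag, exp_0, dst_refl in G.
  replace (1 * (0 + (B * t1 - B * t0))) with (B * (t1 - t0)) in G by ring.
  apply G.
  - intros; apply velocity_const.
  - intros t _. split; [|lra]. apply (is_derive_const (V := R_NormedModule)).
  - intros t _. split; [|auto]. auto_derive; auto. ring.
  - intros t h. rewrite Rmult_0_l, Rplus_0_l. auto.
Qed.

(** Local Lipschitz bounds along one of the two curves suffice: near each time both curves lie in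
    the ball around that curve as soon as they agree just before, and Gronwall carries the agreement
    across. *)
Lemma ode_unique_forward (W : pt -> pt) (x1 x2 : R -> pt) (t0 t1 : R) :
  t0 <= t1 -> solution W x1 t0 t1 -> solution W x2 t0 t1 ->
  (forall t, t0 <= t <= t1 -> loc_lip W (x1 t)) ->
  x1 t0 = x2 t0 -> x1 t1 = x2 t1.
Proof.
  intros Ht H1 H2 Hl H0.
  apply (interval_induction (fun s => x1 s = x2 s) t0 t1 Ht H0).
  intros s Hs. destruct (Hl s Hs) as [rho [L [Hr [HL HW]]]].
  assert (Hr4 : 0 < rho / 4) by lra.
  destruct (velocity_continuous x1 s _ (H1 s Hs) _ Hr4) as [d1 [Hd1 C1]].
  destruct (velocity_continuous x2 s _ (H2 s Hs) _ Hr4) as [d2 [Hd2 C2]].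
  exists (Rmin d1 d2). split; [apply Rmin_glb_lt; auto|].
  intros s1 s2 h1 h2 h3 h4 E.
  assert (Hm : Rmin d1 d2 <= d1 /\ Rmin d1 d2 <= d2) by (split; [apply Rmin_l|le_min]).
  assert (C1' : forall t, s1 <= t <= s2 -> dst (x1 t) (x1 s) < rho / 4).
  { intros t Ht'. apply C1. apply Rabs_def1; lra. }
  assert (C2' : forall t, s1 <= t <= s2 -> dst (x2 t) (x2 s) < rho / 4).
  { intros t Ht'. apply C2. apply Rabs_def1; lra. }
  assert (Hss : dst (x2 s) (x1 s) < rho / 2).
  { pose proof (dst_triangle (x2 s) (x2 s1) (x1 s)) as h5.
    rewrite (dst_sym (x2 s) (x2 s1)) in h5. rewrite <- E in h5 at 2.
    specialize (C1' s1). specialize (C2' s1).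
    assert (dst (x1 s1) (x1 s) < rho / 4) by (apply C1'; lra).
    assert (dst (x2 s1) (x2 s) < rho / 4) by (apply C2'; lra). lra. }
  apply dst_eq0.
  assert (dst (x1 s2) (x2 s2) <= exp (L * (s2 - s1)) * dst (x1 s1) (x2 s1)).
  { apply (gronwall_lipschitz W L); auto; [lra| | |].
    - eapply solution_sub; eauto; lra.
    - eapply solution_sub; eauto; lra.
    - intros t Ht'. apply HW.
      + specialize (C1' t Ht'). lra.
      + specialize (C2' t Ht'). pose proof (dst_triangle (x2 t) (x2 s) (x1 s)). lra. }
  rewrite E, dst_refl in H. lra.
Qed.

Lemma ode_unique_backward (W : pt -> pt) (x1 x2 : R -> pt) (t0 t1 : R) :
  t0 <= t1 -> solution W x1 t0 t1 -> solution W x2 t0 t1 ->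
  (forall t, t0 <= t <= t1 -> loc_lip W (x1 t)) ->
  x1 t1 = x2 t1 -> x1 t0 = x2 t0.
Proof.
  intros Ht H1 H2 Hl H0.
  set (W' := fun z => (- fst (W z), - snd (W z))).
  pose proof (ode_unique_forward W' (fun t => x1 (t1 - t)) (fun t => x2 (t1 - t)) 0 (t1 - t0)) as U.
  cbv beta in U. replace (t1 - (t1 - t0)) with t0 in U by ring. rewrite Rminus_0_r in U.
  apply U; [lra| | | |exact H0].
  - intros t Ht'. apply velocity_reverse, H1. lra.
  - intros t Ht'. apply velocity_reverse, H2. lra.
  - intros t Ht'. destruct (Hl (t1 - t)) as [rho [L [A [B C]]]]; [lra|].
    exists rho, L. split; [auto|split; [auto|]]. intros z w Hz Hw.
    eapply Rle_trans; [|apply C; eauto]. right. unfold W', dst; simpl. f_equal. ring.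
Qed.

Definition is_flow (G : pt -> pt) (phi : R -> pt -> pt) : Prop :=
  forall z, phi 0 z = z /\ forall t, velocity (fun t => phi t z) t (G (phi t z)).

Lemma flow_exists (G : pt -> pt) (L B : R) :
  0 < L -> 0 <= B -> lip2 L G -> bounded2 B G -> exists phi, is_flow G phi.
Proof.
  intros HL HB HG Hb.
  destruct (functional_choice (fun (z : pt) (x : R -> pt) =>
     x 0 = z /\ forall t, velocity x t (G (x t)))) as [f Hf].
  - intros z. apply (ode_global_solution G L B z HL HB HG Hb).
  - exists (fun t z => f z t). exact Hf.
Qed.

Lemma lip2_loc_lip (G : pt -> pt) (L : R) (q : pt) : 0 <= L -> lip2 L G -> loc_lip G q.
Proof. intros HL HG. exists 1, L. split; [lra|split; [auto|]]. intros z w _ _. apply HG. Qed.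

Lemma solution_unique (G : pt -> pt) (L : R) (x1 x2 : R -> pt) (s t : R) :
  0 <= L -> lip2 L G -> (forall t, velocity x1 t (G (x1 t))) ->
  (forall t, velocity x2 t (G (x2 t))) -> x1 s = x2 s -> x1 t = x2 t.
Proof.
  intros HL HG H1 H2 E. destruct (Rle_lt_dec s t).
  - apply (ode_unique_forward G x1 x2 s t); auto; try (intros u _; auto).
    apply (lip2_loc_lip _ L); auto.
  - apply (ode_unique_backward G x1 x2 t s); auto; try lra; try (intros u _; auto).
    apply (lip2_loc_lip _ L); auto.
Qed.

Lemma flow_plus (G : pt -> pt) (L : R) (phi : R -> pt -> pt) (s t : R) (z : pt) :
  0 <= L -> lip2 L G -> is_flow G phi -> phi (t + s) z = phi s (phi t z).
Proof.
  intros HL HG Hf.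
  apply (solution_unique G L (fun s => phi (t + s) z) (fun s => phi s (phi t z)) 0 s HL HG).
  - intros u. apply velocity_shift with (g := fun t => phi t z). apply Hf.
  - intros u. apply Hf.
  - rewrite Rplus_0_r. symmetry. apply Hf.
Qed.

Lemma flow_lipschitz (G : pt -> pt) (L : R) (phi : R -> pt -> pt) (t : R) (z w : pt) :
  0 <= L -> lip2 L G -> is_flow G phi ->
  dst (phi t z) (phi t w) <= exp (L * Rabs t) * dst z w.
Proof.
  intros HL HG Hf.
  destruct (Hf z) as [z0 Hz]. destruct (Hf w) as [w0 Hw].
  destruct (Rle_lt_dec 0 t) as [Ht|Ht].
  - rewrite Rabs_right by lra.
    pose proof (gronwall_lipschitz G L (fun t => phi t z) (fun t => phi t w) 0 t HL Ht) as g.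
    cbv beta in g. rewrite z0, w0, Rminus_0_r in g. apply g; try (intros u _; auto).
  - rewrite Rabs_left by lra.
    set (G' := fun z => (- fst (G z), - snd (G z))).
    pose proof (gronwall_lipschitz G' L (fun s => phi (0 - s) z) (fun s => phi (0 - s) w) 0 (- t) HL) as g.
    cbv beta in g. replace (0 - - t) with t in g by ring. rewrite !Rminus_0_r in g.
    rewrite z0, w0 in g. apply g; [lra| | |].
    + intros u _. apply (velocity_reverse (fun t => phi t z)). apply Hz.
    + intros u _. apply (velocity_reverse (fun t => phi t w)). apply Hw.
    + intros u _. eapply Rle_trans; [|apply HG]. right. unfold G', dst; simpl. f_equal. ring.
Qed.

Lemma flow_speed (G : pt -> pt) (B : R) (phi : R -> pt -> pt) (s t : R) (z : pt) :
  0 <= B -> bounded2 B G -> is_flow G phi ->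
  dst (phi t z) (phi s z) <= B * Rabs (t - s).
Proof.
  intros HB Hb Hf.
  assert (H : forall s t, s <= t -> dst (phi t z) (phi s z) <= B * Rabs (t - s)).
  { intros s' t' h. rewrite Rabs_right by lra.
    apply (speed_bound (fun t => phi t z) (fun t => G (phi t z))); auto.
    intros; apply Hf. }
  destruct (Rle_lt_dec s t) as [h|h]; [auto|].
  rewrite dst_sym, Rabs_minus_sym. apply H. lra.
Qed.

(** * Cut-off functions and gluing of fields *)

Definition bump (q : pt) (rho : R) (z : pt) : R :=
  Rmax 0 (Rmin 1 (2 - dst z q / rho)).

Lemma bump_range (q : pt) (rho : R) (z : pt) : 0 <= bump q rho z <= 1.
Proof.
  unfold bump. split; [apply Rmax_l|]. apply Rmax_lub; [lra|apply Rmin_l].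
Qed.

Lemma bump_one (q : pt) (rho : R) (z : pt) : 0 < rho -> dst z q < rho -> bump q rho z = 1.
Proof.
  intros Hr H. unfold bump. assert (dst z q / rho < 1) by (apply Rlt_div_l; lra).
  rewrite Rmin_left by lra. apply Rmax_right. lra.
Qed.

Lemma bump_zero (q : pt) (rho : R) (z : pt) : 0 < rho -> 2 * rho <= dst z q -> bump q rho z = 0.
Proof.
  intros Hr H. unfold bump. assert (2 <= dst z q / rho) by (apply Rle_div_r; lra).
  apply Rmax_left. eapply Rle_trans; [apply Rmin_r|]. lra.
Qed.

Lemma bump_lipschitz (q : pt) (rho : R) (z w : pt) :
  0 < rho -> Rabs (bump q rho z - bump q rho w) <= / rho * dst z w.
Proof.
  intros Hr.
  assert (H : Rabs (dst z q / rho - dst w q / rho) <= / rho * dst z w).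
  { replace (dst z q / rho - dst w q / rho) with (/ rho * (dst z q - dst w q)) by (field; lra).
    rewrite Rabs_mult, Rabs_right by (left; apply Rinv_0_lt_compat; auto).
    apply Rmult_le_compat_l; [left; apply Rinv_0_lt_compat; auto|].
    pose proof (dst_triangle z w q). pose proof (dst_triangle w z q).
    rewrite (dst_sym w z) in *. apply Rabs_le. lra. }
  eapply Rle_trans; [|exact H]. unfold bump.
  set (a := dst z q / rho). set (b := dst w q / rho). clearbody a b. clear.
  unfold Rmin. destruct (Rle_dec 1 (2 - a)), (Rle_dec 1 (2 - b)); unfold Rmax;
  repeat match goal with |- context [Rle_dec ?x ?y] => destruct (Rle_dec x y) end;
  unfold Rabs;
  repeat match goal with |- context [Rcase_abs ?x] => destruct (Rcase_abs x) end; lra.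
Qed.

Lemma dst_combination (a b : R) (u v u' v' : pt) :
  dst (a * fst u + b * fst v, a * snd u + b * snd v)
      (a * fst u' + b * fst v', a * snd u' + b * snd v') <=
  Rabs a * dst u u' + Rabs b * dst v v'.
Proof.
  assert (Hs : forall c x y, Rabs c * dst x y =
     sqrt ((c * (fst x - fst y)) ^ 2 + (c * (snd x - snd y)) ^ 2)).
  { intros c x y. unfold dst. rewrite <- sqrt_Rsqr_abs, <- sqrt_mult.
    f_equal. unfold Rsqr. ring. apply Rle_0_sqr. apply dst_arg_nonneg. }
  rewrite !Hs. eapply Rle_trans; [|apply sqrt_sum_triangle].
  right. unfold dst; simpl. f_equal. ring.
Qed.

Lemma dst_scale_diff (a b : R) (u : pt) :
  dst (a * fst u, a * snd u) (b * fst u, b * snd u) = Rabs (a - b) * dst u (0, 0).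
Proof.
  unfold dst; simpl. rewrite <- sqrt_Rsqr_abs, <- sqrt_mult.
  f_equal. unfold Rsqr. ring. apply Rle_0_sqr. apply (dst_arg_nonneg u (0, 0)).
Qed.

Lemma dst_plus_split (u v u' v' : pt) :
  dst (fst u + fst v, snd u + snd v) (fst u' + fst v', snd u' + snd v') <=
  dst u u' + dst v v'.
Proof.
  pose proof (dst_combination 1 1 u v u' v'). rewrite Rabs_R1, !Rmult_1_l in H. exact H.
Qed.

(** The delicate case has one point outside the ball, where [W] is uncontrolled: the cut-off
    vanishes there, so [W] at that point may be replaced by its value at the other one, and only the
    variation of the cut-off remains. *)
Lemma scaled_field_lipschitz (chi : pt -> R) (W : pt -> pt) (q : pt) (rho B L K : R) :
  0 <= B -> 0 <= L -> 0 <= K ->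
  (forall z, 0 <= chi z <= 1) -> (forall z, rho <= dst z q -> chi z = 0) ->
  (forall z w, Rabs (chi z - chi w) <= K * dst z w) ->
  (forall z, dst z q < rho -> dst (W z) (0, 0) <= B) -> lip_ball W q rho L ->
  lip2 (K * B + L) (fun z => (chi z * fst (W z), chi z * snd (W z))).
Proof.
  intros HB HL HK Hr H0 Hc Hb HW z w. cbv beta.
  assert (Hout : forall z w, rho <= dst w q ->
     dst (chi z * fst (W z), chi z * snd (W z)) (chi w * fst (W w), chi w * snd (W w))
     <= (K * B + L) * dst z w).
  { intros z' w' hw. pose proof (dst_nonneg z' w') as h0.
    replace (chi w' * fst (W w'), chi w' * snd (W w')) with
            (chi w' * fst (W z'), chi w' * snd (W z')) by (rewrite (H0 w' hw); f_equal; ring).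
    rewrite dst_scale_diff.
    destruct (Rle_lt_dec rho (dst z' q)) as [hz|hz].
    - rewrite (H0 z' hz), (H0 w' hw), Rminus_diag, Rabs_R0, Rmult_0_l.
      apply Rmult_le_pos; [nra|auto].
    - specialize (Hb z' hz). specialize (Hc z' w').
      apply Rle_trans with (K * dst z' w' * B); [|nra].
      apply Rmult_le_compat; auto. apply Rabs_pos. apply dst_nonneg. }
  destruct (Rle_lt_dec rho (dst w q)) as [hw|hw]; [auto|].
  destruct (Rle_lt_dec rho (dst z q)) as [hz|hz].
  { rewrite dst_sym, (dst_sym z w). auto. }
  eapply Rle_trans; [apply (dst_triangle _ (chi w * fst (W z), chi w * snd (W z)))|].
  rewrite dst_scale_diff.
  pose proof (dst_combination (chi w) 0 (W z) (0,0) (W w) (0,0)) as h.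
  simpl in h. rewrite !Rmult_0_r, !Rplus_0_r, Rabs_R0, Rmult_0_l, Rplus_0_r in h.
  specialize (Hb z hz). specialize (Hc z w). specialize (HW z w hz hw).
  pose proof (dst_nonneg z w). pose proof (dst_nonneg (W z) (W w)).
  destruct (Hr w). rewrite (Rabs_right (chi w)) in h by lra.
  assert (Rabs (chi z - chi w) * dst (W z) (0, 0) <= K * dst z w * B).
  { apply Rmult_le_compat; auto. apply Rabs_pos. apply dst_nonneg. }
  assert (chi w * dst (W z) (W w) <= 1 * (L * dst z w)).
  { apply Rmult_le_compat; auto. }
  lra.
Qed.

(** Equal to [W] within [rho] of q and to [G] beyond [2 * rho]. As a convex combination it keeps any
    common speed bound; the transition costs 1/rho in the Lipschitz constant. *)
Definition glue (q : pt) (rho : R) (G W : pt -> pt) (z : pt) : pt :=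
  ((1 - bump q rho z) * fst (G z) + bump q rho z * fst (W z),
   (1 - bump q rho z) * snd (G z) + bump q rho z * snd (W z)).

Lemma glue_lipschitz (q : pt) (rho B B' L L' : R) (G W : pt -> pt) :
  0 < rho -> 0 <= B -> 0 <= B' -> 0 <= L -> 0 <= L' ->
  lip2 L G -> bounded2 B G ->
  (forall z, dst z q < 2 * rho -> dst (W z) (0, 0) <= B') ->
  lip_ball W q (2 * rho) L' ->
  lip2 ((/ rho * B + L) + (/ rho * B' + L')) (glue q rho G W).
Proof.
  intros Hr HB HB' HL HL' HG Hb Hb' HW.
  assert (Hi : 0 <= / rho) by (left; apply Rinv_0_lt_compat; auto).
  assert (H1 : lip2 (/ rho * B + L)
     (fun z => ((1 - bump q rho z) * fst (G z), (1 - bump q rho z) * snd (G z)))).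
  { intros z w. cbv beta.
    eapply Rle_trans; [apply (dst_triangle _ ((1 - bump q rho w) * fst (G z), (1 - bump q rho w) * snd (G z)))|].
    rewrite dst_scale_diff.
    pose proof (dst_combination (1 - bump q rho w) 0 (G z) (0,0) (G w) (0,0)) as h.
    simpl in h. rewrite !Rmult_0_r, !Rplus_0_r, Rabs_R0, Rmult_0_l, Rplus_0_r in h.
    pose proof (bump_lipschitz q rho z w Hr) as hl.
    replace (1 - bump q rho z - (1 - bump q rho w)) with (- (bump q rho z - bump q rho w)) by ring.
    rewrite Rabs_Ropp.
    pose proof (dst_nonneg z w). pose proof (dst_nonneg (G z) (G w)).
    pose proof (bump_range q rho w). rewrite (Rabs_right (1 - bump q rho w)) in h by lra.
    assert (Rabs (bump q rho z - bump q rho w) * dst (G z) (0, 0) <= / rho * dst z w * B).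
    { apply Rmult_le_compat; auto. apply Rabs_pos. apply dst_nonneg. }
    assert ((1 - bump q rho w) * dst (G z) (G w) <= 1 * (L * dst z w)).
    { apply Rmult_le_compat; auto; lra. }
    lra. }
  assert (H2 : lip2 (/ rho * B' + L')
     (fun z => (bump q rho z * fst (W z), bump q rho z * snd (W z)))).
  { apply (scaled_field_lipschitz (bump q rho) W q (2 * rho)); auto.
    - apply bump_range.
    - intros; apply bump_zero; auto.
    - intros; apply bump_lipschitz; auto. }
  intros z w. unfold glue.
  eapply Rle_trans; [apply (dst_plus_split
    ((1 - bump q rho z) * fst (G z), (1 - bump q rho z) * snd (G z))
    (bump q rho z * fst (W z), bump q rho z * snd (W z))
    ((1 - bump q rho w) * fst (G w), (1 - bump q rho w) * snd (G w))
    (bump q rho w * fst (W w), bump q rho w * snd (W w)))|].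
  specialize (H1 z w). specialize (H2 z w). cbv beta in H1, H2. lra.
Qed.

Lemma convex_bounded (l : R) (u v : pt) (B : R) :
  0 <= l <= 1 -> dst u (0, 0) <= B -> dst v (0, 0) <= B ->
  dst ((1 - l) * fst u + l * fst v, (1 - l) * snd u + l * snd v) (0, 0) <= B.
Proof.
  intros Hl Hu Hv.
  pose proof (dst_combination (1 - l) l u v (0, 0) (0, 0)) as h.
  simpl in h. rewrite !Rmult_0_r, !Rplus_0_r in h.
  rewrite !Rabs_right in h by lra. nra.
Qed.

Lemma glue_bounded (q : pt) (rho B : R) (G W : pt -> pt) :
  0 < rho -> bounded2 B G ->
  (forall z, dst z q < 2 * rho -> dst (W z) (0, 0) <= B) ->
  bounded2 B (glue q rho G W).
Proof.
  intros Hr Hb Hb' z. unfold glue.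
  destruct (Rle_lt_dec (2 * rho) (dst z q)) as [h|h].
  - rewrite bump_zero by auto. specialize (Hb z).
    replace ((1 - 0) * fst (G z) + 0 * fst (W z)) with (fst (G z)) by ring.
    replace ((1 - 0) * snd (G z) + 0 * snd (W z)) with (snd (G z)) by ring.
    rewrite <- surjective_pairing. exact Hb.
  - apply convex_bounded; auto. apply bump_range.
Qed.

(** Where [G] already equals [W] the combination changes nothing, so a gluing step does not spoil
    the agreement obtained by earlier ones. *)
Lemma glue_agrees (q : pt) (rho : R) (G W : pt -> pt) (z : pt) :
  0 < rho -> G z = W z \/ dst z q < rho -> glue q rho G W z = W z.
Proof.
  intros Hr [H|H]; unfold glue.
  - rewrite H. rewrite (surjective_pairing (W z)) at 5. f_equal; ring.
  - rewrite bump_one by auto. rewrite (surjective_pairing (W z)) at 3. f_equal; ring.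
Qed.

(** * The regularized field *)

Lemma MVT_segment (f : R -> R) (M x y : R) :
  (forall s, Rmin x y <= s <= Rmax x y -> ex_derive f s) ->
  (forall s, Rmin x y <= s <= Rmax x y -> Rabs (Derive f s) <= M) ->
  Rabs (f y - f x) <= M * Rabs (y - x).
Proof.
  intros Hd HM.
  destruct (MVT_gen f x y (Derive f)) as [s [Hs E]].
  - intros s Hs. apply Derive_correct, Hd. lra.
  - intros s Hs. eapply is_derive_continuity_pt. apply Derive_correct, Hd. exact Hs.
  - rewrite E, Rabs_mult. apply Rmult_le_compat_r; [apply Rabs_pos|]. auto.
Qed.

Lemma between_Rabs (x y s c r : R) :
  Rmin x y <= s <= Rmax x y -> Rabs (x - c) < r -> Rabs (y - c) < r -> Rabs (s - c) < r.
Proof.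
  intros Hs Hx Hy. apply Rabs_def2 in Hx, Hy. apply Rabs_def1.
  - revert Hs. unfold Rmin, Rmax. destruct (Rle_dec x y); lra.
  - revert Hs. unfold Rmin, Rmax. destruct (Rle_dec x y); lra.
Qed.

(** The first partial derivatives are continuous at q, hence bounded nearby; the mean value theorem
    is applied along a horizontal and then a vertical segment, whose common corner stays in the
    coordinate box around q. *)
Lemma Ck_locally_lipschitz (r : nat) (U : set2) (f : pt -> R) (q : pt) :
  open U -> U q -> Ck_on (S r) U f ->
  exists rho L, 0 < rho /\ 0 <= L /\
    forall z w, dst z q < rho -> dst w q < rho -> Rabs (f z - f w) <= L * dst z w.
Proof.
  intros HU Hq Hf.
  destruct (open_dst U q HU Hq) as [r0 [Hr0 HUr]].
  destruct (Hf q Hq) as [_ [_ [_ [H1 H2]]]].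
  assert (c1 : continuity_2d_pt (fun u v => Derive (fun z => f (z, v)) u) (fst q) (snd q)).
  { destruct r; apply H1. }
  assert (c2 : continuity_2d_pt (fun u v => Derive (fun z => f (u, z)) v) (fst q) (snd q)).
  { destruct r; apply H2. }
  destruct (c1 (mkposreal 1 Rlt_0_1)) as [d1 D1].
  destruct (c2 (mkposreal 1 Rlt_0_1)) as [d2 D2]. simpl in D1, D2.
  set (a1 := Derive (fun z => f (z, snd q)) (fst q)) in *.
  set (a2 := Derive (fun z => f (fst q, z)) (snd q)) in *.
  set (M := Rabs a1 + Rabs a2 + 1).
  set (rho := Rmin (r0 / 2) (Rmin d1 d2)).
  assert (Hrho : 0 < rho).
  { unfold rho. repeat apply Rmin_glb_lt; try apply cond_pos. lra. }
  assert (l0 : rho <= r0 / 2) by le_min.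
  assert (l1 : rho <= d1) by le_min.
  assert (l2 : rho <= d2) by le_min.
  assert (HM : 0 <= M) by (unfold M; pose proof (Rabs_pos a1); pose proof (Rabs_pos a2); lra).
  assert (HUxy : forall x y, Rabs (x - fst q) < rho -> Rabs (y - snd q) < rho -> U (x, y)).
  { intros x y hx hy. apply HUr. apply dst_lt_of_abs; simpl; lra. }
  exists rho, (2 * M). split; [auto|split; [lra|]].
  intros z w Hz Hw.
  pose proof (dst_fst z q). pose proof (dst_snd z q).
  pose proof (dst_fst w q). pose proof (dst_snd w q).
  destruct z as [z1 z2], w as [w1 w2], q as [q1 q2]. cbn [fst snd] in *.
  assert (A : Rabs (f (z1, z2) - f (w1, z2)) <= M * Rabs (z1 - w1)).
  { apply (MVT_segment (fun x => f (x, z2))).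
    - intros s Hs. apply (between_Rabs _ _ _ q1 rho) in Hs; try lra.
      destruct (Hf (s, z2)) as [_ [h _]]; [apply HUxy; lra|]. exact h.
    - intros s Hs. apply (between_Rabs _ _ _ q1 rho) in Hs; try lra.
      assert (h : Rabs (Derive (fun x => f (x, z2)) s - a1) < 1) by (apply D1; lra).
      pose proof (Rabs_triang_inv (Derive (fun x => f (x, z2)) s) a1).
      pose proof (Rabs_pos a2). unfold M. lra. }
  assert (B : Rabs (f (w1, z2) - f (w1, w2)) <= M * Rabs (z2 - w2)).
  { apply (MVT_segment (fun y => f (w1, y))).
    - intros s Hs. apply (between_Rabs _ _ _ q2 rho) in Hs; try lra.
      destruct (Hf (w1, s)) as [_ [_ [h _]]]; [apply HUxy; lra|]. exact h.
    - intros s Hs. apply (between_Rabs _ _ _ q2 rho) in Hs; try lra.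
      assert (h : Rabs (Derive (fun y => f (w1, y)) s - a2) < 1) by (apply D2; lra).
      pose proof (Rabs_triang_inv (Derive (fun y => f (w1, y)) s) a2).
      pose proof (Rabs_pos a1). unfold M. lra. }
  pose proof (dst_fst (z1, z2) (w1, w2)) as h1. pose proof (dst_snd (z1, z2) (w1, w2)) as h2.
  cbn [fst snd] in h1, h2.
  replace (f (z1, z2) - f (w1, w2)) with
    ((f (z1, z2) - f (w1, z2)) + (f (w1, z2) - f (w1, w2))) by ring.
  eapply Rle_trans; [apply Rabs_triang|].
  apply Rmult_le_compat_l with (r := M) in h1; auto.
  apply Rmult_le_compat_l with (r := M) in h2; auto. lra.
Qed.

Definition nice_at (X : pt -> pt) (q : pt) : Prop :=
  exists rho L B, 0 < rho /\ 0 <= L /\ 0 <= B /\ lip_ball X q rho L /\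
    forall z, dst z q < rho -> dst (X z) (0, 0) <= B.

Lemma Ck_field_nice (r : nat) (U : set2) (X : pt -> pt) (q : pt) :
  open U -> U q -> Ck_field_on (S r) U X -> nice_at X q.
Proof.
  intros HU Hq [H1 H2].
  destruct (Ck_locally_lipschitz r U _ q HU Hq H1) as [r1 [L1 [A1 [B1 C1]]]].
  destruct (Ck_locally_lipschitz r U _ q HU Hq H2) as [r2 [L2 [A2 [B2 C2]]]].
  set (rho := Rmin r1 r2).
  assert (Hr : 0 < rho) by (apply Rmin_glb_lt; auto).
  assert (l1 : rho <= r1) by le_min. assert (l2 : rho <= r2) by le_min.
  assert (HL : lip_ball X q rho (L1 + L2)).
  { intros z w Hz Hw. eapply Rle_trans; [apply dst_le_sum|].
    assert (h1 : Rabs (fst (X z) - fst (X w)) <= L1 * dst z w) by (apply C1; lra).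
    assert (h2 : Rabs (snd (X z) - snd (X w)) <= L2 * dst z w) by (apply C2; lra). lra. }
  exists rho, (L1 + L2), ((L1 + L2) * rho + dst (X q) (0, 0)).
  pose proof (dst_nonneg (X q) (0, 0)).
  split; [auto|split; [lra|split; [|split; [exact HL|]]]].
  - assert (0 <= (L1 + L2) * rho) by (apply Rmult_le_pos; lra). lra.
  - intros z Hz. eapply Rle_trans; [apply (dst_triangle _ (X q))|].
    apply Rplus_le_compat_r. eapply Rle_trans; [apply HL; auto|].
    + rewrite dst_refl; auto.
    + apply Rmult_le_compat_l; lra.
Qed.

(** * Transition function and weights *)

Record transition (ell : R) (Phi : R -> R) : Prop := Transition {
  tr_ell : 0 <= ell;
  tr_lip : forall s t, Rabs (Phi s - Phi t) <= ell * Rabs (s - t);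
  tr_mono : forall s t, s <= t -> Phi s <= Phi t;
  tr_up : forall s, 1 <= s -> Phi s = 1;
  tr_low : forall s, s <= -1 -> Phi s = -1
}.

Arguments tr_ell {ell Phi}.
Arguments tr_lip {ell Phi}.
Arguments tr_mono {ell Phi}.
Arguments tr_up {ell Phi}.
Arguments tr_low {ell Phi}.

(** [Phi] is [phi] composed with the projection of the line onto [-1, 1]. Since the projection is
    monotone and 1-Lipschitz, the maximum of |phi'| on [-1, 1] is a Lipschitz constant of [Phi]. *)
Lemma monotonic_transition_facts (r : nat) (Phi : R -> R) :
  monotonic_transition r Phi -> exists ell, transition ell Phi.
Proof.
  intros [phi [Hs [H1 [H2 [_ [Hd [Hin Hout]]]]]]].
  assert (Hex : forall x, ex_derive phi x) by (intros x; apply (Hs 1%nat x)).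
  assert (HcD : forall x, continuity_pt (Derive phi) x).
  { intros x. destruct (Hs 2%nat x) as [l Hl]. apply (is_derive_continuity_pt _ _ l). exact Hl. }
  destruct (continuity_ab_maj (fun x => Rabs (Derive phi x)) (-1) 1) as [xm [Hxm _]].
  { lra. }
  { intros c _. apply (continuity_pt_comp (Derive phi) Rabs). apply HcD. apply Rcontinuity_abs. }
  set (ell := Rabs (Derive phi xm)) in *.
  set (cl := fun s => Rmax (-1) (Rmin 1 s)).
  assert (Hcl : forall s, -1 <= cl s <= 1).
  { intros s. unfold cl. split; [apply Rmax_l|]. apply Rmax_lub; [lra|apply Rmin_l]. }
  assert (HPhi : forall s, Phi s = phi (cl s)).
  { intros s. unfold cl. destruct (Rle_lt_dec 1 s) as [h|h].
    - rewrite Rmin_left, Rmax_right by lra. rewrite Hout, sign_eq_1; auto. lra.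
      rewrite Rabs_right; lra.
    - rewrite Rmin_right by lra. destruct (Rle_lt_dec s (-1)) as [h'|h'].
      + rewrite Rmax_left by lra. rewrite Hout, sign_eq_m1; auto. lra.
        rewrite Rabs_left; lra.
      + rewrite Rmax_right by lra. apply Hin. apply Rabs_le. lra. }
  assert (Hclm : forall s t, s <= t -> cl s <= cl t).
  { intros s t h. unfold cl. apply Rle_max_compat_l. apply Rle_min_compat_l. exact h. }
  exists ell. constructor.
  - apply Rabs_pos.
  - intros s t. rewrite !HPhi.
    apply Rle_trans with (ell * Rabs (cl s - cl t)).
    + apply MVT_segment; [intros; apply Hex|].
      intros u Hu. apply Hxm. pose proof (Hcl s). pose proof (Hcl t).
      revert Hu. unfold Rmin, Rmax. destruct (Rle_dec (cl t) (cl s)); lra.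
    + apply Rmult_le_compat_l; [apply Rabs_pos|].
      unfold cl, Rmin. destruct (Rle_dec 1 s), (Rle_dec 1 t); unfold Rmax;
      repeat match goal with |- context [Rle_dec ?x ?y] => destruct (Rle_dec x y) end;
      unfold Rabs;
      repeat match goal with |- context [Rcase_abs ?x] => destruct (Rcase_abs x) end; lra.
  - intros s t h. rewrite !HPhi. specialize (Hclm s t h).
    pose proof (derive_ge_increase phi (Derive phi) (cl s) (cl t) 0 Hclm) as g.
    assert (phi (cl s) + 0 * (cl t - cl s) <= phi (cl t)); [|lra]. apply g.
    + intros; apply Derive_correct, Hex.
    + intros x Hx. pose proof (Hcl s). pose proof (Hcl t). left; apply Hd. lra.
  - intros s h. rewrite Hout, sign_eq_1; auto. lra. rewrite Rabs_right; lra.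
  - intros s h. rewrite Hout, sign_eq_m1; auto. lra. rewrite Rabs_left; lra.
Qed.

(** The weight of [Xp] in the regularization at height y. *)
Definition lam (Phi : R -> R) (eps y : R) : R := (1 + Phi (y / eps)) / 2.

Section Lambda.
Context {ell : R} {Phi : R -> R} (T : transition ell Phi) {eps : R} (Heps : 0 < eps).

Lemma lam_up (y : R) : eps <= y -> lam Phi eps y = 1.
Proof.
  intros h. unfold lam. rewrite (tr_up T). lra. apply Rle_div_r; lra.
Qed.

Lemma lam_low (y : R) : y <= - eps -> lam Phi eps y = 0.
Proof.
  intros h. unfold lam. rewrite (tr_low T). lra. apply Rle_div_l; lra.
Qed.

Lemma lam_mono (y y' : R) : y <= y' -> lam Phi eps y <= lam Phi eps y'.
Proof.
  intros h. unfold lam.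
  assert (Phi (y / eps) <= Phi (y' / eps)); [|lra]. apply (tr_mono T).
  apply Rmult_le_compat_r; [left; apply Rinv_0_lt_compat; auto|auto].
Qed.

Lemma lam_range (y : R) : 0 <= lam Phi eps y <= 1.
Proof.
  split.
  - rewrite <- (lam_low (Rmin y (- eps))) by le_min. apply lam_mono, Rmin_l.
  - rewrite <- (lam_up (Rmax y eps)) by apply Rmax_r. apply lam_mono, Rmax_l.
Qed.

Lemma lam_lip (y y' : R) :
  Rabs (lam Phi eps y - lam Phi eps y') <= ell / eps * Rabs (y - y').
Proof.
  unfold lam.
  replace ((1 + Phi (y / eps)) / 2 - (1 + Phi (y' / eps)) / 2) with
    (/ 2 * (Phi (y / eps) - Phi (y' / eps))) by field.
  rewrite Rabs_mult, (Rabs_right (/ 2)) by lra.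
  pose proof (tr_lip T (y / eps) (y' / eps)) as h.
  replace (y / eps - y' / eps) with (/ eps * (y - y')) in h by (field; lra).
  rewrite Rabs_mult, (Rabs_right (/ eps)) in h by (left; apply Rinv_0_lt_compat; auto).
  replace (ell / eps * Rabs (y - y')) with (ell * (/ eps * Rabs (y - y'))) by (field; lra).
  pose proof (Rabs_pos (Phi (y / eps) - Phi (y' / eps))). lra.
Qed.
End Lambda.

Record tame (Z : filippov) : Prop := Tame {
  tm_open : open (dom Z);
  tm_h : forall q, dom Z q -> h Z q = snd q;
  tm_p : forall q, dom Z q -> 0 <= snd q -> nice_at (Xp Z) q;
  tm_m : forall q, dom Z q -> snd q <= 0 -> nice_at (Xm Z) q
}.

Arguments tm_open {Z}.
Arguments tm_h {Z}.
Arguments tm_p {Z}.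
Arguments tm_m {Z}.

Lemma filippov_tame (Z : filippov) (k : nat) :
  (1 <= k)%nat -> filippov_class Z (2 * k) -> (forall q, dom Z q -> h Z q = snd q) -> tame Z.
Proof.
  intros Hk [Ho [_ [_ [_ [[U [HU [HUs HUk]]] [V [HV [HVs HVk]]]]]]]] Hh.
  destruct k as [|k]; [lia|]. replace (2 * S k)%nat with (S (S (2 * k))) in * by lia.
  constructor; auto.
  - intros q Hq Hy. apply (Ck_field_nice (S (2 * k)) U (Xp Z) q HU); [|exact HUk].
    apply HUs. unfold union, Sigma_p, Sigma. rewrite Hh by auto.
    destruct Hy as [Hy|Hy]; [left|right]; auto.
  - intros q Hq Hy. apply (Ck_field_nice (S (2 * k)) V (Xm Z) q HV); [|exact HVk].
    apply HVs. unfold union, Sigma_m, Sigma. rewrite Hh by auto.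
    destruct Hy as [Hy|Hy]; [left|right]; auto.
Qed.

Section Regularized.
Context {Z : filippov} (TZ : tame Z) {ell : R} {Phi : R -> R} (T : transition ell Phi).

Lemma reg_convex (eps : R) (z : pt) : dom Z z ->
  regularization Z Phi eps z =
    ((1 - lam Phi eps (snd z)) * fst (Xm Z z) + lam Phi eps (snd z) * fst (Xp Z z),
     (1 - lam Phi eps (snd z)) * snd (Xm Z z) + lam Phi eps (snd z) * snd (Xp Z z)).
Proof.
  intros Hz. unfold regularization, lam. rewrite (tm_h TZ z Hz). f_equal; field.
Qed.

Lemma reg_up (eps : R) (z : pt) : 0 < eps -> dom Z z -> eps <= snd z ->
  regularization Z Phi eps z = Xp Z z.
Proof.
  intros He Hz Hy. rewrite reg_convex by auto. rewrite (lam_up T He) by auto.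
  rewrite (surjective_pairing (Xp Z z)) at 3. f_equal; ring.
Qed.

Lemma reg_low (eps : R) (z : pt) : 0 < eps -> dom Z z -> snd z <= - eps ->
  regularization Z Phi eps z = Xm Z z.
Proof.
  intros He Hz Hy. rewrite reg_convex by auto. rewrite (lam_low T He) by auto.
  rewrite (surjective_pairing (Xm Z z)) at 3. f_equal; ring.
Qed.

Lemma convex_diff (l m : R) (u v u' v' : pt) :
  0 <= l <= 1 ->
  dst ((1 - l) * fst u + l * fst v, (1 - l) * snd u + l * snd v)
      ((1 - m) * fst u' + m * fst v', (1 - m) * snd u' + m * snd v') <=
  (1 - l) * dst u u' + l * dst v v' + Rabs (l - m) * dst v' u'.
Proof.
  intros Hl.
  eapply Rle_trans; [apply (dst_triangle _
    ((1 - l) * fst u' + l * fst v', (1 - l) * snd u' + l * snd v'))|].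
  apply Rplus_le_compat.
  - pose proof (dst_combination (1 - l) l u v u' v') as h.
    rewrite !Rabs_right in h by lra. exact h.
  - right. unfold dst; simpl. rewrite <- sqrt_Rsqr_abs, <- sqrt_mult.
    f_equal. unfold Rsqr. ring. apply Rle_0_sqr. apply (dst_arg_nonneg v' u').
Qed.

(** Off Sigma the ball is shrunk so that it keeps height at least [rho] on its side; for eps < rho
    it misses the strip and the regularization is a single field there. On Sigma both fields are
    controlled at once. *)
Lemma local_structure (q : pt) : dom Z q ->
  exists rho L B, 0 < rho /\ 0 <= L /\ 0 <= B /\
    (forall z, dst z q < rho -> dom Z z) /\
    ((0 < snd q /\ lip_ball (Xp Z) q rho L /\
      (forall z, dst z q < rho -> rho <= snd z /\ dst (Xp Z z) (0, 0) <= B)) \/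
     (snd q < 0 /\ lip_ball (Xm Z) q rho L /\
      (forall z, dst z q < rho -> snd z <= - rho /\ dst (Xm Z z) (0, 0) <= B)) \/
     (snd q = 0 /\ lip_ball (Xp Z) q rho L /\ lip_ball (Xm Z) q rho L /\
      (forall z, dst z q < rho -> dst (Xp Z z) (0, 0) <= B /\ dst (Xm Z z) (0, 0) <= B))).
Proof.
  intros Hq.
  destruct (open_dst _ q (tm_open TZ) Hq) as [r0 [Hr0 Hd]].
  destruct (Rtotal_order (snd q) 0) as [Hy|[Hy|Hy]].
  - destruct (tm_m TZ q Hq) as [r [L [B [h1 [h2 [h3 [h4 h5]]]]]]]; [lra|].
    set (rho := Rmin r0 (Rmin r (- snd q / 2))).
    assert (l0 : rho <= r0) by le_min.
    assert (l1 : rho <= r) by le_min.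
    assert (l2 : rho <= - snd q / 2) by le_min.
    exists rho, L, B. split; [unfold rho; repeat apply Rmin_glb_lt; lra|].
    split; [auto|split; [auto|split; [intros; apply Hd; lra|]]].
    right; left. split; [auto|split].
    + intros z w Hz Hw; apply h4; lra.
    + intros z Hz. split; [|apply h5; lra].
      pose proof (dst_snd z q) as hs. apply Rabs_le_between in hs. lra.
  - destruct (tm_m TZ q Hq) as [r [L [B [h1 [h2 [h3 [h4 h5]]]]]]]; [lra|].
    destruct (tm_p TZ q Hq) as [r' [L' [B' [h1' [h2' [h3' [h4' h5']]]]]]]; [lra|].
    set (rho := Rmin r0 (Rmin r r')).
    assert (l0 : rho <= r0) by le_min.
    assert (l1 : rho <= r) by le_min.
    assert (l2 : rho <= r') by le_min.
    exists rho, (L + L'), (B + B'). split; [unfold rho; repeat apply Rmin_glb_lt; lra|].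
    split; [lra|split; [lra|split; [intros; apply Hd; lra|]]].
    right; right. split; [auto|split; [|split]].
    + intros z w Hz Hw. specialize (h4' z w). pose proof (dst_nonneg z w).
      assert (dst (Xp Z z) (Xp Z w) <= L' * dst z w) by (apply h4'; lra). nra.
    + intros z w Hz Hw. specialize (h4 z w). pose proof (dst_nonneg z w).
      assert (dst (Xm Z z) (Xm Z w) <= L * dst z w) by (apply h4; lra). nra.
    + intros z Hz. specialize (h5 z). specialize (h5' z).
      assert (dst (Xp Z z) (0, 0) <= B') by (apply h5'; lra).
      assert (dst (Xm Z z) (0, 0) <= B) by (apply h5; lra). lra.
  - destruct (tm_p TZ q Hq) as [r [L [B [h1 [h2 [h3 [h4 h5]]]]]]]; [lra|].
    set (rho := Rmin r0 (Rmin r (snd q / 2))).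
    assert (l0 : rho <= r0) by le_min.
    assert (l1 : rho <= r) by le_min.
    assert (l2 : rho <= snd q / 2) by le_min.
    exists rho, L, B. split; [unfold rho; repeat apply Rmin_glb_lt; lra|].
    split; [auto|split; [auto|split; [intros; apply Hd; lra|]]].
    left. split; [auto|split].
    + intros z w Hz Hw; apply h4; lra.
    + intros z Hz. split; [|apply h5; lra].
      pose proof (dst_snd z q) as hs. apply Rabs_le_between in hs. lra.
Qed.

(** The variation of the weight is kept as a separate term: a crude use bounds it by ell / eps, a
    finer one absorbs it into the motion across the strip. *)
Lemma reg_diff_sigma (q : pt) (rho L B eps : R) (z w : pt) :
  0 < eps -> 0 <= L -> 0 <= B -> (forall z, dst z q < rho -> dom Z z) ->
  lip_ball (Xp Z) q rho L -> lip_ball (Xm Z) q rho L ->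
  (forall z, dst z q < rho -> dst (Xp Z z) (0, 0) <= B /\ dst (Xm Z z) (0, 0) <= B) ->
  dst z q < rho -> dst w q < rho ->
  dst (regularization Z Phi eps z) (regularization Z Phi eps w) <=
    L * dst z w + Rabs (lam Phi eps (snd z) - lam Phi eps (snd w)) * (2 * B).
Proof.
  intros He HL HB Hd Hp Hm Hb Hz Hw.
  rewrite !reg_convex by auto.
  pose proof (lam_range T He (snd z)) as hr.
  eapply Rle_trans; [apply convex_diff; exact hr|].
  specialize (Hp z w Hz Hw). specialize (Hm z w Hz Hw).
  destruct (Hb w Hw) as [b1 b2].
  assert (dst (Xp Z w) (Xm Z w) <= 2 * B).
  { pose proof (dst_triangle (Xp Z w) (0, 0) (Xm Z w)). rewrite (dst_sym (0, 0)) in H. lra. }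
  apply Rplus_le_compat.
  - pose proof (dst_nonneg (Xp Z z) (Xp Z w)). pose proof (dst_nonneg (Xm Z z) (Xm Z w)). nra.
  - apply Rmult_le_compat_l; [apply Rabs_pos|auto].
Qed.

(** The radius and the speed bound are chosen before eps and the Lipschitz constant after it: on
    Sigma the latter contains ell / eps. *)
Lemma reg_local (q : pt) : dom Z q ->
  exists rho B, 0 < rho /\ 0 <= B /\ (forall z, dst z q < rho -> dom Z z) /\
    forall eps, 0 < eps < rho ->
      (forall z, dst z q < rho -> dst (regularization Z Phi eps z) (0, 0) <= B) /\
      exists L, 0 <= L /\ lip_ball (regularization Z Phi eps) q rho L.
Proof.
  intros Hq.
  destruct (local_structure q Hq) as [rho [L [B [Hr [HL [HB [Hd Hs]]]]]]].
  exists rho, B. split; [auto|split; [auto|split; [auto|]]]. intros eps He.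
  destruct Hs as [[_ [h1 h2]]|[[_ [h1 h2]]|[_ [h1 [h2 h3]]]]].
  - assert (E : forall z, dst z q < rho -> regularization Z Phi eps z = Xp Z z).
    { intros z Hz. apply reg_up; auto; [lra|]. specialize (h2 z Hz). lra. }
    split.
    + intros z Hz. rewrite E by auto. apply h2; auto.
    + exists L. split; [auto|]. intros z w Hz Hw. rewrite !E by auto. auto.
  - assert (E : forall z, dst z q < rho -> regularization Z Phi eps z = Xm Z z).
    { intros z Hz. apply reg_low; auto; [lra|]. specialize (h2 z Hz). lra. }
    split.
    + intros z Hz. rewrite E by auto. apply h2; auto.
    + exists L. split; [auto|]. intros z w Hz Hw. rewrite !E by auto. auto.
  - split.
    + intros z Hz. rewrite reg_convex by auto.
      apply convex_bounded; [|apply h3; auto|apply h3; auto].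
      apply (lam_range T). lra.
    + exists (L + ell / eps * (2 * B)).
      assert (H0 : 0 <= ell / eps) by (apply Rdiv_le_0_compat; [apply (tr_ell T)|lra]).
      split; [nra|].
      intros z w Hz Hw.
      assert (He0 : 0 < eps) by lra.
      eapply Rle_trans; [apply (reg_diff_sigma q rho L B); auto|].
      pose proof (lam_lip T He0 (snd z) (snd w)) as hl. pose proof (dst_snd z w) as hs.
      assert (Rabs (lam Phi eps (snd z) - lam Phi eps (snd w)) <= ell / eps * dst z w) by nra.
      nra.
Qed.

(* Only the values near the compact set c([a, b]) matter, so the regularized
   fields may be replaced by complete ones, with a speed bound uniform in eps. *)
Lemma complete_extension (c : R -> pt) (a b : R) :
  a <= b -> (forall s, continuous c s) -> (forall s, dom Z (c s)) ->
  exists kap B, 0 < kap /\ 0 <= B /\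
    (forall z s, a <= s <= b -> dst z (c s) < kap -> dom Z z) /\
    forall eps, 0 < eps < kap -> exists L G, 0 < L /\ lip2 L G /\ bounded2 B G /\
      forall z s, a <= s <= b -> dst z (c s) < kap -> G z = regularization Z Phi eps z.
Proof.
  intros Hab Hc Hd.
  set (P := fun t => exists kap B, 0 < kap /\ 0 <= B /\
    (forall z s, a <= s <= t -> dst z (c s) < kap -> dom Z z) /\
    forall eps, 0 < eps < kap -> exists L G, 0 < L /\ lip2 L G /\ bounded2 B G /\
      forall z s, a <= s <= t -> dst z (c s) < kap -> G z = regularization Z Phi eps z).
  assert (Hloc : forall s, exists d, 0 < d /\ exists rho B, 0 < rho /\ 0 <= B /\
    (forall t, Rabs (t - s) < d -> dst (c t) (c s) < rho / 2) /\
    (forall z, dst z (c s) < 2 * rho -> dom Z z) /\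
    forall eps, 0 < eps < 2 * rho ->
      (forall z, dst z (c s) < 2 * rho -> dst (regularization Z Phi eps z) (0, 0) <= B) /\
      exists L, 0 <= L /\ lip_ball (regularization Z Phi eps) (c s) (2 * rho) L).
  { intros s. destruct (reg_local (c s) (Hd s)) as [rho [B [Hr [HB [Hdm He]]]]].
    assert (Hr4 : 0 < rho / 4) by lra.
    destruct (continuous_dst c s _ (Hc s) Hr4) as [d [Hd0 Hd1]].
    exists d. split; [auto|]. exists (rho / 2), B.
    replace (2 * (rho / 2)) with rho by field. replace (rho / 2 / 2) with (rho / 4) by field.
    split; [lra|split; [auto|split; [auto|split; auto]]]. }
  (* One gluing step: the extension built up to parameter [s1] is merged with the regularized field
     in a ball around [c s], which covers the parameters between [s1] and [s2]. The speed bound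
     becomes a maximum of two numbers independent of eps. *)
  assert (Hglue : forall s s1 s2 (d : R), 0 < d -> s - d < s1 <= s -> s <= s2 < s + d ->
    (exists rho B, 0 < rho /\ 0 <= B /\
    (forall t, Rabs (t - s) < d -> dst (c t) (c s) < rho / 2) /\
    (forall z, dst z (c s) < 2 * rho -> dom Z z) /\
    forall eps, 0 < eps < 2 * rho ->
      (forall z, dst z (c s) < 2 * rho -> dst (regularization Z Phi eps z) (0, 0) <= B) /\
      exists L, 0 <= L /\ lip_ball (regularization Z Phi eps) (c s) (2 * rho) L) ->
    P s1 -> P s2).
  { intros s s1 s2 d Hd0 h1 h2 [rho [B [Hr [HB [Hct [Hdm Hreg]]]]]] [kap [B1 [Hk [HB1 [Hdm1 HP]]]]].
    exists (Rmin kap (rho / 2)), (Rmax B1 B).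
    assert (k1 : Rmin kap (rho / 2) <= kap) by le_min.
    assert (k2 : Rmin kap (rho / 2) <= rho / 2) by le_min.
    assert (b1 : B1 <= Rmax B1 B) by apply Rmax_l.
    assert (b2 : B <= Rmax B1 B) by apply Rmax_r.
    assert (Hnear : forall z t, s1 < t <= s2 -> dst z (c t) < Rmin kap (rho / 2) -> dst z (c s) < rho).
    { intros z t Ht Hz. assert (h : Rabs (t - s) < d) by (apply Rabs_def1; lra).
      specialize (Hct t h). pose proof (dst_triangle z (c t) (c s)). lra. }
    split; [apply Rmin_glb_lt; lra|split; [lra|split]].
    - intros z t Ht Hz. destruct (Rle_lt_dec t s1) as [h|h].
      + apply (Hdm1 z t); lra.
      + apply Hdm. assert (dst z (c s) < rho) by (apply (Hnear z t); lra). lra.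
    - intros eps He.
      destruct (HP eps) as [L1 [G1 [HL1 [HG1 [Hb1 Ha1]]]]]; [lra|].
      destruct (Hreg eps) as [Hbd [L [HL Hlip]]]; [lra|].
      set (R0 := regularization Z Phi eps) in *.
      assert (HB12 : 0 <= Rmax B1 B) by lra.
      exists ((/ rho * Rmax B1 B + L1) + (/ rho * Rmax B1 B + L)), (glue (c s) rho G1 R0).
      assert (0 < / rho) by (apply Rinv_0_lt_compat; auto).
      assert (Hb1' : bounded2 (Rmax B1 B) G1) by (intros z; specialize (Hb1 z); lra).
      assert (Hbd' : forall z, dst z (c s) < 2 * rho -> dst (R0 z) (0, 0) <= Rmax B1 B).
      { intros z Hz; specialize (Hbd z Hz); lra. }
      split; [|split; [|split]].
      + assert (0 <= / rho * Rmax B1 B) by (apply Rmult_le_pos; lra). lra.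
      + apply glue_lipschitz; auto; lra.
      + apply glue_bounded; auto.
      + intros z t Ht Hz. apply glue_agrees; [auto|].
        destruct (Rle_lt_dec t s1) as [h|h].
        * left. apply (Ha1 z t); lra.
        * right. apply (Hnear z t); lra. }
  change (P b). apply (interval_induction P a b Hab).
  (* The induction starts from the zero field on the empty parameter interval that ends at
     [a - d / 2]; one gluing step then covers [a]. *)
  - destruct (Hloc a) as [d [Hd0 H]].
    apply (Hglue a (a - d / 2) a d); try lra; auto.
    exists 1, 0. split; [lra|split; [lra|split]].
    + intros z s Hs. lra.
    + intros eps He. exists 1, (fun _ => (0, 0)). split; [lra|split; [|split]].
      * intros z w. rewrite dst_refl, Rmult_1_l. apply dst_nonneg.
      * intros z. rewrite dst_refl. lra.
      * intros z s Hs. lra.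
  - intros s Hs. destruct (Hloc s) as [d [Hd0 H]]. exists d. split; [auto|].
    intros s1 s2 h1 h2 _ _. apply (Hglue s s1 s2 d); auto.
Qed.

End Regularized.

(** * Transit along the regular orbit *)

Definition segment_point (z w : pt) (l : R) : pt :=
  (fst z + l * (fst w - fst z), snd z + l * (snd w - snd z)).

Lemma dst_segment (z w : pt) (l m : R) :
  dst (segment_point z w l) (segment_point z w m) = Rabs (l - m) * dst z w.
Proof.
  unfold dst, segment_point; simpl. rewrite <- sqrt_Rsqr_abs, <- sqrt_mult.
  f_equal. unfold Rsqr. ring. apply Rle_0_sqr. apply (dst_arg_nonneg z w).
Qed.

Lemma segment_in_ball (z w q : pt) (l rho : R) :
  0 <= l <= 1 -> dst z q < rho -> dst w q < rho -> dst (segment_point z w l) q < rho.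
Proof.
  intros Hl Hz Hw.
  pose proof (dst_combination (1 - l) l z w q q) as h.
  rewrite !Rabs_right in h by lra.
  replace (dst (segment_point z w l) q) with
    (dst ((1 - l) * fst z + l * fst w, (1 - l) * snd z + l * snd w)
         ((1 - l) * fst q + l * fst q, (1 - l) * snd q + l * snd q)).
  - destruct (Rle_lt_dec l (1/2)); nra.
  - unfold dst, segment_point; simpl. f_equal. ring.
Qed.

(** A ball is convex: the segment is cut into pieces shorter than [theta] and the bounds are added.
    The constant does not depend on [theta], so the scale may shrink with eps. *)
Lemma local_to_global_lipschitz (f : pt -> pt) (q : pt) (rho theta C : R) :
  0 < theta -> 0 <= C ->
  (forall z w, dst z q < rho -> dst w q < rho -> dst z w <= theta ->
     dst (f z) (f w) <= C * dst z w) ->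
  forall z w, dst z q < rho -> dst w q < rho -> dst (f z) (f w) <= C * dst z w.
Proof.
  intros Ht HC H z w Hz Hw.
  destruct (INR_unbounded (dst z w / theta)) as [n Hn].
  assert (Hn0 : 0 < INR n).
  { pose proof (dst_nonneg z w). assert (0 <= dst z w / theta) by (apply Rdiv_le_0_compat; auto). lra. }
  set (p := fun j => segment_point z w (INR j / INR n)).
  assert (Hp : forall j, (j <= n)%nat -> dst (p j) q < rho).
  { intros j Hj. apply segment_in_ball; auto. apply le_INR in Hj. split.
    - apply Rdiv_le_0_compat; [apply pos_INR|auto].
    - apply Rle_div_l; [auto|lra]. }
  assert (Hstep : forall j, dst (p j) (p (S j)) = / INR n * dst z w).
  { intros j. unfold p. rewrite dst_segment, S_INR.
    replace (INR j / INR n - (INR j + 1) / INR n) with (- / INR n) by (field; lra).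
    rewrite Rabs_Ropp, Rabs_right; [auto|]. left; apply Rinv_0_lt_compat; auto. }
  assert (Hind : forall j, (j <= n)%nat -> dst (f (p 0%nat)) (f (p j)) <= C * (INR j * (/ INR n * dst z w))).
  { induction j as [|j IH]; intros Hj.
    - rewrite dst_refl. simpl. lra.
    - eapply Rle_trans; [apply (dst_triangle _ (f (p j)))|].
      assert (h1 : dst (f (p 0%nat)) (f (p j)) <= C * (INR j * (/ INR n * dst z w))) by (apply IH; lia).
      assert (h2 : dst (f (p j)) (f (p (S j))) <= C * dst (p j) (p (S j))).
      { apply H; try (apply Hp; lia). rewrite Hstep.
        apply Rlt_div_l in Hn; auto.
        apply Rmult_le_reg_l with (INR n); auto. rewrite <- Rmult_assoc, Rinv_r by lra. lra. }
      rewrite Hstep in h2. rewrite S_INR. lra. }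
  specialize (Hind n (le_n n)).
  replace (p 0%nat) with z in Hind.
  replace (p n) with w in Hind.
  - replace (INR n * (/ INR n * dst z w)) with (dst z w) in Hind by (field; lra). exact Hind.
  - unfold p, segment_point. replace (INR n / INR n) with 1 by (field; lra).
    rewrite (surjective_pairing w) at 1. f_equal; ring.
  - unfold p, segment_point. simpl. rewrite (surjective_pairing z) at 1.
    f_equal; field; lra.
Qed.

(* The field may have Lipschitz constant of order 1/eps on |y| < eps, but then
   y' is bounded away from 0; the weight K atan(y/eps) in the exponent absorbs
   the passage at a cost independent of eps. *)
Lemma chart_lipschitz (G : pt -> pt) (phi : R -> pt -> pt) (q : pt)
    (rho M K sig eps L B T : R) :
  0 < eps -> 0 <= M -> 0 <= K -> 0 <= L -> 0 <= B -> Rabs sig = 1 ->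
  lip2 L G -> bounded2 B G -> is_flow G phi ->
  (forall z, dst z q < rho -> 0 <= K * (sig * snd (G z))) ->
  (forall z w, dst z q < rho -> dst w q < rho -> dst z w <= eps ->
     dst (G z) (G w) <=
     (M + K * (sig * snd (G z)) * (eps / (eps ^ 2 + snd z ^ 2))) * dst z w) ->
  0 <= T -> B * T <= rho / 2 ->
  forall z w, dst z q < rho / 2 -> dst w q < rho / 2 ->
    dst (phi T z) (phi T w) <= exp (M * T + K * PI) * dst z w.
Proof.
  intros He HM HK HL HB Hsig HG Hb Hf Hpos HPI HT HBT.
  assert (Hstay : forall z t, dst z q < rho / 2 -> 0 <= t <= T -> dst (phi t z) q < rho).
  { intros z t Hz Ht. pose proof (flow_speed G B phi 0 t z HB Hb Hf) as h.
    destruct (Hf z) as [Hz0 _]. rewrite Hz0, Rminus_0_r, Rabs_right in h by lra.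
    assert (B * t <= B * T) by (apply Rmult_le_compat_l; lra).
    pose proof (dst_triangle (phi t z) z q). lra. }
  (* At this scale the crude constant [L] keeps the two orbits within eps of each other up to time
     [T]. [L] enters the scale only and disappears from the final constant. *)
  apply (local_to_global_lipschitz (phi T) q (rho / 2) (eps * exp (- (L * T)))).
  { apply Rmult_lt_0_compat; [auto|apply exp_pos]. }
  { left; apply exp_pos. }
  intros z w Hz Hw Hzw.
  assert (Hclose : forall t, 0 <= t <= T -> dst (phi t z) (phi t w) <= eps).
  { intros t Ht. eapply Rle_trans; [apply (flow_lipschitz G L phi t z w HL HG Hf)|].
    rewrite Rabs_right by lra.
    apply Rle_trans with (exp (L * T) * (eps * exp (- (L * T)))).
    - apply Rmult_le_compat; auto. left; apply exp_pos. apply dst_nonneg.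
      apply exp_le. apply Rmult_le_compat_l; lra.
    - replace (exp (L * T) * (eps * exp (- (L * T)))) with
        (eps * (exp (L * T) * exp (- (L * T)))) by ring.
      rewrite <- exp_plus. replace (L * T + - (L * T)) with 0 by ring. rewrite exp_0. lra. }
  set (yz := fun t => snd (phi t z)).
  (* The derivative of atan(y / eps) is y' eps / (eps^2 + y^2), the rate allowed by the hypothesis;
     its total variation is at most PI for every eps. *)
  set (A := fun t => M * t + K * sig * atan (yz t / eps)).
  set (dA := fun t => M + K * (sig * snd (G (phi t z))) * (eps / (eps ^ 2 + yz t ^ 2))).
  destruct (Hf z) as [z0 Vz]. destruct (Hf w) as [w0 Vw].
  assert (Hden : forall t, 0 < eps ^ 2 + yz t ^ 2).
  { intros t. pose proof (pow2_ge_0 (yz t)). assert (0 < eps ^ 2) by (apply pow_lt; auto). lra. }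
  pose proof (gronwall_plane (fun t => phi t z) (fun t => phi t w) (fun t => G (phi t z))
    (fun t => G (phi t w)) A dA (fun _ => 0) (fun _ => 0) 0 T HT) as g.
  cbv beta in g. rewrite Rminus_diag, Rplus_0_r, z0, w0 in g.
  eapply Rle_trans; [apply g|].
  - intros; apply Vz.
  - intros; apply Vw.
  - intros t Ht. split.
    + unfold A, dA. apply (is_derive_plus (V := R_NormedModule)).
      * auto_derive; auto. ring.
      * destruct (Vz t) as [_ V2]. fold yz in V2.
        evar_last.
        apply (is_derive_scal (fun t => atan (yz t / eps)) t (K * sig)).
        apply (is_derive_comp atan (fun t => yz t / eps)). apply is_derive_atan.
        apply (is_derive_ext (fun t => / eps * yz t)). intros; unfold Rdiv; apply Rmult_comm.
        apply (is_derive_scal yz t (/ eps)). exact V2.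
        unfold scal; simpl; unfold mult; simpl. unfold Rsqr.
        specialize (Hden t). field. split; [|lra].
        replace (eps ^ 2 + yz t * yz t) with (eps ^ 2 + yz t ^ 2) by ring. lra.
    + unfold dA. pose proof (Hpos (phi t z) (Hstay z t Hz Ht)).
      assert (0 <= eps / (eps ^ 2 + yz t ^ 2)) by (apply Rdiv_le_0_compat; [lra|auto]). nra.
  - intros t _. split; [|lra]. apply (is_derive_const (V := R_NormedModule)).
  - intros t Ht. rewrite Rplus_0_r. unfold dA, yz. apply HPI; auto.
  - apply Rmult_le_compat_r; [apply dst_nonneg|]. apply exp_le. unfold A.
    pose proof (atan_bound (yz T / eps)) as a1. pose proof (atan_bound (yz 0 / eps)) as a2.
    set (d := atan (yz T / eps)) in *. set (e := atan (yz 0 / eps)) in *.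
    assert (h : K * sig * d - K * sig * e <= K * PI); [|lra].
    replace (K * sig * d - K * sig * e) with (K * (sig * (d - e))) by ring.
    apply Rmult_le_compat_l; auto.
    eapply Rle_trans; [apply Rle_abs|]. rewrite Rabs_mult, Hsig, Rmult_1_l.
    apply Rabs_le. lra.
Qed.

Lemma derive_ge_increase_open (f df : R -> R) (a b c : R) :
  a <= b ->
  (forall x, a <= x <= b -> continuity_pt f x) ->
  (forall x, a < x < b -> is_derive f x (df x)) ->
  (forall x, a < x < b -> c <= df x) -> f a + c * (b - a) <= f b.
Proof.
  intros Hab Hc Hd Hdf.
  destruct (Rle_lt_or_eq_dec _ _ Hab) as [Hlt| ->]; [|lra].
  assert (E : exists x, a < x < b /\ f b - f a = df x * (b - a)).
  { assert (pr : forall x, a < x < b -> derivable_pt f x).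
    { intros x Hx. exists (df x). apply is_derive_Reals. auto. }
    destruct (MVT f (fun x => x) a b pr (fun x _ => derivable_pt_id x) Hlt Hc) as [x [Hx E]].
    - intros; apply derivable_continuous_pt, derivable_pt_id.
    - exists x. split; [exact Hx|].
      rewrite derive_pt_id, Rmult_1_r in E.
      rewrite <- (proj2 (derive_pt_eq f x (df x) (pr x Hx))).
      + lra.
      + apply is_derive_Reals. auto. }
  destruct E as [x [Hx E]]. specialize (Hdf x Hx). nra.
Qed.

Lemma continuous_snd_pt (g : R -> pt) (t : R) :
  continuous g t -> continuity_pt (fun s => snd (g s)) t.
Proof.
  intros H. apply continuity_pt_filterlim.
  apply (continuous_comp g snd). exact H. apply continuous_snd.
Qed.

(** Velocities are prescribed in the open interval only, as on an orbit arc that starts or ends on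
    Sigma. The closed estimate on a slightly smaller interval is combined with continuity at the two
    ends. *)
Lemma speed_bound_open (g v : R -> pt) (B t0 t1 : R) :
  0 <= B -> t0 <= t1 ->
  (forall t, t0 <= t <= t1 -> continuous g t) ->
  (forall t, t0 < t < t1 -> velocity g t (v t) /\ dst (v t) (0, 0) <= B) ->
  dst (g t1) (g t0) <= B * (t1 - t0).
Proof.
  intros HB Ht Hc Hv.
  destruct (Rle_lt_or_eq_dec _ _ Ht) as [Hlt| ->].
  2: { rewrite dst_refl, Rminus_diag. lra. }
  apply Rnot_lt_le. intros Hn.
  set (gap := dst (g t1) (g t0) - B * (t1 - t0)) in *.
  assert (Hgap : 0 < gap / 4) by (unfold gap; lra).
  destruct (continuous_dst g t0 _ (Hc t0 (conj (Rle_refl _) Ht)) Hgap) as [d0 [D0 C0]].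
  destruct (continuous_dst g t1 _ (Hc t1 (conj Ht (Rle_refl _))) Hgap) as [d1 [D1 C1]].
  set (e := Rmin (Rmin (d0 / 2) (d1 / 2)) ((t1 - t0) / 4)).
  assert (e1 : e <= d0 / 2) by le_min.
  assert (e2 : e <= d1 / 2) by le_min.
  assert (e3 : e <= (t1 - t0) / 4) by le_min.
  assert (e0 : 0 < e) by (unfold e; repeat apply Rmin_glb_lt; lra).
  assert (h : dst (g (t1 - e)) (g (t0 + e)) <= B * (t1 - e - (t0 + e))).
  { apply (speed_bound g v); auto; try lra; intros; apply Hv; lra. }
  assert (dst (g (t0 + e)) (g t0) < gap / 4).
  { apply C0. rewrite Rabs_right; lra. }
  assert (dst (g (t1 - e)) (g t1) < gap / 4).
  { apply C1. rewrite Rabs_left; lra. }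
  pose proof (dst_triangle (g t1) (g (t1 - e)) (g t0)).
  pose proof (dst_triangle (g (t1 - e)) (g (t0 + e)) (g t0)).
  rewrite (dst_sym (g t1) (g (t1 - e))) in *.
  assert (B * (t1 - e - (t0 + e)) <= B * (t1 - t0)) by (apply Rmult_le_compat_l; lra).
  unfold gap in *. lra.
Qed.

(* sig is the direction in which Sigma is crossed: the orbit g follows Xb
   before time t0 and Xa after. *)
Record crossing (Xa Xb : pt -> pt) (g : R -> pt) (q : pt)
    (t0 d rho c L B sig : R) : Prop := Crossing {
  cr_d : 0 < d;
  cr_c : 0 < c;
  cr_L : 0 <= L;
  cr_B : 0 <= B;
  cr_sig : Rabs sig = 1;
  cr_t0 : g t0 = q;
  cr_q : snd q = 0;
  cr_cont : forall t, Rabs (t - t0) < d -> continuous g t /\ dst (g t) q < rho / 2;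
  cr_iso : forall t, Rabs (t - t0) < d -> t <> t0 -> snd (g t) <> 0;
  cr_a : forall t, Rabs (t - t0) < d -> 0 < sig * snd (g t) -> velocity g t (Xa (g t));
  cr_b : forall t, Rabs (t - t0) < d -> sig * snd (g t) < 0 -> velocity g t (Xb (g t));
  cr_ball : forall z, dst z q < rho ->
    c <= sig * snd (Xa z) /\ c <= sig * snd (Xb z) /\
    dst (Xa z) (0, 0) <= B /\ dst (Xb z) (0, 0) <= B;
  cr_lip : lip_ball Xa q rho L
}.

Arguments cr_d {Xa Xb g q t0 d rho c L B sig}.
Arguments cr_c {Xa Xb g q t0 d rho c L B sig}.
Arguments cr_L {Xa Xb g q t0 d rho c L B sig}.
Arguments cr_B {Xa Xb g q t0 d rho c L B sig}.
Arguments cr_sig {Xa Xb g q t0 d rho c L B sig}.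
Arguments cr_t0 {Xa Xb g q t0 d rho c L B sig}.
Arguments cr_q {Xa Xb g q t0 d rho c L B sig}.
Arguments cr_cont {Xa Xb g q t0 d rho c L B sig}.
Arguments cr_iso {Xa Xb g q t0 d rho c L B sig}.
Arguments cr_a {Xa Xb g q t0 d rho c L B sig}.
Arguments cr_b {Xa Xb g q t0 d rho c L B sig}.
Arguments cr_ball {Xa Xb g q t0 d rho c L B sig}.
Arguments cr_lip {Xa Xb g q t0 d rho c L B sig}.

Section Crossing.
Context {Xa Xb : pt -> pt} {g : R -> pt} {q : pt} {t0 d rho c L B sig : R}.
Context (C : crossing Xa Xb g q t0 d rho c L B sig).

Let Y (t : R) : R := sig * snd (g t).

Lemma crossing_Y_continuity (t : R) : Rabs (t - t0) < d -> continuity_pt Y t.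
Proof.
  intros Ht. apply continuity_pt_scal with (f := fun s => snd (g s)).
  apply continuous_snd_pt. apply (cr_cont C); auto.
Qed.

Lemma crossing_Y_t0 : Y t0 = 0.
Proof.
  unfold Y. rewrite (cr_t0 C), (cr_q C). ring.
Qed.

Lemma crossing_Y_nonzero (t : R) : Rabs (t - t0) < d -> t <> t0 -> Y t <> 0.
Proof.
  intros Ht Hne E. unfold Y in E. apply Rmult_integral in E. destruct E as [E|E].
  - pose proof (cr_sig C) as h. rewrite E, Rabs_R0 in h. lra.
  - revert E. apply (cr_iso C); auto.
Qed.

Lemma crossing_velocity_Y (t : R) (X : pt -> pt) :
  velocity g t (X (g t)) -> is_derive Y t (sig * snd (X (g t))).
Proof. intros [_ h]. unfold Y. apply (is_derive_scal (fun s => snd (g s))). exact h. Qed.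

(** After [t0] the signed height Y has no zero, hence a constant sign. If it were negative, the
    orbit would follow [Xb] and Y would increase from Y(t0) = 0, a contradiction. So it is positive,
    the orbit follows [Xa], and Y grows at rate c. *)
Lemma crossing_after (t : R) : t0 < t < t0 + d -> c * (t - t0) <= Y t.
Proof.
  intros Ht.
  assert (Hin : forall s, t0 <= s <= t -> Rabs (s - t0) < d).
  { intros s Hs. rewrite Rabs_right; lra. }
  assert (Hpos : forall s, t0 < s <= t -> 0 < Y s).
  { intros s Hs. apply Rnot_le_lt. intros Hle.
    assert (Hneg : forall v, t0 < v <= s -> Y v < 0).
    { intros v Hv. apply Rnot_le_lt. intros Hle'.
      destruct (intermediate_value (fun x => - Y x) v s 0) as [x [Hx Ex]].
      - lra.
      - intros x Hx. apply continuity_pt_opp, crossing_Y_continuity, Hin. lra.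
      - lra.
      - apply (crossing_Y_nonzero x); [apply Hin; lra|lra|lra]. }
    pose proof (derive_ge_increase_open Y (fun v => sig * snd (Xb (g v))) t0 s c) as h.
    assert (Y t0 + c * (s - t0) <= Y s).
    { apply h; [lra| | |].
      - intros x Hx. apply crossing_Y_continuity, Hin. lra.
      - intros x Hx. apply crossing_velocity_Y.
        apply (cr_b C); [apply Hin; lra|apply Hneg; lra].
      - intros x Hx. apply (cr_ball C).
        pose proof (cr_cont C x) as [_ h']; [apply Hin; lra|].
        pose proof (dst_nonneg (g x) q). lra. }
    rewrite crossing_Y_t0 in H. pose proof (cr_c C).
    assert (0 < c * (s - t0)) by (apply Rmult_lt_0_compat; lra). lra. }
  pose proof (derive_ge_increase_open Y (fun v => sig * snd (Xa (g v))) t0 t c) as h.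
  rewrite crossing_Y_t0, Rplus_0_l in h. apply h; [lra| | |].
  - intros x Hx. apply crossing_Y_continuity, Hin. lra.
  - intros x Hx. apply crossing_velocity_Y.
    apply (cr_a C); [apply Hin; lra|apply Hpos; lra].
  - intros x Hx. apply (cr_ball C).
    pose proof (cr_cont C x) as [_ h']; [apply Hin; lra|].
    pose proof (dst_nonneg (g x) q). lra.
Qed.

Lemma crossing_before (t : R) : t0 - d < t < t0 -> Y t <= - (c * (t0 - t)).
Proof.
  intros Ht.
  assert (Hin : forall s, t <= s <= t0 -> Rabs (s - t0) < d).
  { intros s Hs. rewrite Rabs_left1; lra. }
  assert (Hpos : forall s, t <= s < t0 -> Y s < 0).
  { intros s Hs. apply Rnot_le_lt. intros Hle.
    assert (Hneg : forall v, s <= v < t0 -> 0 < Y v).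
    { intros v Hv. apply Rnot_le_lt. intros Hle'.
      destruct (intermediate_value (fun x => - Y x) s v 0) as [x [Hx Ex]].
      - lra.
      - intros x Hx. apply continuity_pt_opp, crossing_Y_continuity, Hin. lra.
      - lra.
      - apply (crossing_Y_nonzero x); [apply Hin; lra|lra|lra]. }
    pose proof (derive_ge_increase_open Y (fun v => sig * snd (Xa (g v))) s t0 c) as h.
    assert (Y s + c * (t0 - s) <= Y t0).
    { apply h; [lra| | |].
      - intros x Hx. apply crossing_Y_continuity, Hin. lra.
      - intros x Hx. apply crossing_velocity_Y.
        apply (cr_a C); [apply Hin; lra|apply Hneg; lra].
      - intros x Hx. apply (cr_ball C).
        pose proof (cr_cont C x) as [_ h']; [apply Hin; lra|].
        pose proof (dst_nonneg (g x) q). lra. }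
    rewrite crossing_Y_t0 in H. pose proof (cr_c C).
    assert (0 < c * (t0 - s)) by (apply Rmult_lt_0_compat; lra). lra. }
  pose proof (derive_ge_increase_open Y (fun v => sig * snd (Xb (g v))) t t0 c) as h.
  rewrite crossing_Y_t0 in h.
  assert (Y t + c * (t0 - t) <= 0); [|lra]. apply h; [lra| | |].
  - intros x Hx. apply crossing_Y_continuity, Hin. lra.
  - intros x Hx. apply crossing_velocity_Y.
    apply (cr_b C); [apply Hin; lra|apply Hpos; lra].
  - intros x Hx. apply (cr_ball C).
    pose proof (cr_cont C x) as [_ h']; [apply Hin; lra|].
    pose proof (dst_nonneg (g x) q). lra.
Qed.

Lemma crossing_speed (s t : R) : t0 - d < s -> s <= t -> t < t0 + d ->
  dst (g t) (g s) <= B * (t - s).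
Proof.
  intros hs hst ht.
  pose proof (cr_B C) as HB.
  pose proof (cr_c C) as Hc.
  assert (Hin : forall x, s <= x <= t -> Rabs (x - t0) < d).
  { intros x Hx. apply Rabs_def1; lra. }
  assert (Hball : forall x, s <= x <= t -> dst (g x) q < rho).
  { intros x Hx. pose proof (cr_cont C x (Hin x Hx)) as [_ h'].
    pose proof (dst_nonneg (g x) q). lra. }
  assert (right : forall u, t0 <= u <= t -> s <= u -> dst (g t) (g u) <= B * (t - u)).
  { intros u Hu Hsu. apply (speed_bound_open g (fun x => Xa (g x))); auto; [lra| |].
    - intros x Hx. apply (cr_cont C), Hin. lra.
    - intros x Hx. split.
      + apply (cr_a C); [apply Hin; lra|].
        pose proof (crossing_after x). unfold Y in H.
        assert (0 < c * (x - t0)) by (apply Rmult_lt_0_compat; lra).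
        assert (c * (x - t0) <= sig * snd (g x)) by (apply H; lra). lra.
      + apply (cr_ball C), Hball. lra. }
  assert (left : forall u, s <= u <= t0 -> u <= t -> dst (g u) (g s) <= B * (u - s)).
  { intros u Hu Hut. apply (speed_bound_open g (fun x => Xb (g x))); auto; [lra| |].
    - intros x Hx. apply (cr_cont C), Hin. lra.
    - intros x Hx. split.
      + apply (cr_b C); [apply Hin; lra|].
        pose proof (crossing_before x). unfold Y in H.
        assert (0 < c * (t0 - x)) by (apply Rmult_lt_0_compat; lra).
        assert (sig * snd (g x) <= - (c * (t0 - x))) by (apply H; lra). lra.
      + apply (cr_ball C), Hball. lra. }
  destruct (Rle_lt_dec t0 s) as [h|h]; [apply right; lra|].
  destruct (Rle_lt_dec t t0) as [h'|h']; [apply left; lra|].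
  pose proof (dst_triangle (g t) (g t0) (g s)).
  assert (dst (g t) (g t0) <= B * (t - t0)) by (apply right; lra).
  assert (dst (g t0) (g s) <= B * (t0 - s)) by (apply left; lra). lra.
Qed.

(* The regularized orbit coincides with g until the strip |y| < eps, loses
   O(eps) in it, and then both follow Xa. *)
Lemma crossing_reference (G : pt -> pt) (phi : R -> pt -> pt) (L' eps t1 t2 : R) :
  0 < eps -> 0 <= L' -> lip2 L' G -> bounded2 B G -> is_flow G phi ->
  (forall z, dst z q < rho -> eps <= sig * snd z -> G z = Xa z) ->
  (forall z, dst z q < rho -> sig * snd z <= - eps -> G z = Xb z) ->
  (forall z, dst z q < rho -> c <= sig * snd (G z)) ->
  t0 - d < t1 <= t0 -> t1 <= t2 -> t2 < t0 + d -> B * (t2 - t1) <= rho / 2 ->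
  dst (phi (t2 - t1) (g t1)) (g t2) <=
    exp (L * (2 * d)) * (2 * B * ((1 + B / c) / c + / c)) * eps.
Proof.
  intros He HL' HG Hb Hf Ha Hb' Hc' Ht1 Ht12 Ht2 HBT.
  pose proof (cr_B C) as HB.
  pose proof (cr_c C) as Hc.
  pose proof (cr_L C) as HL.
  pose proof (cr_d C) as Hd.
  assert (Hic : 0 < / c) by (apply Rinv_0_lt_compat; auto).
  assert (HBc : 0 <= B / c) by (apply Rdiv_le_0_compat; auto).
  (* At time [s1], introduced below, the depth is at most B eps / c. Rising at rate c, the
     regularized orbit is above the strip after a further time K eps, since c K eps = eps + B eps /
     c. *)
  set (K := (1 + B / c) / c).
  assert (HK : 0 < K) by (apply Rdiv_lt_0_compat; lra).
  set (x := fun t => phi (t - t1) (g t1)).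
  assert (Hx1 : x t1 = g t1) by (unfold x; rewrite Rminus_diag; apply Hf).
  assert (Vx : forall t, velocity x t (G (x t))).
  { intros t. unfold x.
    apply (velocity_ext (fun s => phi (- t1 + s) (g t1)) _ t _ 1); [lra| |].
    - intros s _. f_equal. ring.
    - replace (t - t1) with (- t1 + t) by ring.
      apply (velocity_shift (fun s => phi s (g t1))). apply Hf. }
  assert (Hxspeed : forall s t, s <= t -> dst (x t) (x s) <= B * (t - s)).
  { intros s t Hst. apply (speed_bound x (fun t => G (x t))); auto. }
  assert (Hin : forall t, t1 <= t <= t2 -> Rabs (t - t0) < d).
  { intros t Ht. apply Rabs_def1; lra. }
  assert (Hg1 : dst (g t1) q < rho / 2).
  { apply (cr_cont C), Hin. lra. }
  assert (Hgball : forall t, t1 <= t <= t2 -> dst (g t) q < rho).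
  { intros t Ht. pose proof (cr_cont C t (Hin t Ht)) as [_ h'].
    pose proof (dst_nonneg (g t) q). lra. }
  assert (Hxball : forall t, t1 <= t <= t2 -> dst (x t) q < rho).
  { intros t Ht. specialize (Hxspeed t1 t (proj1 Ht)). rewrite Hx1 in Hxspeed.
    assert (B * (t - t1) <= B * (t2 - t1)) by (apply Rmult_le_compat_l; lra).
    pose proof (dst_triangle (x t) (g t1) q). lra. }
  assert (HE : 1 <= exp (L * (2 * d))) by (apply exp_nonneg_ge1; nra).
  set (E := exp (L * (2 * d))) in *.
  (* The two curves agree on entering the strip and then separate with relative speed at most 2 B,
     for a time at most (K + 1/c) eps. *)
  set (W := 2 * B * (K + / c) * eps).
  assert (HW : 0 <= W).
  { unfold W. repeat apply Rmult_le_pos; lra. }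
  replace (E * (2 * B * (K + / c)) * eps) with (E * W) by (unfold W; ring).
  change (phi (t2 - t1) (g t1)) with (x t2).
  (* Until t0 - eps / c the orbit [g] is at depth at least eps, so both curves follow [Xb]. The
     maximum covers a start inside the strip, where they agree by the choice of the initial
     point. *)
  set (s1 := Rmax t1 (t0 - eps * / c)).
  assert (Hs1 : t1 <= s1) by apply Rmax_l.
  assert (Hs1' : t0 - eps * / c <= s1) by apply Rmax_r.
  assert (Hec : 0 < eps * / c) by (apply Rmult_lt_0_compat; auto).
  assert (Hs10 : s1 <= t0) by (apply Rmax_lub; lra).
  assert (Heq : forall t, t1 <= t <= t2 -> t <= s1 -> x t = g t).
  { intros t Ht Hts. destruct (Rle_lt_or_eq_dec t1 t (proj1 Ht)) as [Hlt| <-]; [|exact Hx1].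
    assert (Hs1e : s1 = t0 - eps * / c).
    { unfold s1 in *. revert Hts. unfold Rmax. destruct Rle_dec; [auto|lra]. }
    apply (ode_unique_forward G x g t1 t (proj1 Ht)).
    - intros s _. apply Vx.
    - intros s Hs.
      assert (h : sig * snd (g s) <= - eps).
      { pose proof (crossing_before s) as h. unfold Y in h.
        assert (sig * snd (g s) <= - (c * (t0 - s))) by (apply h; lra).
        assert (c * (eps * / c) <= c * (t0 - s)) by (apply Rmult_le_compat_l; lra).
        replace (c * (eps * / c)) with eps in H0 by (field; lra). lra. }
      rewrite Hb' by (auto; apply Hgball; lra).
      apply (cr_b C); [apply Hin; lra|lra].
    - intros s _. apply (lip2_loc_lip G L'); auto.
    - exact Hx1. }
  destruct (Rle_lt_dec t2 s1) as [h2|h2].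
  { rewrite Heq by lra. rewrite dst_refl. nra. }
  assert (Exs : x s1 = g s1) by (apply Heq; lra).
  assert (Hmid : forall t, s1 <= t <= t2 -> t <= t0 + K * eps -> dst (x t) (g t) <= W).
  { intros t Ht HtK.
    pose proof (Hxspeed s1 t (proj1 Ht)) as a1.
    assert (a2 : dst (g t) (g s1) <= B * (t - s1)) by (apply crossing_speed; lra).
    pose proof (dst_triangle (x t) (x s1) (g t)) as a3. rewrite Exs in a1, a3.
    rewrite (dst_sym (g s1) (g t)) in a3.
    assert (B * (t - s1) <= B * ((K + / c) * eps)).
    { apply Rmult_le_compat_l; lra. }
    unfold W. lra. }
  destruct (Rle_lt_dec t2 (t0 + K * eps)) as [h3|h3].
  { specialize (Hmid t2). assert (dst (x t2) (g t2) <= W) by (apply Hmid; lra). nra. }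
  set (s2 := t0 + K * eps) in *.
  assert (HKe : 0 < K * eps) by (apply Rmult_lt_0_compat; auto).
  assert (Hs2 : dst (x s2) (g s2) <= W) by (apply Hmid; unfold s2 in *; lra).
  assert (Hafter_x : forall t, s2 <= t <= t2 -> eps <= sig * snd (x t)).
  { intros t Ht.
    assert (HY : sig * snd (x s1) + c * (t - s1) <= sig * snd (x t)).
    { apply (derive_ge_increase (fun t => sig * snd (x t)) (fun t => sig * snd (G (x t)))).
      - unfold s2 in *; lra.
      - intros s _. apply (is_derive_scal (fun s => snd (x s))). apply Vx.
      - intros s Hs. apply Hc', Hxball. unfold s2 in *; lra. }
    assert (Hstart : - (B * (eps * / c)) <= sig * snd (x s1)).
    { rewrite Exs.
      assert (a1 : dst (g t0) (g s1) <= B * (t0 - s1)) by (apply crossing_speed; unfold s2 in *; lra).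
      pose proof (dst_snd (g t0) (g s1)) as a2.
      rewrite (cr_t0 C), (cr_q C) in a2.
      rewrite (cr_t0 C) in a1.
      rewrite Rminus_0_l, Rabs_Ropp in a2.
      assert (a3 : Rabs (sig * snd (g s1)) = Rabs (snd (g s1))).
      { rewrite Rabs_mult, (cr_sig C). ring. }
      assert (B * (t0 - s1) <= B * (eps * / c)) by (apply Rmult_le_compat_l; lra).
      pose proof (Rabs_le_between (sig * snd (g s1)) (B * (eps * / c))) as [a4 _].
      apply a4. lra. }
    assert (c * (K * eps) <= c * (t - s1)) by (apply Rmult_le_compat_l; unfold s2 in *; lra).
    replace (c * (K * eps)) with (eps + B * (eps * / c)) in H by (unfold K; field; lra).
    lra. }
  assert (Hafter_g : forall t, s2 <= t <= t2 -> 0 < sig * snd (g t)).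
  { intros t Ht. pose proof (crossing_after t) as h. unfold Y in h.
    assert (c * (t - t0) <= sig * snd (g t)) by (apply h; unfold s2 in *; lra).
    assert (0 < c * (t - t0)) by (apply Rmult_lt_0_compat; unfold s2 in *; lra). lra. }
  pose proof (gronwall_lipschitz Xa L x g s2 t2 HL) as gr.
  eapply Rle_trans; [apply gr|].
  - lra.
  - intros t Ht. rewrite <- Ha. apply Vx. apply Hxball; unfold s2 in *; lra. auto.
  - intros t Ht. apply (cr_a C); [apply Hin; unfold s2 in *; lra|auto].
  - intros t Ht. apply (cr_lip C); [apply Hxball|apply Hgball]; unfold s2 in *; lra.
  - apply Rmult_le_compat; auto. left; apply exp_pos. apply dst_nonneg.
    apply exp_le. apply Rmult_le_compat_l; unfold s2 in *; lra.
Qed.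

End Crossing.

(** * Transit along arcs, uniformly in eps *)

(** [kap0] and the speed bound [B] are common to all small eps; the Lipschitz constant in [cp_lip]
    may depend on eps. *)
Record completed (Z : filippov) (Phi : R -> R) (Gamma : set2) (kap0 B : R)
    (G : R -> pt -> pt) (phi : R -> R -> pt -> pt) : Prop := Completed {
  cp_kap : 0 < kap0;
  cp_B : 0 <= B;
  cp_dom : forall z q, Gamma q -> dst z q < kap0 -> dom Z z;
  cp_lip : forall eps, 0 < eps < kap0 -> exists L, 0 < L /\ lip2 L (G eps);
  cp_bdd : forall eps, 0 < eps < kap0 -> bounded2 B (G eps);
  cp_agree : forall eps, 0 < eps < kap0 -> forall z q, Gamma q -> dst z q < kap0 ->
    G eps z = regularization Z Phi eps z;
  cp_flow : forall eps, 0 < eps < kap0 -> is_flow (G eps) (phi eps)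
}.

Arguments cp_kap {Z Phi Gamma kap0 B G phi}.
Arguments cp_B {Z Phi Gamma kap0 B G phi}.
Arguments cp_dom {Z Phi Gamma kap0 B G phi}.
Arguments cp_lip {Z Phi Gamma kap0 B G phi}.
Arguments cp_bdd {Z Phi Gamma kap0 B G phi}.
Arguments cp_agree {Z Phi Gamma kap0 B G phi}.
Arguments cp_flow {Z Phi Gamma kap0 B G phi}.

(** The form is chosen to compose along an arc: the Lipschitz constant C is fixed before the
    closeness [kap] and is uniform in eps, while the radius [r] may depend on [kap]. *)
Definition transit (kap0 : R) (phi : R -> R -> pt -> pt) (g : R -> pt) (t1 t2 : R) : Prop :=
  exists C, 1 <= C /\ forall kap, 0 < kap -> exists r, 0 < r <= kap0 /\
    forall eps, 0 < eps < r ->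
      (forall z, dst z (g t1) <= r -> forall s, 0 <= s <= t2 - t1 ->
         dst (phi eps s z) (g (t1 + s)) <= kap) /\
      (forall z w, dst z (g t1) <= r -> dst w (g t1) <= r ->
         dst (phi eps (t2 - t1) z) (phi eps (t2 - t1) w) <= C * dst z w).

Lemma Rbar_interval_open (a b : Rbar) (t : R) :
  Rbar_lt a t -> Rbar_lt t b ->
  exists d, 0 < d /\ forall s, Rabs (s - t) < d -> Rbar_lt a s /\ Rbar_lt s b.
Proof.
  intros Ha Hb.
  assert (h1 : exists d, 0 < d /\ forall s : R, Rabs (s - t) < d -> Rbar_lt a s).
  { destruct a as [a| |]; simpl in *; try tauto.
    - exists (t - a). split; [lra|]. intros s Hs. apply Rabs_def2 in Hs. lra.
    - exists 1. split; [lra|auto]. }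
  assert (h2 : exists d, 0 < d /\ forall s : R, Rabs (s - t) < d -> Rbar_lt s b).
  { destruct b as [b| |]; simpl in *; try tauto.
    - exists (b - t). split; [lra|]. intros s Hs. apply Rabs_def2 in Hs. lra.
    - exists 1. split; [lra|auto]. }
  destruct h1 as [d1 [D1 H1]]. destruct h2 as [d2 [D2 H2]].
  exists (Rmin d1 d2). split; [apply Rmin_glb_lt; auto|].
  intros s Hs. split; [apply H1|apply H2]; eapply Rlt_le_trans; eauto; [apply Rmin_l|apply Rmin_r].
Qed.

Section Transit.
Context {Z : filippov} (TZ : tame Z) {ell : R} {Phi : R -> R} (T : transition ell Phi).
Context {Gamma : set2} {kap0 B : R} {G : R -> pt -> pt} {phi : R -> R -> pt -> pt}.
Context (HC : completed Z Phi Gamma kap0 B G phi).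

Lemma transit_refl (g : R -> pt) (t : R) : transit kap0 phi g t t.
Proof.
  pose proof (cp_kap HC).
  exists 1. split; [lra|]. intros kap Hk. exists (Rmin kap kap0).
  split; [split; [apply Rmin_glb_lt; auto|apply Rmin_r]|].
  intros eps He. assert (Rmin kap kap0 <= kap0) by le_min.
  assert (Hf : is_flow (G eps) (phi eps)) by (apply (cp_flow HC); lra).
  split.
  - intros z Hz s Hs. replace s with 0 by lra. rewrite (proj1 (Hf z)), Rplus_0_r.
    eapply Rle_trans; [exact Hz|apply Rmin_l].
  - intros z w _ _. rewrite Rminus_diag, (proj1 (Hf z)), (proj1 (Hf w)). lra.
Qed.

Lemma transit_trans (g : R -> pt) (t1 t2 t3 : R) :
  t1 <= t2 -> t2 <= t3 ->
  transit kap0 phi g t1 t2 -> transit kap0 phi g t2 t3 -> transit kap0 phi g t1 t3.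
Proof.
  intros h12 h23 [C1 [HC1 H1]] [C2 [HC2 H2]].
  exists (C1 * C2). split; [nra|]. intros kap Hk.
  destruct (H2 kap Hk) as [r2 [Hr2 K2]].
  destruct (H1 (Rmin kap r2)) as [r1 [Hr1 K1]]; [apply Rmin_glb_lt; lra|].
  exists (Rmin r1 r2). split.
  { split; [apply Rmin_glb_lt; lra|]. eapply Rle_trans; [apply Rmin_l|lra]. }
  assert (m1 : Rmin r1 r2 <= r1) by le_min.
  assert (m2 : Rmin r1 r2 <= r2) by le_min.
  assert (m3 : Rmin kap r2 <= kap) by le_min.
  assert (m4 : Rmin kap r2 <= r2) by le_min.
  intros eps He.
  destruct (K1 eps) as [A1 B1]; [lra|]. destruct (K2 eps) as [A2 B2]; [lra|].
  assert (He' : 0 < eps < kap0) by lra.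
  destruct (cp_lip HC eps He') as [L [HL HG]].
  assert (Hpl : forall s z, phi eps (t2 - t1 + s) z = phi eps s (phi eps (t2 - t1) z)).
  { intros s z. apply (flow_plus (G eps) L); auto; [lra|]. apply (cp_flow HC); auto. }
  assert (Hmid : forall z, dst z (g t1) <= Rmin r1 r2 -> dst (phi eps (t2 - t1) z) (g t2) <= r2).
  { intros z Hz. replace t2 with (t1 + (t2 - t1)) at 2 by ring.
    eapply Rle_trans; [apply A1; lra|]. lra. }
  split.
  - intros z Hz s Hs. destruct (Rle_lt_dec s (t2 - t1)) as [h|h].
    + eapply Rle_trans; [apply A1; lra|]. lra.
    + replace s with (t2 - t1 + (s - (t2 - t1))) at 1 by ring.
      rewrite Hpl. replace (t1 + s) with (t2 + (s - (t2 - t1))) by ring.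
      apply A2; [auto|lra].
  - intros z w Hz Hw. replace (t3 - t1) with (t2 - t1 + (t3 - t2)) by ring.
    rewrite !Hpl. eapply Rle_trans; [apply B2; auto|].
    assert (dst (phi eps (t2 - t1) z) (phi eps (t2 - t1) w) <= C1 * dst z w) by (apply B1; lra).
    assert (C2 * dst (phi eps (t2 - t1) z) (phi eps (t2 - t1) w) <= C2 * (C1 * dst z w)).
    { apply Rmult_le_compat_l; lra. } lra.
Qed.

(** The distance to [g] is at most C r for the shift of the initial point plus C' eps for the error
    of the reference orbit; both are made small by the same [r]. *)
Lemma transit_of_chart (g : R -> pt) (q : pt) (t1 t2 rho C C' e0 : R) :
  t1 <= t2 -> 0 < rho -> 0 < e0 -> 1 <= C -> 0 <= C' -> dst (g t1) q < rho / 4 ->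
  (forall eps, 0 < eps < e0 -> eps < kap0 -> forall s, 0 <= s <= t2 - t1 ->
     dst (phi eps s (g t1)) (g (t1 + s)) <= C' * eps /\
     forall z w, dst z q < rho / 2 -> dst w q < rho / 2 ->
       dst (phi eps s z) (phi eps s w) <= C * dst z w) ->
  transit kap0 phi g t1 t2.
Proof.
  intros Ht Hr He0 HC1 HC' Hg H. pose proof (cp_kap HC) as Hk0.
  exists C. split; [auto|]. intros kap Hk.
  set (r := Rmin (Rmin kap0 e0) (Rmin (rho / 8) (kap / (C + C')))).
  assert (r1 : r <= kap0) by le_min.
  assert (r2 : r <= e0) by le_min.
  assert (r3 : r <= rho / 8) by le_min.
  assert (r4 : r <= kap / (C + C')) by le_min.
  assert (Hr0 : 0 < r).
  { unfold r. repeat apply Rmin_glb_lt; try lra. apply Rdiv_lt_0_compat; lra. }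
  apply Rle_div_r in r4; [|lra].
  exists r. split; [lra|]. intros eps He.
  assert (Hball : forall z, dst z (g t1) <= r -> dst z q < rho / 2).
  { intros z Hz. pose proof (dst_triangle z (g t1) q). lra. }
  split.
  - intros z Hz s Hs. destruct (H eps) with (s := s) as [A1 A2]; try lra.
    assert (h : dst (phi eps s z) (phi eps s (g t1)) <= C * dst z (g t1)).
    { apply A2; [auto|]. lra. }
    pose proof (dst_triangle (phi eps s z) (phi eps s (g t1)) (g (t1 + s))).
    assert (C * dst z (g t1) <= C * r) by (apply Rmult_le_compat_l; lra).
    assert (C' * eps <= C' * r) by (apply Rmult_le_compat_l; lra). lra.
  - intros z w Hz Hw. destruct (H eps) with (s := t2 - t1) as [A1 A2]; try lra.
    apply A2; auto.
Qed.

Lemma lie_h (X : pt -> pt) (q : pt) : dom Z q -> lie X (h Z) q = snd (X q).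
Proof.
  intros Hq. destruct (open_dst _ q (tm_open TZ) Hq) as [r [Hr Hd]].
  unfold lie, d1, d2. destruct q as [x y]; cbn [fst snd] in *.
  assert (E1 : Derive (fun x0 => h Z (x0, y)) x = 0).
  { apply is_derive_unique. apply (is_derive_ext_loc (fun _ => y)).
    - exists (mkposreal r Hr). intros s Hs. change (Rabs (s - x) < r) in Hs.
      symmetry. apply (tm_h TZ). apply Hd. eapply Rle_lt_trans; [apply dst_le_sum|].
      simpl. rewrite Rminus_diag, Rabs_R0. lra.
    - apply (is_derive_const (V := R_NormedModule)). }
  assert (E2 : Derive (fun y0 => h Z (x, y0)) y = 1).
  { apply is_derive_unique. apply (is_derive_ext_loc (fun s => s)).
    - exists (mkposreal r Hr). intros s Hs. change (Rabs (s - y) < r) in Hs.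
      symmetry. apply (tm_h TZ). apply Hd. eapply Rle_lt_trans; [apply dst_le_sum|].
      simpl. rewrite Rminus_diag, Rabs_R0. lra.
    - apply (is_derive_id (K := R_AbsRing)). }
  transitivity (fst (X (x, y)) * 0 + snd (X (x, y)) * 1); [|ring].
  apply f_equal2; apply f_equal2; auto.
Qed.

Context {g : R -> pt} {a b : Rbar}.
Context (Hg : regular_orbit Z g a b).
Context (HgG : forall t : R, Rbar_lt a t -> Rbar_lt t b -> Gamma (g t)).

Lemma transit_smooth (t0 rho L : R) (X : pt -> pt) :
  Rbar_lt a t0 -> Rbar_lt t0 b -> 0 < rho -> 0 <= L -> lip_ball X (g t0) rho L ->
  (forall eps z, 0 < eps < rho -> dst z (g t0) < rho -> dom Z z ->
     regularization Z Phi eps z = X z) ->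
  (forall t : R, Rbar_lt a t -> Rbar_lt t b -> dst (g t) (g t0) < rho -> velocity g t (X (g t))) ->
  exists d, 0 < d /\ forall t1 t2, t0 - d < t1 <= t0 -> t0 <= t2 < t0 + d ->
    transit kap0 phi g t1 t2.
Proof.
  intros Ha Hb Hr HL HX HR HV.
  pose proof (cp_kap HC) as Hk0. pose proof (cp_B HC) as HB.
  set (rh := Rmin rho kap0).
  assert (q1 : rh <= rho) by le_min. assert (q2 : rh <= kap0) by le_min.
  assert (Hrh : 0 < rh) by (apply Rmin_glb_lt; auto).
  destruct (Rbar_interval_open a b t0 Ha Hb) as [d1 [D1 Hab]].
  assert (Hcg : continuous g t0) by (apply (Hg t0 Ha Hb)).
  assert (Hr4 : 0 < rh / 4) by lra.
  destruct (continuous_dst g t0 _ Hcg Hr4) as [d2 [D2 Hc]].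
  assert (Hd3 : 0 < rh / (4 * (B + 1))) by (apply Rdiv_lt_0_compat; lra).
  set (d := Rmin (Rmin d1 d2) (rh / (4 * (B + 1)))).
  assert (e1 : d <= d1) by le_min.
  assert (e2 : d <= d2) by le_min.
  assert (e3 : d * (4 * (B + 1)) <= rh) by (apply Rle_div_r; [lra|le_min]).
  assert (e0 : 0 < d) by (unfold d; repeat apply Rmin_glb_lt; auto).
  exists d. split; [auto|]. intros t1 t2 h1 h2.
  assert (HBd : forall s, 0 <= s <= t2 - t1 -> B * s <= rh / 2).
  { intros s Hs. assert (B * s <= B * (2 * d)) by (apply Rmult_le_compat_l; lra). nra. }
  assert (Hin : forall t, t1 <= t <= t2 -> Rabs (t - t0) < d) by (intros; apply Rabs_def1; lra).
  assert (Hball : forall t, t1 <= t <= t2 -> dst (g t) (g t0) < rh / 4).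
  { intros t Ht. apply Hc. specialize (Hin t Ht). lra. }
  assert (Hgt0 : Gamma (g t0)) by auto.
  apply (transit_of_chart g (g t0) t1 t2 rh (exp (L * (2 * d))) 0 rho); try lra.
  - apply exp_nonneg_ge1. apply Rmult_le_pos; lra.
  - apply Hball. lra.
  - intros eps He Hek s Hs.
    assert (He' : 0 < eps < kap0) by lra.
    destruct (cp_lip HC eps He') as [Le [HLe HG]].
    pose proof (cp_bdd HC eps He') as Hbd.
    pose proof (cp_flow HC eps He') as Hf.
    assert (HGX : forall z, dst z (g t0) < rh -> G eps z = X z).
    { intros z Hz. rewrite (cp_agree HC eps He' z (g t0)) by (auto; lra).
      apply HR; [lra|lra|]. apply (cp_dom HC z (g t0)); auto; lra. }
    split.
    + rewrite Rmult_0_l. right.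
      replace (phi eps s (g t1)) with (g (t1 + s)); [apply dst_refl|].
      symmetry.
      apply (ode_unique_forward (G eps) (fun s => phi eps s (g t1)) (fun s => g (t1 + s)) 0 s).
      * lra.
      * intros u _. apply Hf.
      * intros u Hu. apply velocity_shift.
        assert (hb : dst (g (t1 + u)) (g t0) < rh / 4) by (apply Hball; lra).
        rewrite HGX by lra.
        assert (h : Rabs (t1 + u - t0) < d) by (apply Hin; lra).
        destruct (Hab (t1 + u)); [lra|].
        apply HV; auto. lra.
      * intros u _. apply (lip2_loc_lip _ Le); auto; lra.
      * rewrite Rplus_0_r. apply Hf.
    + intros z w Hz Hw.
      (* Away from Sigma the field is Lipschitz uniformly in eps, so the chart estimate is applied
         with K = 0, without the arctangent weight. *)
      assert (Hle : exp (L * s + 0 * PI) <= exp (L * (2 * d))).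
      { apply exp_le. rewrite Rmult_0_l, Rplus_0_r. apply Rmult_le_compat_l; lra. }
      eapply Rle_trans;
        [apply (chart_lipschitz (G eps) (phi eps) (g t0) rh L 0 1 eps Le B s)|]; auto; try lra.
      * apply Rabs_R1.
      * intros; lra.
      * intros z' w' Hz' Hw' _. rewrite !HGX by auto. rewrite Rmult_0_l, Rmult_0_l, Rplus_0_r.
        apply HX; lra.
      * apply Rmult_le_compat_r; [apply dst_nonneg|auto].
Qed.

Lemma transit_crossing (t0 sig : R) (Xa Xb : pt -> pt) :
  Rbar_lt a t0 -> Rbar_lt t0 b -> snd (g t0) = 0 ->
  (sig = 1 /\ Xa = Xp Z /\ Xb = Xm Z \/ sig = -1 /\ Xa = Xm Z /\ Xb = Xp Z) ->
  0 < sig * snd (Xp Z (g t0)) -> 0 < sig * snd (Xm Z (g t0)) ->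
  (exists d, 0 < d /\ forall s, 0 < Rabs (s - t0) < d -> ~ Sigma Z (g s)) ->
  exists d, 0 < d /\ forall t1 t2, t0 - d < t1 <= t0 -> t0 <= t2 < t0 + d ->
    transit kap0 phi g t1 t2.
Proof.
  intros Ha Hb Hy Hside Hp Hm [d0 [D0 Hiso]].
  pose proof (cp_kap HC) as Hk0. pose proof (cp_B HC) as HB.
  pose proof (tr_ell T) as Hell.
  assert (Hsig : Rabs sig = 1).
  { destruct Hside as [[-> _]|[-> _]]; [apply Rabs_R1|rewrite Rabs_left; lra]. }
  set (q := g t0) in *.
  destruct (Hg t0 Ha Hb) as [Hq [Hcg _]]. fold q in Hq.
  destruct (local_structure TZ q Hq) as [rho0 [L [B0 [Hr0 [HL [HB0 [Hdom Hs]]]]]]].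
  destruct Hs as [[h _]|[[h _]|[_ [LP [LM Hbd0]]]]]; [lra|lra|].
  set (c := Rmin (sig * snd (Xp Z q)) (sig * snd (Xm Z q)) / 2).
  assert (c1 : 2 * c <= sig * snd (Xp Z q)).
  { unfold c. pose proof (Rmin_l (sig * snd (Xp Z q)) (sig * snd (Xm Z q))). lra. }
  assert (c2 : 2 * c <= sig * snd (Xm Z q)).
  { unfold c. pose proof (Rmin_r (sig * snd (Xp Z q)) (sig * snd (Xm Z q))). lra. }
  assert (Hc : 0 < c).
  { unfold c. assert (0 < Rmin (sig * snd (Xp Z q)) (sig * snd (Xm Z q))) by (apply Rmin_glb_lt; auto). lra. }
  set (rho := Rmin (Rmin rho0 kap0) (c / (L + 1))).
  assert (q1 : rho <= rho0) by le_min.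
  assert (q2 : rho <= kap0) by le_min.
  assert (q3 : rho * (L + 1) <= c) by (apply Rle_div_r; [lra|le_min]).
  assert (Hrho : 0 < rho).
  { unfold rho. repeat apply Rmin_glb_lt; auto. apply Rdiv_lt_0_compat; lra. }
  assert (Hsnd : forall X z, lip_ball X q rho0 L -> 2 * c <= sig * snd (X q) ->
    dst z q < rho -> c <= sig * snd (X z)).
  { intros X z HX HcX Hz.
    assert (h1 : dst (X z) (X q) <= L * dst z q) by (apply HX; [lra|rewrite dst_refl; lra]).
    pose proof (dst_snd (X z) (X q)) as h2. pose proof (dst_nonneg z q).
    assert (h3 : Rabs (sig * (snd (X z) - snd (X q))) <= c).
    { rewrite Rabs_mult, Hsig. assert (L * dst z q <= L * rho) by (apply Rmult_le_compat_l; lra). lra. }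
    apply Rabs_le_between in h3. lra. }
  set (B1 := Rmax B B0).
  assert (b1 : B <= B1) by apply Rmax_l. assert (b2 : B0 <= B1) by apply Rmax_r.
  destruct (Rbar_interval_open a b t0 Ha Hb) as [d1 [D1 Hab]].
  assert (Hr4 : 0 < rho / 4) by lra.
  destruct (continuous_dst g t0 _ Hcg Hr4) as [d2 [D2 Hcn]].
  assert (Hd3 : 0 < rho / (4 * (B1 + 1))) by (apply Rdiv_lt_0_compat; lra).
  set (d := Rmin (Rmin d1 d2) (Rmin d0 (rho / (4 * (B1 + 1))))).
  assert (e1 : d <= d1) by le_min.
  assert (e2 : d <= d2) by le_min.
  assert (e3 : d <= d0) by le_min.
  assert (e4 : d * (4 * (B1 + 1)) <= rho).
  { apply Rle_div_r; [lra|]. le_min. }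
  assert (e0 : 0 < d) by (unfold d; repeat apply Rmin_glb_lt; auto).
  assert (Hdomg : forall t, Rabs (t - t0) < d -> dom Z (g t)).
  { intros t Ht. destruct (Hab t) as [x1 x2]; [lra|]. exact (proj1 (Hg t x1 x2)). }
  assert (Hside' : (forall z, dom Z z -> 0 < sig * snd z -> Sigma_p Z z /\ Xa = Xp Z \/ Sigma_m Z z /\ Xa = Xm Z) /\
                   (forall z, dom Z z -> sig * snd z < 0 -> Sigma_p Z z /\ Xb = Xp Z \/ Sigma_m Z z /\ Xb = Xm Z)).
  { unfold Sigma_p, Sigma_m. split; intros z Hz Hyz; rewrite (tm_h TZ z Hz);
    destruct Hside as [[-> [-> ->]]|[-> [-> ->]]].
    - left. split; [split; auto; lra|auto].
    - right. split; [split; auto; lra|auto].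
    - right. split; [split; auto; lra|auto].
    - left. split; [split; auto; lra|auto]. }
  assert (Cr : crossing Xa Xb g q t0 d rho c L B1 sig).
  { constructor; auto; try lra.
    - intros t Ht. destruct (Hab t) as [x1 x2]; [lra|]. split; [exact (proj1 (proj2 (Hg t x1 x2)))|].
      assert (h : dst (g t) (g t0) < rho / 4) by (apply Hcn; lra). fold q in h. lra.
    - intros t Ht Hne E. apply (Hiso t).
      + split; [|lra]. apply Rabs_pos_lt. lra.
      + split; [apply Hdomg; auto|]. rewrite (tm_h TZ) by (apply Hdomg; auto). exact E.
    - intros t Ht Hyt. destruct (Hab t); [lra|].
      destruct (Hg t) as [_ [_ [g1 [g2 _]]]]; auto.
      destruct (proj1 Hside' (g t) (Hdomg t Ht) Hyt) as [[S1 ->]|[S1 ->]]; [apply g1|apply g2]; auto.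
    - intros t Ht Hyt. destruct (Hab t); [lra|].
      destruct (Hg t) as [_ [_ [g1 [g2 _]]]]; auto.
      destruct (proj2 Hside' (g t) (Hdomg t Ht) Hyt) as [[S1 ->]|[S1 ->]]; [apply g1|apply g2]; auto.
    - intros z Hz. destruct (Hbd0 z) as [x1 x2]; [lra|].
      pose proof (Hsnd (Xp Z) z LP c1 Hz). pose proof (Hsnd (Xm Z) z LM c2 Hz).
      destruct Hside as [[_ [-> ->]]|[_ [-> ->]]]; repeat split; lra.
    - intros z w Hz Hw. destruct Hside as [[_ [-> ->]]|[_ [-> ->]]]; [apply LP|apply LM]; lra. }
  exists d. split; [auto|]. intros t1 t2 h1 h2.
  assert (HBd : forall s, 0 <= s <= t2 - t1 -> B1 * s <= rho / 2).
  { intros s Hs. assert (B1 * s <= B1 * (2 * d)) by (apply Rmult_le_compat_l; lra). nra. }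
  (* For |y| <= 2 eps one has eps / (eps^2 + y^2) >= 1 / (5 eps) and vertical speed at least c, so
     this K gives at least K c / (5 eps) = 2 B0 ell / eps, the contribution of the weight to the
     Lipschitz rate. *)
  set (K := 10 * B0 * ell / c).
  assert (HK : 0 <= K) by (unfold K; apply Rdiv_le_0_compat; [|auto]; repeat apply Rmult_le_pos; lra).
  pose proof PI_RGT_0 as HPI.
  set (C' := exp (L * (2 * d)) * (2 * B1 * ((1 + B1 / c) / c + / c))).
  assert (HC' : 0 <= C').
  { unfold C'. assert (0 < / c) by (apply Rinv_0_lt_compat; auto).
    assert (0 <= B1 / c) by (apply Rdiv_le_0_compat; lra).
    assert (0 <= (1 + B1 / c) / c) by (apply Rdiv_le_0_compat; lra).
    apply Rmult_le_pos; [left; apply exp_pos|]. apply Rmult_le_pos; lra. }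
  assert (Hqg : Gamma q) by (apply HgG; auto).
  apply (transit_of_chart g q t1 t2 rho (exp (L * (2 * d) + K * PI)) C' kap0); auto; try lra.
  - apply exp_nonneg_ge1. assert (0 <= L * (2 * d)) by (apply Rmult_le_pos; lra).
    assert (0 <= K * PI) by (apply Rmult_le_pos; lra). lra.
  - apply Hcn. apply Rabs_def1; lra.
  - intros eps He _ s Hs.
    destruct (cp_lip HC eps He) as [Le [HLe HG]].
    assert (Hbd : bounded2 B1 (G eps)).
    { intros z. pose proof (cp_bdd HC eps He z). lra. }
    pose proof (cp_flow HC eps He) as Hf.
    assert (Hdz : forall z, dst z q < rho -> dom Z z) by (intros z Hz; apply Hdom; lra).
    assert (HGW : forall z, dst z q < rho -> G eps z = regularization Z Phi eps z).
    { intros z Hz. apply (cp_agree HC eps He z q); auto; lra. }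
    assert (Hspeed : forall z, dst z q < rho -> c <= sig * snd (G eps z)).
    { intros z Hz. rewrite HGW, (reg_convex TZ) by auto. cbn [snd].
      pose proof (Hsnd (Xp Z) z LP c1 Hz). pose proof (Hsnd (Xm Z) z LM c2 Hz).
      pose proof (lam_range T (proj1 He) (snd z)) as hr.
      set (l := lam Phi eps (snd z)) in *. nra. }
    split.
    + pose proof (crossing_reference Cr (G eps) (phi eps) Le eps t1 (t1 + s)) as R0.
      replace (t1 + s - t1) with s in R0 by ring.
      apply R0; auto; try lra.
      * intros z Hz Hyz. rewrite HGW by auto.
        destruct Hside as [[-> [-> ->]]|[-> [-> ->]]];
        [apply (reg_up TZ T)|apply (reg_low TZ T)]; auto; lra.
      * intros z Hz Hyz. rewrite HGW by auto.
        destruct Hside as [[-> [-> ->]]|[-> [-> ->]]];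
        [apply (reg_low TZ T)|apply (reg_up TZ T)]; auto; lra.
    + intros z w Hz Hw.
      assert (Hle : exp (L * s + K * PI) <= exp (L * (2 * d) + K * PI)).
      { apply exp_le. assert (L * s <= L * (2 * d)) by (apply Rmult_le_compat_l; lra). lra. }
      eapply Rle_trans;
        [apply (chart_lipschitz (G eps) (phi eps) q rho L K sig eps Le B1 s)|]; auto; try lra.
      * intros z' Hz'. apply Rmult_le_pos; auto. specialize (Hspeed z' Hz'). lra.
      * intros z' w' Hz' Hw' Hzw. rewrite !(HGW _ Hz'), !(HGW _ Hw').
        assert (He0 : 0 < eps) by lra.
        eapply Rle_trans.
        { apply (reg_diff_sigma TZ T q rho L B0 eps z' w'); auto.
          - intros u v Hu Hv; apply LP; lra.
          - intros u v Hu Hv; apply LM; lra.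
          - intros u Hu; apply Hbd0; lra. }
        rewrite Rmult_plus_distr_r. apply Rplus_le_compat_l.
        rewrite <- (HGW z' Hz').
        pose proof (Hspeed z' Hz') as hs. pose proof (dst_nonneg z' w') as hd.
        pose proof (dst_snd z' w') as hy.
        set (y := snd z') in *. set (y' := snd w') in *.
        assert (Hden : 0 < eps ^ 2 + y ^ 2).
        { pose proof (pow2_ge_0 y). assert (0 < eps ^ 2) by (apply pow_lt; auto). lra. }
        (* Within 2 eps of Sigma the arctangent term dominates. Farther away, two points at distance
           at most eps lie beyond the strip on the same side, and their weights are equal. *)
        destruct (Rle_lt_dec (Rabs y) (2 * eps)) as [hin|hout].
        -- assert (hf : / (5 * eps) <= eps / (eps ^ 2 + y ^ 2)).
           { apply Rle_div_r; auto. apply Rmult_le_reg_l with (5 * eps); [lra|].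
             rewrite <- Rmult_assoc, Rinv_r by lra.
             assert (y ^ 2 <= (2 * eps) ^ 2).
             { rewrite <- (pow2_abs y). apply pow_incr. split; [apply Rabs_pos|auto]. }
             lra. }
           pose proof (lam_lip T He0 y y') as hl.
           assert (hel : 0 <= ell / eps) by (apply Rdiv_le_0_compat; lra).
           apply Rle_trans with (ell / eps * dst z' w' * (2 * B0)).
           { apply Rmult_le_compat_r; [lra|]. eapply Rle_trans; [exact hl|].
             apply Rmult_le_compat_l; auto. }
           apply Rle_trans with (K * c * / (5 * eps) * dst z' w').
           { right. unfold K. field. lra. }
           apply Rmult_le_compat_r; auto.
           apply Rmult_le_compat; auto.
           ++ apply Rmult_le_pos; lra.
           ++ left; apply Rinv_0_lt_compat; lra.
           ++ apply Rmult_le_compat_l; auto.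
        -- assert (El : lam Phi eps y = lam Phi eps y').
           { apply Rabs_le_between in hy.
             destruct (Rle_lt_dec 0 y) as [hp|hn].
             - rewrite Rabs_right in hout by lra.
               rewrite !(lam_up T He0) by lra. reflexivity.
             - rewrite Rabs_left in hout by lra.
               rewrite !(lam_low T He0) by lra. reflexivity. }
           rewrite El, Rminus_diag, Rabs_R0, Rmult_0_l.
           apply Rmult_le_pos; auto. apply Rmult_le_pos; [apply Rmult_le_pos; lra|].
           apply Rdiv_le_0_compat; lra.
      * apply Rmult_le_compat_r; [apply dst_nonneg|auto].
Qed.

Lemma transit_local (t0 : R) :
  Rbar_lt a t0 -> Rbar_lt t0 b ->
  exists d, 0 < d /\ forall t1 t2, t0 - d < t1 <= t0 -> t0 <= t2 < t0 + d ->
    transit kap0 phi g t1 t2.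
Proof.
  intros Ha Hb.
  destruct (Hg t0 Ha Hb) as [Hd [_ [_ [_ Hsig]]]].
  destruct (local_structure TZ (g t0) Hd) as [rho [L [B0 [Hr [HL [HB0 [Hdom Hs]]]]]]].
  destruct Hs as [[hy [LX HX]]|[[hy [LX HX]]|[hy _]]].
  - apply (transit_smooth t0 rho L (Xp Z)); auto.
    + intros eps z He Hz Hdz. apply (reg_up TZ T); auto; [lra|]. destruct (HX z Hz). lra.
    + intros t h1 h2 h3. destruct (Hg t h1 h2) as [g0 [_ [g1 _]]]. apply g1.
      split; [auto|]. rewrite (tm_h TZ) by auto. destruct (HX (g t) h3). lra.
  - apply (transit_smooth t0 rho L (Xm Z)); auto.
    + intros eps z He Hz Hdz. apply (reg_low TZ T); auto; [lra|]. destruct (HX z Hz). lra.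
    + intros t h1 h2 h3. destruct (Hg t h1 h2) as [g0 [_ [_ [g1 _]]]]. apply g1.
      split; [auto|]. rewrite (tm_h TZ) by auto. destruct (HX (g t) h3). lra.
  - destruct Hsig as [[_ Hc] Hiso].
    { split; [auto|]. rewrite (tm_h TZ) by auto. exact hy. }
    unfold Xph, Xmh in Hc. rewrite !lie_h in Hc by auto.
    destruct (Rlt_le_dec 0 (snd (Xp Z (g t0)))) as [hp|hp].
    + assert (hm : 0 < snd (Xm Z (g t0))).
      { apply Rnot_le_lt. intros h. nra. }
      apply (transit_crossing t0 1 (Xp Z) (Xm Z)); auto; lra.
    + assert (hm : snd (Xm Z (g t0)) < 0).
      { apply Rnot_le_lt. intros h. nra. }
      assert (hp' : snd (Xp Z (g t0)) < 0).
      { destruct hp as [hp|hp]; [auto|]. rewrite hp in Hc. lra. }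
      apply (transit_crossing t0 (-1) (Xm Z) (Xp Z)); auto; lra.
Qed.

(** Local transits hold across every time of the compact interval, smooth points and crossings
    alike; interval induction composes finitely many of them. *)
Lemma transit_all (t1 t2 : R) :
  Rbar_lt a t1 -> t1 <= t2 -> Rbar_lt t2 b -> transit kap0 phi g t1 t2.
Proof.
  intros Ha Ht Hb.
  refine (proj2 (interval_induction (fun t => t1 <= t /\ transit kap0 phi g t1 t) t1 t2 Ht _ _)).
  - split; [lra|apply transit_refl].
  - intros s Hs.
    assert (Has : Rbar_lt a s) by (apply (Rbar_lt_le_trans _ t1); simpl; auto; lra).
    assert (Hbs : Rbar_lt s b) by (apply (Rbar_le_lt_trans _ t2); simpl; auto; lra).
    destruct (transit_local s Has Hbs) as [d [Hd H]].
    exists d. split; [auto|]. intros s1 s2 h1 h2 h3 h4 [h5 h6]. split; [lra|].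
    apply (transit_trans g t1 s1 s2); [lra|lra|exact h6|apply H; lra].
Qed.

End Transit.

(** * Graph coordinates at the tangency *)

(** The expansion bound makes the increment k of [tau] small with h, and k is nonzero when h is; the
    difference quotient of [tau] is the inverse of that of [f] at k, which stays above c. *)
Lemma is_derive_inverse (f tau : R -> R) (u0 l c r : R) :
  0 < c -> 0 < r -> is_derive f (tau u0) l ->
  (forall u, Rabs (u - u0) < r -> f (tau u) = u) ->
  (forall u, Rabs (u - u0) < r -> c * Rabs (tau u - tau u0) <= Rabs (f (tau u) - f (tau u0)) /\
     0 <= (tau u - tau u0) * (f (tau u) - f (tau u0))) ->
  c <= l -> is_derive tau u0 (/ l).
Proof.
  intros Hc Hr Hf Hinv Hexp Hl.
  apply is_derive_Reals. apply is_derive_Reals in Hf.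
  intros e He.
  assert (He' : 0 < e * (c * c)) by (apply Rmult_lt_0_compat; nra).
  destruct (Hf _ He') as [del Hdel].
  assert (Hd : 0 < Rmin r (c * del)).
  { apply Rmin_glb_lt; auto. apply Rmult_lt_0_compat; [auto|apply cond_pos]. }
  exists (mkposreal _ Hd). intros h Hh Hh'. simpl in Hh'.
  assert (h1 : Rabs h < r) by (eapply Rlt_le_trans; [exact Hh'|le_min]).
  assert (h2 : Rabs h < c * del) by (eapply Rlt_le_trans; [exact Hh'|le_min]).
  assert (hu : Rabs (u0 + h - u0) < r) by (replace (u0 + h - u0) with h by ring; auto).
  assert (hu0 : Rabs (u0 - u0) < r) by (rewrite Rminus_diag, Rabs_R0; auto).
  destruct (Hexp _ hu) as [e1 e2].
  rewrite (Hinv _ hu), (Hinv _ hu0) in e1, e2.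
  replace (u0 + h - u0) with h in e1, e2 by ring.
  set (k := tau (u0 + h) - tau u0) in *.
  assert (Hk : k <> 0).
  { intros E. assert (tau (u0 + h) = tau u0) by (unfold k in E; lra).
    apply Hh. rewrite <- (Hinv _ hu), H, (Hinv _ hu0) in hu.
    pose proof (Hinv _ hu0). pose proof (Hinv (u0 + h)).
    assert (f (tau (u0 + h)) = u0 + h).
    { apply H1. replace (u0 + h - u0) with h by ring; auto. }
    rewrite H in H2. lra. }
  assert (Hkd : Rabs k < del).
  { apply Rmult_lt_reg_l with c; auto. lra. }
  specialize (Hdel k Hk Hkd).
  replace (tau u0 + k) with (tau (u0 + h)) in Hdel by (unfold k; ring).
  rewrite (Hinv _ hu), (Hinv _ hu0) in Hdel.
  replace (u0 + h - u0) with h in Hdel by ring.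
  assert (Hq : c <= h / k).
  { assert (Hka : 0 < Rabs k) by (apply Rabs_pos_lt; auto).
    replace (h / k) with (Rabs h / Rabs k).
    - apply Rle_div_r; auto.
    - rewrite <- Rabs_div by auto. apply Rabs_right. apply Rle_ge.
      destruct (Rlt_le_dec 0 k) as [hk|hk].
      + apply Rdiv_le_0_compat; auto. nra.
      + assert (k < 0) by lra. replace (h / k) with ((- h) / (- k)) by (field; auto).
        apply Rdiv_le_0_compat; nra. }
  set (m := h / k) in *.
  assert (Ekh : k / h = / m) by (unfold m; field; auto).
  rewrite Ekh.
  replace (/ m - / l) with ((l - m) / (m * l)) by (field; lra).
  assert (Hml : c * c <= m * l) by nra.
  rewrite Rabs_div by nra. rewrite (Rabs_right (m * l)) by nra.
  apply Rlt_div_l; [nra|]. rewrite Rabs_minus_sym in Hdel.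
  apply Rlt_le_trans with (1 := Hdel). apply Rmult_le_compat_l; lra.
Qed.

(** The coordinate u of the shear; being linear, it also gives the u-component of a velocity. The
    shear keeps y, so the strip is still |y| < eps and the weight does not depend on u. *)
Definition ul (al : R) (v : pt) : R := fst v - al * snd v.
Definition shear (al u y : R) : pt := (u + al * y, y).

Lemma shear_ul (al : R) (z : pt) : shear al (ul al z) (snd z) = z.
Proof. destruct z as [x y]. unfold shear, ul; simpl. f_equal. ring. Qed.

Lemma ul_derive (al : R) (z : R -> pt) (t : R) (v : pt) :
  velocity z t v -> is_derive (fun t => ul al (z t)) t (ul al v).
Proof.
  intros [h1 h2]. unfold ul. apply (is_derive_minus (V := R_NormedModule)); [exact h1|].
  apply (is_derive_scal (fun t => snd (z t))). exact h2.
Qed.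

(** The coordinate u increases along the orbit at rate at least c, so time is a differentiable
    function [tau] of u, and dy/du is the quotient of the two velocity components. *)
Lemma graph_of_orbit (al c tl th : R) (z v : R -> pt) :
  0 < c -> tl <= th ->
  (forall t, tl <= t <= th -> velocity z t (v t) /\ c <= ul al (v t)) ->
  exists tau : R -> R,
    (forall t, tl <= t <= th -> tau (ul al (z t)) = t) /\
    forall u, ul al (z tl) < u < ul al (z th) ->
      tl < tau u < th /\ ul al (z (tau u)) = u /\
      is_derive (fun u => snd (z (tau u))) u (snd (v (tau u)) / ul al (v (tau u))).
Proof.
  intros Hc Hlh Hv.
  set (f := fun t => ul al (z t)).
  assert (Hfd : forall t, tl <= t <= th -> is_derive f t (ul al (v t))).
  { intros t Ht. apply ul_derive. apply Hv; auto. }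
  assert (Hmono : forall s t, tl <= s -> s <= t -> t <= th -> f s + c * (t - s) <= f t).
  { intros s t h1 h2 h3. apply (derive_ge_increase f (fun t => ul al (v t))); auto.
    - intros x Hx; apply Hfd; lra.
    - intros x Hx; apply Hv; lra. }
  assert (Hex : forall u, exists t, f tl <= u <= f th -> tl <= t <= th /\ f t = u).
  { intros u. destruct (classic (f tl <= u <= f th)) as [H|H].
    - destruct (intermediate_value f tl th u Hlh) as [t Ht]; auto.
      + intros x Hx. apply (is_derive_continuity_pt _ _ (ul al (v x))). auto.
      + exists t. auto.
    - exists 0. intros; tauto. }
  destruct (functional_choice _ Hex) as [tau Htau].
  assert (Hinj : forall s t, tl <= s <= th -> tl <= t <= th -> f s = f t -> s = t).
  { intros s t hs ht E. destruct (Rtotal_order s t) as [h|[h|h]]; auto; exfalso.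
    - pose proof (Hmono s t). assert (f s + c * (t - s) <= f t) by (apply H; lra).
      assert (0 < c * (t - s)) by (apply Rmult_lt_0_compat; lra). lra.
    - pose proof (Hmono t s). assert (f t + c * (s - t) <= f s) by (apply H; lra).
      assert (0 < c * (s - t)) by (apply Rmult_lt_0_compat; lra). lra. }
  assert (Hrange : forall t, tl <= t <= th -> f tl <= f t <= f th).
  { intros t Ht. pose proof (Hmono tl t). pose proof (Hmono t th).
    assert (f tl + c * (t - tl) <= f t) by (apply H; lra).
    assert (f t + c * (th - t) <= f th) by (apply H0; lra).
    assert (0 <= c * (t - tl)) by (apply Rmult_le_pos; lra).
    assert (0 <= c * (th - t)) by (apply Rmult_le_pos; lra). lra. }
  exists tau. split.
  - intros t Ht. destruct (Htau (f t) (Hrange t Ht)) as [h1 h2]. apply Hinj; auto.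
  - intros u Hu. change (f tl < u < f th) in Hu.
    assert (Hu' : f tl <= u <= f th) by lra.
    destruct (Htau u Hu') as [h1 h2].
    assert (h3 : tl < tau u < th).
    { split.
      - destruct (Req_dec tl (tau u)) as [E|]; [rewrite <- E in h2; lra|lra].
      - destruct (Req_dec (tau u) th) as [E|]; [rewrite E in h2; lra|lra]. }
    split; [exact h3|split; [exact h2|]].
    assert (Hl : c <= ul al (v (tau u))) by (apply Hv; auto).
    assert (Hdt : is_derive tau u (/ ul al (v (tau u)))).
    { assert (Hin : forall w, Rabs (w - u) < Rmin (u - f tl) (f th - u) -> f tl <= w <= f th).
      { intros w Hw. assert (a1 : Rabs (w - u) < u - f tl) by (eapply Rlt_le_trans; [exact Hw|le_min]).
        assert (a2 : Rabs (w - u) < f th - u) by (eapply Rlt_le_trans; [exact Hw|le_min]).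
        apply Rabs_def2 in a1, a2. lra. }
      apply (is_derive_inverse f tau u _ c (Rmin (u - f tl) (f th - u))); auto.
      - apply Rmin_glb_lt; lra.
      - intros w Hw. apply (Htau w). auto.
      - intros w Hw. destruct (Htau w (Hin w Hw)) as [w1 w2].
        destruct (Rle_lt_dec (tau u) (tau w)) as [h|h].
        + pose proof (Hmono (tau u) (tau w)) as hm.
          assert (hm' : f (tau u) + c * (tau w - tau u) <= f (tau w)) by (apply hm; lra).
          assert (0 <= c * (tau w - tau u)) by (apply Rmult_le_pos; lra).
          rewrite !Rabs_right by lra. split; [lra|apply Rmult_le_pos; lra].
        + pose proof (Hmono (tau w) (tau u)) as hm.
          assert (hm' : f (tau w) + c * (tau u - tau w) <= f (tau u)) by (apply hm; lra).
          assert (0 <= c * (tau u - tau w)) by (apply Rmult_le_pos; lra).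
          rewrite !Rabs_left1 by lra. split; [lra|].
          replace ((tau w - tau u) * (f (tau w) - f (tau u))) with
            ((tau u - tau w) * (f (tau u) - f (tau w))) by ring.
          apply Rmult_le_pos; lra. }
    evar_last. apply (is_derive_comp (fun t => snd (z t)) tau).
    apply Hv; auto. exact Hdt. unfold scal; simpl; unfold mult; simpl. unfold Rdiv. ring.
Qed.

(* Slope, in the (u, y) coordinates, of the convex combination of Xm and Xp
   with weight l on Xp. *)
Definition slope (Xm Xp : pt -> pt) (al l : R) (z : pt) : R :=
  ((1 - l) * snd (Xm z) + l * snd (Xp z)) /
  ((1 - l) * ul al (Xm z) + l * ul al (Xp z)).

Lemma quotient_lipschitz (n n' d d' c B e1 e2 : R) :
  0 < c -> c <= d -> c <= d' -> Rabs n' <= B -> Rabs (n - n') <= e1 -> Rabs (d - d') <= e2 ->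
  Rabs (n / d - n' / d') <= e1 / c + B * e2 / (c * c).
Proof.
  intros Hc Hd Hd' Hn He1 He2.
  replace (n / d - n' / d') with ((n - n') / d - n' * (d - d') / (d * d')) by (field; lra).
  pose proof (Rabs_pos (n - n')). pose proof (Rabs_pos (d - d')). pose proof (Rabs_pos n').
  unfold Rminus at 1. eapply Rle_trans; [apply Rabs_triang|]. rewrite Rabs_Ropp.
  apply Rplus_le_compat.
  - rewrite Rabs_div by lra. rewrite (Rabs_right d) by lra.
    apply Rmult_le_compat; auto. left; apply Rinv_0_lt_compat; lra.
    apply Rinv_le_contravar; lra.
  - rewrite Rabs_div by nra. rewrite Rabs_mult, (Rabs_right (d * d')) by nra.
    apply Rmult_le_compat.
    + apply Rmult_le_pos; auto.
    + left; apply Rinv_0_lt_compat; nra.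
    + apply Rmult_le_compat; auto.
    + apply Rinv_le_contravar; nra.
Qed.

Lemma ul_abs (al : R) (v w : pt) : Rabs (ul al v - ul al w) <= (1 + Rabs al) * dst v w.
Proof.
  unfold ul. replace (fst v - al * snd v - (fst w - al * snd w)) with
    ((fst v - fst w) + - (al * (snd v - snd w))) by ring.
  eapply Rle_trans; [apply Rabs_triang|]. rewrite Rabs_Ropp, Rabs_mult.
  pose proof (dst_fst v w). pose proof (dst_snd v w). pose proof (Rabs_pos al).
  assert (Rabs al * Rabs (snd v - snd w) <= Rabs al * dst v w) by (apply Rmult_le_compat_l; auto).
  lra.
Qed.

Lemma shear_dst (al u y u' y' : R) :
  dst (shear al u y) (shear al u' y') <= Rabs (u - u') + (1 + Rabs al) * Rabs (y - y').
Proof.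
  eapply Rle_trans; [apply dst_le_sum|]. unfold shear; simpl.
  replace (u + al * y - (u' + al * y')) with ((u - u') + al * (y - y')) by ring.
  pose proof (Rabs_triang (u - u') (al * (y - y'))). rewrite Rabs_mult in H. lra.
Qed.

(** * Slopes of the regularized field near the tangency *)

Section SlopeAtTangency.
Context {Xm Xp : pt -> pt} {al rho L B c m2 : R}.
Context (Hc : 0 < c) (HL : 0 <= L) (HB : 0 <= B).
Context (LP : lip_ball Xp (0, 0) rho L) (LM : lip_ball Xm (0, 0) rho L).
Context (BP : forall z, dst z (0, 0) < rho -> dst (Xp z) (0, 0) <= B).
Context (BM : forall z, dst z (0, 0) < rho -> dst (Xm z) (0, 0) <= B).
Context (UP : forall z, dst z (0, 0) < rho -> c <= ul al (Xp z)).
Context (UM : forall z, dst z (0, 0) < rho -> c <= ul al (Xm z)).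

Let M1 : R := L / c + B * ((1 + Rabs al) * L) / (c * c).

Lemma slope_lip_const_nonneg : 0 <= M1.
Proof.
  unfold M1. pose proof (Rabs_pos al).
  assert (0 <= L / c) by (apply Rdiv_le_0_compat; auto).
  assert (0 <= B * ((1 + Rabs al) * L) / (c * c)).
  { apply Rdiv_le_0_compat; [|nra]. apply Rmult_le_pos; auto. apply Rmult_le_pos; lra. }
  lra.
Qed.

Lemma convex_Rabs (l x y e : R) :
  0 <= l <= 1 -> Rabs x <= e -> Rabs y <= e -> Rabs ((1 - l) * x + l * y) <= e.
Proof.
  intros Hl Hx Hy. apply Rabs_le_between in Hx, Hy. apply Rabs_le. split; nra.
Qed.

Lemma slope_den (l : R) (z : pt) : 0 <= l <= 1 -> dst z (0, 0) < rho ->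
  c <= (1 - l) * ul al (Xm z) + l * ul al (Xp z).
Proof. intros Hl Hz. specialize (UP z Hz). specialize (UM z Hz). nra. Qed.

Lemma slope_lipschitz (l : R) (z w : pt) : 0 <= l <= 1 ->
  dst z (0, 0) < rho -> dst w (0, 0) < rho ->
  Rabs (slope Xm Xp al l z - slope Xm Xp al l w) <= M1 * dst z w.
Proof.
  intros Hl Hz Hw. unfold slope.
  replace (M1 * dst z w) with
    (L * dst z w / c + B * ((1 + Rabs al) * L * dst z w) / (c * c)) by (unfold M1; field; lra).
  specialize (LP z w Hz Hw). specialize (LM z w Hz Hw).
  pose proof (Rabs_pos al).
  apply quotient_lipschitz; auto; try (apply slope_den; auto).
  - apply convex_Rabs; auto.
    + pose proof (dst_snd (Xm w) (0, 0)) as h. simpl in h. rewrite Rminus_0_r in h.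
      specialize (BM w Hw). lra.
    + pose proof (dst_snd (Xp w) (0, 0)) as h. simpl in h. rewrite Rminus_0_r in h.
      specialize (BP w Hw). lra.
  - replace ((1 - l) * snd (Xm z) + l * snd (Xp z) - ((1 - l) * snd (Xm w) + l * snd (Xp w)))
      with ((1 - l) * (snd (Xm z) - snd (Xm w)) + l * (snd (Xp z) - snd (Xp w))) by ring.
    apply convex_Rabs; auto.
    + pose proof (dst_snd (Xm z) (Xm w)). lra.
    + pose proof (dst_snd (Xp z) (Xp w)). lra.
  - replace ((1 - l) * ul al (Xm z) + l * ul al (Xp z) - ((1 - l) * ul al (Xm w) + l * ul al (Xp w)))
      with ((1 - l) * (ul al (Xm z) - ul al (Xm w)) + l * (ul al (Xp z) - ul al (Xp w))) by ring.
    apply convex_Rabs; auto.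
    + eapply Rle_trans; [apply ul_abs|]. rewrite Rmult_assoc. apply Rmult_le_compat_l; lra.
    + eapply Rle_trans; [apply ul_abs|]. rewrite Rmult_assoc. apply Rmult_le_compat_l; lra.
Qed.

Lemma slope_bound (l : R) (z : pt) : 0 <= l <= 1 -> dst z (0, 0) < rho ->
  Rabs (slope Xm Xp al l z) <= B / c.
Proof.
  intros Hl Hz. unfold slope. pose proof (slope_den l z Hl Hz) as hd.
  rewrite Rabs_div by lra. rewrite (Rabs_right ((1 - l) * ul al (Xm z) + l * ul al (Xp z))) by lra.
  apply Rmult_le_compat.
  - apply Rabs_pos.
  - left; apply Rinv_0_lt_compat; lra.
  - apply convex_Rabs; auto.
    + pose proof (dst_snd (Xm z) (0, 0)) as h. simpl in h. rewrite Rminus_0_r in h.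
      specialize (BM z Hz). lra.
    + pose proof (dst_snd (Xp z) (0, 0)) as h. simpl in h. rewrite Rminus_0_r in h.
      specialize (BP z Hz). lra.
  - apply Rinv_le_contravar; lra.
Qed.

Lemma slope_0 (z : pt) : slope Xm Xp al 0 z = snd (Xm z) / ul al (Xm z).
Proof.
  unfold slope.
  replace ((1 - 0) * snd (Xm z) + 0 * snd (Xp z)) with (snd (Xm z)) by ring.
  replace ((1 - 0) * ul al (Xm z) + 0 * ul al (Xp z)) with (ul al (Xm z)) by ring. reflexivity.
Qed.

Lemma slope_1 (z : pt) : slope Xm Xp al 1 z = snd (Xp z) / ul al (Xp z).
Proof.
  unfold slope.
  replace ((1 - 1) * snd (Xm z) + 1 * snd (Xp z)) with (snd (Xp z)) by ring.
  replace ((1 - 1) * ul al (Xm z) + 1 * ul al (Xp z)) with (ul al (Xp z)) by ring. reflexivity.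
Qed.

(** In l the slope is a quotient of affine functions with positive denominator, hence monotone.
    After cross-multiplication the difference is (l' - l)(y a - x b), whose sign is that of the
    comparison at l = 0 and l = 1. *)
Lemma slope_decreasing (l l' : R) (z : pt) : 0 <= l -> l <= l' -> l' <= 1 ->
  dst z (0, 0) < rho -> slope Xm Xp al 1 z <= slope Xm Xp al 0 z ->
  slope Xm Xp al l' z <= slope Xm Xp al l z.
Proof.
  intros h0 h1 h2 Hz Hs. rewrite slope_0, slope_1 in Hs.
  assert (hl : c <= (1 - l) * ul al (Xm z) + l * ul al (Xp z)) by (apply slope_den; auto; lra).
  assert (hl' : c <= (1 - l') * ul al (Xm z) + l' * ul al (Xp z)) by (apply slope_den; auto; lra).
  pose proof (UP z Hz) as hp. pose proof (UM z Hz) as hm.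
  unfold slope.
  set (a := ul al (Xp z)) in *. set (b := ul al (Xm z)) in *.
  set (x := snd (Xp z)) in *. set (y := snd (Xm z)) in *.
  assert (hxy : x * b <= y * a).
  { replace (x * b) with (x / a * (a * b)) by (field; lra).
    replace (y * a) with (y / b * (a * b)) by (field; lra).
    apply Rmult_le_compat_r; [nra|exact Hs]. }
  apply Rle_div_l; [lra|].
  replace (((1 - l) * y + l * x) / ((1 - l) * b + l * a) * ((1 - l') * b + l' * a)) with
    (((1 - l) * y + l * x) * ((1 - l') * b + l' * a) / ((1 - l) * b + l * a)) by (field; lra).
  apply Rle_div_r; [lra|].
  assert (0 <= (l' - l) * (y * a - x * b)) by (apply Rmult_le_pos; lra). nra.
Qed.

Context (H0p : snd (Xp (0, 0)) = 0) (Hm2 : 0 < m2).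
Context (H0m : snd (Xm (0, 0)) / ul al (Xm (0, 0)) = m2).
Context (Hrho : 0 < rho) (Hsmall : M1 * rho <= m2 / 2).

Lemma slope_p_upper (z : pt) : dst z (0, 0) < rho -> slope Xm Xp al 1 z <= M1 * dst z (0, 0).
Proof.
  intros Hz.
  assert (h : Rabs (slope Xm Xp al 1 z - slope Xm Xp al 1 (0, 0)) <= M1 * dst z (0, 0)).
  { apply slope_lipschitz; [lra|auto|rewrite dst_refl; auto]. }
  rewrite (slope_1 (0, 0)), H0p in h. unfold Rdiv in h. rewrite Rmult_0_l, Rminus_0_r in h.
  pose proof (Rle_abs (slope Xm Xp al 1 z)). lra.
Qed.

Lemma slope_m_lower (z : pt) : dst z (0, 0) < rho -> m2 / 2 <= slope Xm Xp al 0 z.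
Proof.
  intros Hz.
  assert (h : Rabs (slope Xm Xp al 0 z - slope Xm Xp al 0 (0, 0)) <= M1 * dst z (0, 0)).
  { apply slope_lipschitz; [lra|auto|rewrite dst_refl; auto]. }
  rewrite (slope_0 (0, 0)), H0m in h. apply Rabs_le_between in h.
  pose proof slope_lip_const_nonneg.
  assert (M1 * dst z (0, 0) <= M1 * rho) by (apply Rmult_le_compat_l; lra). lra.
Qed.

Lemma slope_order (z : pt) : dst z (0, 0) < rho -> slope Xm Xp al 1 z <= slope Xm Xp al 0 z.
Proof.
  intros Hz. pose proof (slope_m_lower z Hz). pose proof (slope_p_upper z Hz).
  pose proof slope_lip_const_nonneg.
  assert (M1 * dst z (0, 0) <= M1 * rho) by (apply Rmult_le_compat_l; lra). lra.
Qed.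

(** For the one-sided bound a change of y is split in two: changing the weight at a fixed point only
    lowers the slope, whatever eps is, and moving the point at fixed weight costs the eps-free
    constant [M1] of the fields. The bound in u is eps-free because the weight depends on y
    alone. *)
Lemma slope_box_at_tangency (ell a b eps : R) (Phi : R -> R) :
  transition ell Phi -> 0 < eps -> a + (1 + Rabs al) * b < rho ->
  slope_box a b (m2 / 2) (M1 * (1 + Rabs al)) (B / c) eps
    (fun u y => slope Xm Xp al 0 (shear al u y))
    (fun u y => slope Xm Xp al 1 (shear al u y))
    (fun u y => slope Xm Xp al (lam Phi eps y) (shear al u y)).
Proof.
  intros T He Hab.
  pose proof slope_lip_const_nonneg as HM. pose proof (Rabs_pos al) as Hal.
  assert (H00 : (0, 0) = shear al 0 0) by (unfold shear; f_equal; ring).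
  assert (Hball : forall u y, Rabs u <= a -> Rabs y <= b -> dst (shear al u y) (0, 0) < rho).
  { intros u y hu hy. rewrite H00. eapply Rle_lt_trans; [apply shear_dst|].
    rewrite !Rminus_0_r.
    assert ((1 + Rabs al) * Rabs y <= (1 + Rabs al) * b) by (apply Rmult_le_compat_l; lra). lra. }
  pose proof (fun y => lam_range T He y) as Hlr.
  assert (Hly : forall l u y y', 0 <= l <= 1 -> Rabs u <= a -> Rabs y <= b -> Rabs y' <= b ->
    Rabs (slope Xm Xp al l (shear al u y) - slope Xm Xp al l (shear al u y')) <=
    M1 * (1 + Rabs al) * Rabs (y - y')).
  { intros l u y y' hl hu hy hy'. eapply Rle_trans; [apply slope_lipschitz; auto|].
    rewrite Rmult_assoc. apply Rmult_le_compat_l; auto.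
    eapply Rle_trans; [apply shear_dst|]. rewrite Rminus_diag, Rabs_R0. lra. }
  constructor.
  - intros u y hu hy. apply slope_bound; auto.
  - intros u y1 y2 hu h1 h2 h12.
    assert (hd : slope Xm Xp al (lam Phi eps y2) (shear al u y1) <=
                 slope Xm Xp al (lam Phi eps y1) (shear al u y1)).
    { apply slope_decreasing; auto; try apply Hlr. apply (lam_mono T He); auto.
      apply slope_order; auto. }
    pose proof (Hly (lam Phi eps y2) u y2 y1 (Hlr y2) hu h2 h1) as h.
    rewrite (Rabs_right (y2 - y1)) in h by lra. apply Rabs_le_between in h. lra.
  - intros u u' y hu hu' hy.
    pose proof (slope_lipschitz (lam Phi eps y) (shear al u y) (shear al u' y) (Hlr y)
       (Hball u y hu hy) (Hball u' y hu' hy)) as h.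
    pose proof (shear_dst al u y u' y) as hd. rewrite Rminus_diag, Rabs_R0 in hd.
    assert (M1 * dst (shear al u y) (shear al u' y) <= M1 * (1 + Rabs al) * Rabs (u - u')).
    { rewrite Rmult_assoc. apply Rmult_le_compat_l; auto.
      pose proof (Rabs_pos (u - u')). nra. }
    apply Rabs_le_between in h. lra.
  - intros u y hu hy h. rewrite (lam_up T He) by auto. reflexivity.
  - intros u y hu hy h. rewrite (lam_low T He) by auto. reflexivity.
  - intros u y hu hy. specialize (Hlr y). split; apply slope_decreasing; auto; try lra;
    apply slope_order; auto.
  - intros u y hu hy. apply slope_m_lower; auto.
  - intros u y1 y2 hu h1 h2. apply Hly; auto; lra.
  - intros u y1 y2 hu h1 h2. apply Hly; auto; lra.
  - intros u y hu hy. eapply Rle_trans; [apply slope_p_upper; auto|].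
    rewrite Rmult_assoc. apply Rmult_le_compat_l; auto.
    rewrite H00. eapply Rle_trans; [apply shear_dst|]. rewrite !Rminus_0_r.
    pose proof (Rabs_pos u). pose proof (Rabs_pos y). nra.
Qed.

End SlopeAtTangency.

(** Since u moves at rate at least c, the time span [th] on either side suffices to sweep the whole
    window [u0, u1]. The sign clauses on [tau] tell which part of the graph lies before time 0 and
    which after. *)
Lemma orbit_solves (al c th b u0 u1 : R) (z : R -> pt) (X : pt -> pt) (F : R -> R -> R) :
  0 < c -> 0 < th ->
  (forall t, Rabs t <= th -> velocity z t (X (z t)) /\ c <= ul al (X (z t)) /\
     Rabs (snd (z t)) <= b /\
     snd (X (z t)) / ul al (X (z t)) = F (ul al (z t)) (snd (z t))) ->
  ul al (z 0) - c * th < u0 -> u1 < ul al (z 0) + c * th ->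
  exists tau : R -> R,
    (forall t, Rabs t <= th -> tau (ul al (z t)) = t) /\
    (forall s t, - th <= s -> s <= t -> t <= th -> ul al (z s) <= ul al (z t)) /\
    (forall u, u0 <= u <= u1 -> Rabs (tau u) <= th /\ z (tau u) = shear al u (snd (z (tau u))) /\
       (ul al (z 0) < u -> 0 < tau u) /\ (u < ul al (z 0) -> tau u < 0)) /\
    solves F b (fun u => snd (z (tau u))) u0 u1.
Proof.
  intros Hc Hth Hz H0 H1.
  assert (Hmono : forall s t, - th <= s -> s <= t -> t <= th ->
    ul al (z s) + c * (t - s) <= ul al (z t)).
  { intros s t h1 h2 h3.
    apply (derive_ge_increase (fun t => ul al (z t)) (fun t => ul al (X (z t)))); auto.
    - intros x Hx. apply ul_derive. apply Hz. apply Rabs_le; lra.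
    - intros x Hx. apply Hz. apply Rabs_le; lra. }
  destruct (graph_of_orbit al c (- th) th z (fun t => X (z t)) Hc) as [tau [T1 T2]].
  - lra.
  - intros t Ht. destruct (Hz t) as [h1 [h2 _]]; [apply Rabs_le; lra|]. auto.
  - pose proof (Hmono (- th) 0) as m1. pose proof (Hmono 0 th) as m2.
    assert (m1' : ul al (z (- th)) + c * (0 - - th) <= ul al (z 0)) by (apply m1; lra).
    assert (m2' : ul al (z 0) + c * (th - 0) <= ul al (z th)) by (apply m2; lra).
    assert (Hle : forall s t, - th <= s -> s <= t -> t <= th -> ul al (z s) <= ul al (z t)).
    { intros s t h1 h2 h3. pose proof (Hmono s t h1 h2 h3).
      assert (0 <= c * (t - s)) by (apply Rmult_le_pos; lra). lra. }
    exists tau. split; [|split; [exact Hle|split]].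
    + intros t Ht. apply Rabs_le_between in Ht. apply T1; lra.
    + intros u Hu. destruct (T2 u) as [a1 [a2 _]]; [lra|].
      split; [apply Rabs_le; lra|]. split; [|split].
      * rewrite <- a2 at 2. symmetry. apply shear_ul.
      * intros h. apply Rnot_le_lt. intros hle. pose proof (Hle (tau u) 0). lra.
      * intros h. apply Rnot_le_lt. intros hle. pose proof (Hle 0 (tau u)). lra.
    + intros u Hu. destruct (T2 u) as [a1 [a2 a3]]; [lra|].
      destruct (Hz (tau u)) as [b1 [b2 [b3 b4]]]; [apply Rabs_le; lra|].
      split; [|exact b3]. rewrite b4, a2 in a3. exact a3.
Qed.

(** The field is glued to the zero field outside the ball and the complete flow is used; the speed
    bound tells how long the orbit stays where nothing was changed. *)
Lemma local_orbit (X : pt -> pt) (q : pt) (rho L B : R) :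
  0 < rho -> 0 <= L -> 0 <= B -> lip_ball X q rho L ->
  (forall z, dst z q < rho -> dst (X z) (0, 0) <= B) ->
  exists x : R -> pt, x 0 = q /\ (forall t, dst (x t) q <= B * Rabs t) /\
    forall t, dst (x t) q < rho / 2 -> velocity x t (X (x t)).
Proof.
  intros Hr HL HB HX Hb.
  set (G := glue q (rho / 2) (fun _ => (0, 0)) X).
  assert (Hr2 : 0 < rho / 2) by lra. replace rho with (2 * (rho / 2)) in HX, Hb by field.
  assert (HG : lip2 ((/ (rho / 2) * B + 0) + (/ (rho / 2) * B + L)) G).
  { apply glue_lipschitz; auto; try lra.
    - intros z w. rewrite dst_refl. lra.
    - intros z. rewrite dst_refl. lra. }
  assert (Hbd : bounded2 B G).
  { apply glue_bounded; auto. intros z. rewrite dst_refl. lra. }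
  assert (Hi : 0 < / (rho / 2)) by (apply Rinv_0_lt_compat; auto).
  set (L0 := (/ (rho / 2) * B + 0) + (/ (rho / 2) * B + L)) in *.
  assert (HL0 : 0 <= L0) by (unfold L0; nra).
  assert (HG' : lip2 (L0 + 1) G).
  { intros z w. specialize (HG z w). pose proof (dst_nonneg z w). lra. }
  destruct (flow_exists G (L0 + 1) B) as [phi Hphi]; auto; [lra|].
  exists (fun t => phi t q). destruct (Hphi q) as [h0 hv].
  split; [exact h0|split].
  - intros t. rewrite <- h0 at 2.
    pose proof (flow_speed G B phi 0 t q HB Hbd Hphi) as h. rewrite Rminus_0_r in h. exact h.
  - intros t Ht. rewrite <- (glue_agrees q (rho / 2) (fun _ => (0, 0)) X); auto.
Qed.

Record tangency (Xm Xp : pt -> pt) (al rho L B c m2 : R) : Prop := Tangency {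
  tg_c : 0 < c; tg_L : 0 <= L; tg_B : 0 <= B; tg_rho : 0 < rho; tg_m2 : 0 < m2;
  tg_LP : lip_ball Xp (0, 0) rho L;
  tg_LM : lip_ball Xm (0, 0) rho L;
  tg_BP : forall z, dst z (0, 0) < rho -> dst (Xp z) (0, 0) <= B;
  tg_BM : forall z, dst z (0, 0) < rho -> dst (Xm z) (0, 0) <= B;
  tg_UP : forall z, dst z (0, 0) < rho -> c <= ul al (Xp z);
  tg_UM : forall z, dst z (0, 0) < rho -> c <= ul al (Xm z);
  tg_YM : forall z, dst z (0, 0) < rho -> c <= snd (Xm z);
  tg_0p : snd (Xp (0, 0)) = 0;
  tg_0m : snd (Xm (0, 0)) / ul al (Xm (0, 0)) = m2;
  tg_small : (L / c + B * ((1 + Rabs al) * L) / (c * c)) * rho <= m2 / 2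
}.

(* The shear u = x - al y is chosen so that u increases along both fields. *)
Lemma tangency_exists (Xm Xp : pt -> pt) (r0 : R) :
  0 < r0 -> nice_at Xp (0, 0) -> nice_at Xm (0, 0) ->
  0 < fst (Xp (0, 0)) -> snd (Xp (0, 0)) = 0 -> 0 < snd (Xm (0, 0)) ->
  exists al rho L B c m2, rho <= r0 /\ tangency Xm Xp al rho L B c m2.
Proof.
  intros Hr0 [r1 [L1 [B1 [A1 [A2 [A3 [A4 A5]]]]]]] [r2 [L2 [B2 [C1 [C2 [C3 [C4 C5]]]]]]] Hp Hp0 Hm.
  set (A := fst (Xp (0, 0))) in *. set (m2 := snd (Xm (0, 0))) in *.
  (* This value makes the u-component of [Xm] at p equal to 1, whatever the sign of its first
     component; that of [Xp] remains A > 0 because [Xp] is horizontal at p. *)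
  set (al := (fst (Xm (0, 0)) - 1) / m2).
  assert (Um : ul al (Xm (0, 0)) = 1) by (unfold ul; fold m2; unfold al; field; lra).
  assert (Up : ul al (Xp (0, 0)) = A) by (unfold ul; rewrite Hp0; unfold A; ring).
  set (L := L1 + L2). set (B := B1 + B2).
  set (c := Rmin (Rmin A 1) m2 / 2).
  assert (c1 : 2 * c <= A) by (unfold c; pose proof (Rmin_l (Rmin A 1) m2); pose proof (Rmin_l A 1); lra).
  assert (c2 : 2 * c <= 1) by (unfold c; pose proof (Rmin_l (Rmin A 1) m2); pose proof (Rmin_r A 1); lra).
  assert (c3 : 2 * c <= m2) by (unfold c; pose proof (Rmin_r (Rmin A 1) m2); lra).
  assert (Hc : 0 < c).
  { unfold c. assert (0 < Rmin (Rmin A 1) m2) by (repeat apply Rmin_glb_lt; lra). lra. }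
  pose proof (Rabs_pos al) as Hal.
  set (M1 := L / c + B * ((1 + Rabs al) * L) / (c * c)).
  assert (HL : 0 <= L) by (unfold L; lra). assert (HB : 0 <= B) by (unfold B; lra).
  assert (HkL : 0 <= (1 + Rabs al) * L) by (apply Rmult_le_pos; lra).
  assert (HM1 : 0 <= M1).
  { unfold M1. assert (0 <= L / c) by (apply Rdiv_le_0_compat; auto).
    assert (0 <= B * ((1 + Rabs al) * L) / (c * c)).
    { apply Rdiv_le_0_compat; [|nra]. apply Rmult_le_pos; auto. } lra. }
  set (rho := Rmin (Rmin r0 (Rmin r1 r2)) (Rmin (c / ((1 + Rabs al) * L + 1)) (m2 / 2 / (M1 + 1)))).
  assert (q0 : rho <= r0) by le_min.
  assert (q1 : rho <= r1) by le_min.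
  assert (q2 : rho <= r2) by le_min.
  assert (q3 : rho * ((1 + Rabs al) * L + 1) <= c).
  { apply Rle_div_r; [lra|]. le_min. }
  assert (q4 : rho * (M1 + 1) <= m2 / 2).
  { apply Rle_div_r; [lra|]. le_min. }
  assert (Hrho : 0 < rho).
  { unfold rho. repeat apply Rmin_glb_lt; auto; apply Rdiv_lt_0_compat; lra. }
  assert (LP : lip_ball Xp (0, 0) rho L).
  { intros z w hz hw. pose proof (dst_nonneg z w).
    assert (dst (Xp z) (Xp w) <= L1 * dst z w) by (apply A4; lra). unfold L. nra. }
  assert (LM : lip_ball Xm (0, 0) rho L).
  { intros z w hz hw. pose proof (dst_nonneg z w).
    assert (dst (Xm z) (Xm w) <= L2 * dst z w) by (apply C4; lra). unfold L. nra. }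
  assert (Hul : forall X z, lip_ball X (0, 0) rho L -> dst z (0, 0) < rho ->
    Rabs (ul al (X z) - ul al (X (0, 0))) <= c).
  { intros X z HX Hz. eapply Rle_trans; [apply ul_abs|].
    assert (h : dst (X z) (X (0, 0)) <= L * dst z (0, 0)) by (apply HX; auto; rewrite dst_refl; auto).
    pose proof (dst_nonneg z (0, 0)).
    assert ((1 + Rabs al) * dst (X z) (X (0, 0)) <= (1 + Rabs al) * (L * dst z (0, 0))).
    { apply Rmult_le_compat_l; lra. }
    assert ((1 + Rabs al) * L * dst z (0, 0) <= (1 + Rabs al) * L * rho).
    { apply Rmult_le_compat_l; lra. } lra. }
  exists al, rho, L, B, c, m2. split; [auto|].
  constructor; auto.
  - intros z hz. assert (dst (Xp z) (0, 0) <= B1) by (apply A5; lra). unfold B. lra.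
  - intros z hz. assert (dst (Xm z) (0, 0) <= B2) by (apply C5; lra). unfold B. lra.
  - intros z hz. pose proof (Hul Xp z LP hz) as h. rewrite Up in h.
    apply Rabs_le_between in h. lra.
  - intros z hz. pose proof (Hul Xm z LM hz) as h. rewrite Um in h.
    apply Rabs_le_between in h. lra.
  - intros z hz.
    assert (h : dst (Xm z) (Xm (0, 0)) <= L * dst z (0, 0)) by (apply LM; auto; rewrite dst_refl; auto).
    pose proof (dst_snd (Xm z) (Xm (0, 0))) as h2. fold m2 in h2. apply Rabs_le_between in h2.
    pose proof (dst_nonneg z (0, 0)).
    assert (L * dst z (0, 0) <= L * rho) by (apply Rmult_le_compat_l; lra).
    assert (L * rho <= (1 + Rabs al) * L * rho).
    { apply Rmult_le_compat_r; [lra|]. nra. } lra.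
  - rewrite Um. unfold m2. field.
  - fold M1. lra.
Qed.

Lemma velocity_continuous_pt (g : R -> pt) (t : R) (v : pt) :
  velocity g t v -> continuous g t.
Proof.
  intros Hv P [e He].
  destruct (velocity_continuous g t v Hv e (cond_pos e)) as [d [Hd H]].
  exists (mkposreal d Hd). intros s Hs. apply He. specialize (H s Hs).
  pose proof (dst_fst (g s) (g t)). pose proof (dst_snd (g s) (g t)).
  split; [change (Rabs (fst (g s) - fst (g t)) < e)|change (Rabs (snd (g s) - snd (g t)) < e)]; lra.
Qed.

(** Needed for an arc leaving p, which is known to solve the equation only after its initial time.
    Gronwall from t0 + e with e -> 0 gives agreement a little later, and ordinary uniqueness does
    the rest. *)
Lemma ode_unique_from_limit (W : pt -> pt) (x1 x2 : R -> pt) (t0 t1 : R) :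
  t0 < t1 -> continuous x1 t0 -> continuous x2 t0 ->
  (forall t, t0 < t <= t1 -> velocity x1 t (W (x1 t))) ->
  (forall t, t0 < t <= t1 -> velocity x2 t (W (x2 t))) ->
  (forall t, t0 <= t <= t1 -> loc_lip W (x1 t)) ->
  x1 t0 = x2 t0 -> x1 t1 = x2 t1.
Proof.
  intros Ht C1 C2 V1 V2 Hl E.
  destruct (Hl t0) as [rho [L [Hr [HL HW]]]]; [lra|].
  destruct (continuous_dst x1 t0 _ C1 Hr) as [d1 [D1 H1]].
  destruct (continuous_dst x2 t0 _ C2 Hr) as [d2 [D2 H2]].
  set (d := Rmin (Rmin d1 d2) (t1 - t0)).
  assert (e1 : d <= d1) by le_min.
  assert (e2 : d <= d2) by le_min.
  assert (e3 : d <= t1 - t0) by le_min.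
  assert (Hd : 0 < d) by (unfold d; repeat apply Rmin_glb_lt; lra).
  set (s := t0 + d / 2).
  assert (Es : x1 s = x2 s).
  { apply dst_eq0. apply Rnot_lt_le. intros Hgap. set (gap := dst (x1 s) (x2 s)) in *.
    set (E0 := exp (L * d)).
    assert (HE : 1 <= E0) by (apply exp_nonneg_ge1; apply Rmult_le_pos; lra).
    assert (Hg : 0 < gap / (4 * E0)) by (apply Rdiv_lt_0_compat; lra).
    destruct (continuous_dst x1 t0 _ C1 Hg) as [d3 [D3 H3]].
    destruct (continuous_dst x2 t0 _ C2 Hg) as [d4 [D4 H4]].
    set (e := Rmin (Rmin (d3 / 2) (d4 / 2)) (d / 4)).
    assert (f1 : e <= d3 / 2) by le_min.
    assert (f2 : e <= d4 / 2) by le_min.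
    assert (f3 : e <= d / 4) by le_min.
    assert (He : 0 < e) by (unfold e; repeat apply Rmin_glb_lt; lra).
    assert (g1 : dst (x1 (t0 + e)) (x1 t0) < gap / (4 * E0)).
    { apply H3. rewrite Rabs_right; lra. }
    assert (g2 : dst (x2 (t0 + e)) (x2 t0) < gap / (4 * E0)).
    { apply H4. rewrite Rabs_right; lra. }
    assert (g3 : gap <= exp (L * (s - (t0 + e))) * dst (x1 (t0 + e)) (x2 (t0 + e))).
    { apply (gronwall_lipschitz W L); auto.
      - unfold s; lra.
      - intros u Hu. apply V1. unfold s in *; lra.
      - intros u Hu. apply V2. unfold s in *; lra.
      - intros u Hu. apply HW.
        + apply H1. rewrite Rabs_right; unfold s in *; lra.
        + rewrite E. apply H2. rewrite Rabs_right; unfold s in *; lra. }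
    pose proof (dst_triangle (x1 (t0 + e)) (x1 t0) (x2 (t0 + e))) as g4.
    rewrite E in g4 at 2. rewrite (dst_sym (x2 t0)) in g4.
    assert (g5 : dst (x1 (t0 + e)) (x2 (t0 + e)) <= 2 * (gap / (4 * E0))) by lra.
    assert (g6 : exp (L * (s - (t0 + e))) <= E0).
    { apply exp_le. apply Rmult_le_compat_l; unfold s; lra. }
    assert (g7 : exp (L * (s - (t0 + e))) * dst (x1 (t0 + e)) (x2 (t0 + e)) <= E0 * (2 * (gap / (4 * E0)))).
    { apply Rmult_le_compat; auto. left; apply exp_pos. apply dst_nonneg. }
    replace (E0 * (2 * (gap / (4 * E0)))) with (gap / 2) in g7 by (field; lra). lra. }
  apply (ode_unique_forward W x1 x2 s t1); auto.
  - unfold s; lra.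
  - intros u Hu. apply V1. unfold s in *; lra.
  - intros u Hu. apply V2. unfold s in *; lra.
  - intros u Hu. apply Hl. unfold s in *; lra.
Qed.

(* Gamma crosses the box |u| <= a around p = (0,0) from zb (in Sigma-) to za
   (in Sigma+); the regularized flow takes the section u = - a to u = a as an
   arbitrarily strong contraction, close to Gamma. *)
Record gate (Z : filippov) (Gamma : set2) (kap0 : R) (phi : R -> R -> pt -> pt)
    (al a yb ya c : R) (xp : R -> pt) (ta : R) : Prop := Gate {
  gt_c : 0 < c;
  gt_zb : Gamma (shear al (- a) yb) /\ yb < 0 /\ c <= ul al (Xm Z (shear al (- a) yb));
  gt_za : Gamma (shear al a ya);
  gt_ta : 0 < ta;
  gt_xp0 : xp 0 = (0, 0);
  gt_xpa : xp ta = shear al a ya;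
  gt_xp : forall t, 0 <= t <= ta -> velocity xp t (Xp Z (xp t)) /\ dom Z (xp t);
  gt_xp_up : forall t, 0 < t <= ta -> 0 < snd (xp t);
  gt_contraction : exists Kc, 1 <= Kc /\ forall Lc, 0 < Lc ->
    exists r, 0 < r <= kap0 /\ forall eps, 0 < eps < r ->
      exists T Q : R -> R, forall y, Rabs (y - yb) <= r ->
        0 < T y /\
        phi eps (T y) (shear al (- a) y) = shear al a (Q y) /\
        (forall s, 0 <= s <= T y -> exists q, Gamma q /\
           dst (phi eps s (shear al (- a) y)) q <= Kc * (Rabs (y - yb) + eps)) /\
        Rabs (Q y - ya) <= Kc * (Rabs (y - yb) + eps) /\
        forall y', Rabs (y' - yb) <= r -> Rabs (Q y - Q y') <= Lc * Rabs (y - y')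
}.

(** The scalar results are applied to graphs over u: the orbit of [Xm] before p, the orbit of [Xp]
    after p, and every regularized orbit started near Gamma on u = -a. The first two lie on Gamma
    because they are pieces of its separatrices. *)
Lemma gate_exists (Z : filippov) (TZ : tame Z) (ell : R) (Phi : R -> R)
    (T : transition ell Phi) (Gamma : set2) (kap0 B0 : R) (G : R -> pt -> pt)
    (phi : R -> R -> pt -> pt) (HC : completed Z Phi Gamma kap0 B0 G phi)
    (x0 : R -> pt) (s1 : R) :
  Gamma (0, 0) -> dom Z (0, 0) ->
  0 < fst (Xp Z (0, 0)) -> snd (Xp Z (0, 0)) = 0 -> 0 < snd (Xm Z (0, 0)) ->
  subset (W_pf Z delta_s (0, 0)) Gamma -> subset (W_t Z delta_u (0, 0)) Gamma ->
  0 < s1 -> continuous x0 0 -> x0 0 = (0, 0) ->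
  (forall t, 0 < t < s1 -> velocity x0 t (Xp Z (x0 t)) /\ 0 < snd (x0 t)) ->
  exists al a yb ya c xp ta, gate Z Gamma kap0 phi al a yb ya c xp ta.
Proof.
  intros Gp Dp HA Hp0 Hm2 Wm Wp Hs1 Cx0 Ex0 Hx0.
  pose proof (cp_kap HC) as Hk0. pose proof (cp_B HC) as HB0.
  destruct (tangency_exists (Xm Z) (Xp Z) kap0 Hk0) as [al [rho [L [B [c [m2 [Hrk TG]]]]]]]; auto.
  { apply (tm_p TZ); auto. simpl; lra. }
  { apply (tm_m TZ); auto. simpl; lra. }
  destruct TG as [Hc HL HB Hrho Hmm LP LM BP BM UP UM YM H0p H0m Hsm].
  pose proof (Rabs_pos al) as Hal.
  set (k := 1 + Rabs al) in *.
  assert (Hk : 1 <= k) by (unfold k; lra).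
  set (M := (L / c + B * (k * L) / (c * c)) * k).
  assert (HM : 0 <= M).
  { unfold M. assert (0 <= L / c) by (apply Rdiv_le_0_compat; auto).
    assert (0 <= B * (k * L) / (c * c)).
    { apply Rdiv_le_0_compat; [|nra]. apply Rmult_le_pos; auto. apply Rmult_le_pos; lra. }
    apply Rmult_le_pos; lra. }
  assert (Hdomp : forall z, dst z (0, 0) < rho -> dom Z z).
  { intros z Hz. apply (cp_dom HC z (0, 0)); auto; lra. }
  (* A common speed bound for the two original fields and for the complete fields [G eps], so that
     one time span [th] serves all three kinds of orbit. *)
  set (D := Rmax B B0).
  assert (d1 : B <= D) by apply Rmax_l. assert (d2 : B0 <= D) by apply Rmax_r.
  set (b := rho / (4 * k)).
  assert (Hkb : k * b = rho / 4) by (unfold b; field; lra).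
  assert (Hb : 0 < b) by (unfold b; apply Rdiv_lt_0_compat; lra).
  assert (Hbr : b <= rho / 4) by nra.
  set (th := Rmin (b / (4 * (D + 1))) (s1 / 2)).
  assert (Hth1 : th * (4 * (D + 1)) <= b) by (apply Rle_div_r; [lra|le_min]).
  assert (Hth2 : th <= s1 / 2) by le_min.
  assert (Hth : 0 < th).
  { unfold th. apply Rmin_glb_lt; [|lra]. apply Rdiv_lt_0_compat; lra. }
  assert (HDth : forall t, Rabs t <= th -> D * Rabs t <= b / 4).
  { intros t Ht. assert (D * Rabs t <= D * th) by (apply Rmult_le_compat_l; lra). nra. }
  set (Bs := B / c).
  assert (HBs : 0 <= Bs) by (apply Rdiv_le_0_compat; auto).
  (* The first bound lets an orbit started at u = -a pass u = a within time [th]. The second keeps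
     the box in the ball of radius [rho]. The third puts the starting points on u = -a within b / 4
     of p. *)
  set (a := Rmin (Rmin (c * th / 4) (rho / 4)) (b / (8 * (1 + k * Bs)))).
  assert (Hcth : 0 < c * th) by (apply Rmult_lt_0_compat; auto).
  assert (HkB : 0 <= k * Bs) by (apply Rmult_le_pos; lra).
  assert (a1 : a <= c * th / 4) by le_min.
  assert (a2 : a <= rho / 4) by le_min.
  assert (a3 : a * (8 * (1 + k * Bs)) <= b) by (apply Rle_div_r; [lra|le_min]).
  assert (Ha : 0 < a).
  { unfold a. repeat apply Rmin_glb_lt; try lra. apply Rdiv_lt_0_compat; lra. }
  set (fm := fun u y => slope (Xm Z) (Xp Z) al 0 (shear al u y)).
  set (fp := fun u y => slope (Xm Z) (Xp Z) al 1 (shear al u y)).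
  set (Fe := fun eps u y => slope (Xm Z) (Xp Z) al (lam Phi eps y) (shear al u y)).
  assert (HSB : forall eps, 0 < eps -> slope_box a b (m2 / 2) M Bs eps fm fp (Fe eps)).
  { intros eps He. apply (@slope_box_at_tangency (Xm Z) (Xp Z) al rho L B c m2) with (ell := ell); auto.
    fold k. lra. }
  assert (Hu00 : ul al (0, 0) = 0) by (unfold ul; simpl; ring).
  destruct (local_orbit (Xm Z) (0, 0) rho L B Hrho HL HB LM BM) as [xm [xm0 [xmd xmv]]].
  destruct (local_orbit (Xp Z) (0, 0) rho L B Hrho HL HB LP BP) as [xp [xp0 [xpd xpv]]].
  assert (xmb : forall t, Rabs t <= th -> dst (xm t) (0, 0) < b / 2).
  { intros t Ht. eapply Rle_lt_trans; [apply xmd|]. specialize (HDth t Ht).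
    pose proof (Rabs_pos t). nra. }
  assert (xpb : forall t, Rabs t <= th -> dst (xp t) (0, 0) < b / 2).
  { intros t Ht. eapply Rle_lt_trans; [apply xpd|]. specialize (HDth t Ht).
    pose proof (Rabs_pos t). nra. }
  assert (snd_b : forall z, Rabs (snd z) <= dst z (0, 0)).
  { intros z. pose proof (dst_snd z (0, 0)) as h. simpl in h. rewrite Rminus_0_r in h. exact h. }
  destruct (orbit_solves al c th b (- a) a xm (Xm Z) fm Hc Hth) as [taum [tm1 [tm2 [tm3 tm4]]]].
  { intros t Ht. specialize (xmb t Ht). split; [apply xmv; lra|split; [apply UM; lra|split]].
    - specialize (snd_b (xm t)). lra.
    - unfold fm. rewrite shear_ul, slope_0. reflexivity. }
  { rewrite xm0, Hu00. lra. }
  { rewrite xm0, Hu00. lra. }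
  destruct (orbit_solves al c th b (- a) a xp (Xp Z) fp Hc Hth) as [taup [tp1 [tp2 [tp3 tp4]]]].
  { intros t Ht. specialize (xpb t Ht). split; [apply xpv; lra|split; [apply UP; lra|split]].
    - specialize (snd_b (xp t)). lra.
    - unfold fp. rewrite shear_ul, slope_1. reflexivity. }
  { rewrite xp0, Hu00. lra. }
  { rewrite xp0, Hu00. lra. }
  set (Ym := fun u => snd (xm (taum u))) in *.
  set (Yp := fun u => snd (xp (taup u))) in *.
  assert (Rth0 : Rabs 0 <= th) by (rewrite Rabs_R0; lra).
  assert (Ym0 : Ym 0 = 0).
  { unfold Ym. specialize (tm1 0 Rth0). rewrite xm0, Hu00 in tm1. rewrite tm1, xm0. reflexivity. }
  assert (Yp0 : Yp 0 = 0).
  { unfold Yp. specialize (tp1 0 Rth0). rewrite xp0, Hu00 in tp1. rewrite tp1, xp0. reflexivity. }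
  rewrite xm0, Hu00 in tm3. rewrite xp0, Hu00 in tp3.
  assert (xm_low : forall t, - th <= t < 0 -> snd (xm t) < 0).
  { intros t Ht.
    assert (h : snd (xm t) + c * (0 - t) <= snd (xm 0)).
    { apply (derive_ge_increase (fun t => snd (xm t)) (fun t => snd (Xm Z (xm t)))); [lra| |].
      - intros x Hx. assert (Rabs x <= th) by (apply Rabs_le; lra). specialize (xmb x H). apply xmv. lra.
      - intros x Hx. assert (Rabs x <= th) by (apply Rabs_le; lra). specialize (xmb x H). apply YM. lra. }
    rewrite xm0 in h. simpl in h.
    assert (0 < c * (0 - t)) by (apply Rmult_lt_0_compat; lra). lra. }
  (* By uniqueness the orbit of [Xp] through p is the given arc [x0], which lies in the upper half
     plane; this is how the outgoing arc is known to be in Sigma+. *)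
  assert (xp_eq : forall t, 0 <= t <= th -> xp t = x0 t).
  { intros t Ht. destruct (Req_dec t 0) as [->|Hne]; [congruence|].
    apply (ode_unique_from_limit (Xp Z) xp x0 0 t); auto; try lra.
    - apply velocity_continuous_pt with (Xp Z (xp 0)). apply xpv. rewrite xp0, dst_refl. lra.
    - intros u Hu. assert (hu : Rabs u <= th) by (apply Rabs_le; lra).
      specialize (xpb u hu). apply xpv. lra.
    - intros u Hu. apply Hx0. lra.
    - intros u Hu. assert (hu : Rabs u <= th) by (apply Rabs_le; lra).
      specialize (xpb u hu). exists (rho / 2), L. split; [lra|split; [auto|]].
      intros z w hz hw. apply LP.
      + pose proof (dst_triangle z (xp u) (0, 0)). lra.
      + pose proof (dst_triangle w (xp u) (0, 0)). lra.
    - congruence. }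
  assert (xp_up : forall t, 0 < t <= th -> 0 < snd (xp t)).
  { intros t Ht. rewrite xp_eq by lra. apply Hx0. lra. }
  assert (Ym_pt : forall u, - a <= u <= a -> shear al u (Ym u) = xm (taum u)).
  { intros u Hu. symmetry. apply tm3. exact Hu. }
  assert (Yp_pt : forall u, - a <= u <= a -> shear al u (Yp u) = xp (taup u)).
  { intros u Hu. symmetry. apply tp3. exact Hu. }
  assert (GYm : forall u, - a <= u <= 0 -> Gamma (shear al u (Ym u))).
  { intros u Hu. rewrite Ym_pt by lra.
    destruct (tm3 u) as [h1 [_ [_ h3]]]; [lra|].
    destruct (Req_dec u 0) as [->|Hne].
    - specialize (tm1 0 Rth0). rewrite xm0, Hu00 in tm1. rewrite tm1, xm0. exact Gp.
    - assert (ht : taum u < 0) by (apply h3; lra). apply Rabs_le_between in h1.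
      apply Wm. exists xm, (taum u). rewrite Rmin_right, Rmax_left by lra.
      split; [unfold delta_s; lra|split; [auto|split; [auto|split]]].
      + intros s Hs. assert (hs : Rabs s <= th) by (apply Rabs_le; lra).
        specialize (xmb s hs). split; [apply Hdomp; lra|apply xmv; lra].
      + intros s Hs. assert (hs : Rabs s <= th) by (apply Rabs_le; lra).
        specialize (xmb s hs). assert (hd : dom Z (xm s)) by (apply Hdomp; lra).
        split; [exact hd|]. rewrite (tm_h TZ) by auto. apply xm_low. lra. }
  assert (GYp : forall u, 0 <= u <= a -> Gamma (shear al u (Yp u))).
  { intros u Hu. rewrite Yp_pt by lra.
    destruct (tp3 u) as [h1 [_ [h3 _]]]; [lra|].
    destruct (Req_dec u 0) as [->|Hne].
    - specialize (tp1 0 Rth0). rewrite xp0, Hu00 in tp1. rewrite tp1, xp0. exact Gp.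
    - assert (ht : 0 < taup u) by (apply h3; lra). apply Rabs_le_between in h1.
      apply Wp. exists xp, (taup u). rewrite Rmin_left, Rmax_right by lra.
      split; [unfold delta_u; lra|split; [auto|split; [auto|split]]].
      + intros s Hs. assert (hs : Rabs s <= th) by (apply Rabs_le; lra).
        specialize (xpb s hs). split; [apply Hdomp; lra|apply xpv; lra].
      + intros s Hs. assert (hs : Rabs s <= th) by (apply Rabs_le; lra).
        specialize (xpb s hs). assert (hd : dom Z (xp s)) by (apply Hdomp; lra).
        split; [exact hd|]. rewrite (tm_h TZ) by auto. apply xp_up. lra. }
  assert (Yp_pos : forall u, 0 <= u <= a -> 0 <= Yp u).
  { intros u Hu. destruct (Req_dec u 0) as [->|Hne]; [lra|].
    destruct (tp3 u) as [h1 [_ [h3 _]]]; [lra|].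
    assert (ht : 0 < taup u) by (apply h3; lra). apply Rabs_le_between in h1.
    left. apply xp_up. lra. }
  destruct (tm3 (- a)) as [ma1 [ma2 [_ ma3]]]; [lra|].
  assert (ma4 : taum (- a) < 0) by (apply ma3; lra). apply Rabs_le_between in ma1.
  destruct (tp3 a) as [pa1 [pa2 [pa3 _]]]; [lra|].
  assert (pa4 : 0 < taup a) by (apply pa3; lra). apply Rabs_le_between in pa1.
  assert (tm4' : solves fm b Ym (- a) 0) by (eapply solves_sub; eauto; lra).
  assert (tp4' : solves fp b Yp 0 a) by (eapply solves_sub; eauto; lra).
  assert (Ym_bound : Rabs (Ym (- a)) <= Bs * a).
  { pose proof (HSB 1 Rlt_0_1) as S1.
    assert (h : Rabs (Ym 0 - Ym (- a)) <= Bs * Rabs (0 - - a)).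
    { apply MVT_segment.
      - intros s Hs. rewrite Rmin_left, Rmax_right in Hs by lra. eexists. apply tm4. lra.
      - intros s Hs. rewrite Rmin_left, Rmax_right in Hs by lra.
        destruct (tm4 s) as [h1 h2]; [lra|]. rewrite (is_derive_unique _ _ _ h1).
        apply (@slope_bound (Xm Z) (Xp Z) al rho B c); auto; [lra|].
        rewrite Ym_pt by lra. destruct (tm3 s) as [h3 _]; [lra|]. specialize (xmb _ h3). lra. }
    rewrite Ym0 in h. replace (0 - - a) with a in h by ring.
    rewrite Rminus_0_l, Rabs_Ropp, (Rabs_right a) in h by lra. exact h. }
  exists al, a, (Ym (- a)), (Yp a), c, xp, (taup a).
  constructor; auto.
  - split; [apply GYm; lra|split].
    + apply xm_low. lra.
    + rewrite Ym_pt by lra. apply UM. assert (hs : Rabs (taum (- a)) <= th) by (apply Rabs_le; lra).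
      specialize (xmb _ hs). lra.
  - apply GYp; lra.
  - intros t Ht. assert (ht : Rabs t <= th) by (apply Rabs_le; lra).
    specialize (xpb t ht). split; [apply xpv; lra|apply Hdomp; lra].
  - intros t Ht. apply xp_up. lra.
  (* [K1] and [K] are the constants of [slope_closeness]; the factor [k] converts a gap in y at
     fixed u into a distance in the plane. *)
  - set (K1 := 1 + (1 + M * a) * exp (M * a)).
    set (K := 1 + (K1 + M * a) * exp (M * a)).
    assert (HMa : 0 <= M * a) by nra.
    assert (HE1 : 1 <= exp (M * a)) by (apply exp_nonneg_ge1; auto).
    assert (HK1 : 1 <= K1) by (unfold K1; nra).
    assert (HK : 1 <= K) by (unfold K; nra).
    exists (k * K). split; [nra|]. intros Lc HLc.
    assert (Hm22 : 0 < m2 / 2) by lra.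
    destruct (slope_strong_contraction a b (m2 / 2) M Bs fm fp Ym Yp Lc) as [r1 [Hr1 Hcontr]]; auto.
    set (r := Rmin (Rmin r1 kap0) (b / (8 * k))).
    assert (e1 : r <= r1) by le_min.
    assert (e2 : r <= kap0) by le_min.
    assert (e3 : r * (8 * k) <= b) by (apply Rle_div_r; [lra|le_min]).
    assert (Hr : 0 < r).
    { unfold r. repeat apply Rmin_glb_lt; auto; apply Rdiv_lt_0_compat; lra. }
    exists r. split; [lra|]. intros eps He.
    assert (He0 : 0 < eps) by lra. assert (Hek : 0 < eps < kap0) by lra.
    pose proof (HSB eps He0) as SB.
    pose proof (cp_bdd HC eps Hek) as Hbd.
    pose proof (cp_flow HC eps Hek) as Hf.
    set (W := regularization Z Phi eps).
    assert (HGW : forall z, dst z (0, 0) < rho -> G eps z = W z).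
    { intros z Hz. apply (cp_agree HC eps Hek z (0, 0)); auto; lra. }
    assert (HW : forall z, dst z (0, 0) < rho ->
      c <= ul al (W z) /\ snd (W z) / ul al (W z) = Fe eps (ul al z) (snd z)).
    { intros z Hz. pose proof (slope_den UP UM (lam Phi eps (snd z)) z (lam_range T He0 (snd z)) Hz) as hd.
      assert (E1 : ul al (W z) = (1 - lam Phi eps (snd z)) * ul al (Xm Z z) + lam Phi eps (snd z) * ul al (Xp Z z)).
      { unfold W. rewrite (reg_convex TZ) by auto. unfold ul; simpl. ring. }
      split; [rewrite E1; exact hd|].
      unfold Fe. rewrite shear_ul. unfold slope. rewrite <- E1. unfold W.
      rewrite (reg_convex TZ) by auto. reflexivity. }
    (* The passage time and the graph of the orbit are chosen as a pair, so that [T] and [Q] come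
       from the same orbit. Outside the range of y the pair is a dummy. *)
    assert (Hex : forall y, exists TY : R * (R -> R), Rabs (y - Ym (- a)) <= r ->
      0 < fst TY /\ snd TY (- a) = y /\ solves (Fe eps) b (snd TY) (- a) a /\
      phi eps (fst TY) (shear al (- a) y) = shear al a (snd TY a) /\
      forall s, 0 <= s <= fst TY -> exists u, - a <= u <= a /\
        phi eps s (shear al (- a) y) = shear al u (snd TY u)).
    { intros y. destruct (classic (Rabs (y - Ym (- a)) <= r)) as [Hy|Hy].
      2: { exists (0, fun _ => 0). intros; tauto. }
      set (z0 := shear al (- a) y). set (z := fun t => phi eps t z0).
      assert (z00 : z 0 = z0) by apply Hf.
      assert (Hz0 : dst z0 (0, 0) <= b / 4).
      { replace (0, 0) with (shear al 0 0) by (unfold shear; f_equal; ring).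
        eapply Rle_trans; [apply shear_dst|]. fold k.
        rewrite !Rminus_0_r, Rabs_Ropp, (Rabs_right a) by lra.
        assert (Rabs y <= r + Bs * a).
        { replace y with ((y - Ym (- a)) + Ym (- a)) by ring.
          eapply Rle_trans; [apply Rabs_triang|]. lra. }
        assert (k * Rabs y <= k * (r + Bs * a)) by (apply Rmult_le_compat_l; lra). lra. }
      assert (Hzb : forall t, Rabs t <= th -> dst (z t) (0, 0) < b).
      { intros t Ht. pose proof (flow_speed (G eps) B0 (phi eps) 0 t z0 HB0 Hbd Hf) as h.
        rewrite Rminus_0_r in h. fold (z t) (z 0) in h. rewrite z00 in h.
        specialize (HDth t Ht). pose proof (Rabs_pos t).
        assert (B0 * Rabs t <= D * Rabs t) by (apply Rmult_le_compat_r; lra).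
        pose proof (dst_triangle (z t) z0 (0, 0)). lra. }
      assert (Hulz0 : ul al z0 = - a) by (unfold ul, z0, shear; simpl; ring).
      destruct (orbit_solves al c th b (- a) a z W (Fe eps) Hc Hth) as [tau [t1 [t2 [t3 t4]]]].
      { intros t Ht. specialize (Hzb t Ht). assert (hz : dst (z t) (0, 0) < rho) by lra.
        destruct (HW (z t) hz) as [w1 w2].
        split; [rewrite <- HGW by auto; apply Hf|split; [auto|split; [|auto]]].
        specialize (snd_b (z t)). lra. }
      { rewrite z00, Hulz0. lra. }
      { rewrite z00, Hulz0. lra. }
      rewrite z00, Hulz0 in t3.
      destruct (t3 a) as [ta1 [ta2 [ta3 _]]]; [lra|].
      exists (tau a, fun u => snd (z (tau u))). intros _. cbn [fst snd].
      split; [apply ta3; lra|split; [|split; [exact t4|split; [exact ta2|]]]].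
      - specialize (t1 0 Rth0). rewrite z00, Hulz0 in t1. rewrite t1, z00. reflexivity.
      - intros s Hs. apply Rabs_le_between in ta1.
        assert (hs : Rabs s <= th) by (apply Rabs_le; lra).
        exists (ul al (z s)). split.
        + split.
          * rewrite <- Hulz0, <- z00. apply t2; lra.
          * apply Rle_trans with (ul al (z (tau a))); [apply t2; lra|].
            rewrite ta2. unfold ul, shear; simpl. lra.
        + rewrite (t1 s hs). symmetry. apply shear_ul. }
    destruct (functional_choice _ Hex) as [TY HTY].
    exists (fun y => fst (TY y)), (fun y => snd (TY y) a).
    intros y Hy. destruct (HTY y Hy) as [y1 [y2 [y3 [y4 y5]]]].
    assert (Hcl : Rabs (snd (TY y) (- a) - Ym (- a)) <= r) by (rewrite y2; exact Hy).
    pose proof (Rabs_pos (y - Ym (- a))) as Hd0.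
    set (dy := Rabs (y - Ym (- a))) in *.
    destruct (slope_closeness SB Ym Yp (snd (TY y)) dy) as [cl1 cl2]; auto; try lra.
    { rewrite y2. unfold dy. lra. }
    fold K1 in cl1, cl2. fold K in cl1, cl2.
    assert (HKr : 0 <= K * (dy + eps)) by (apply Rmult_le_pos; lra).
    split; [exact y1|split; [exact y4|split; [|split]]].
    + intros s Hs. destruct (y5 s Hs) as [u [Hu Eu]]. rewrite Eu.
      assert (Hd : forall v, Rabs (snd (TY y) u - v) <= K * (dy + eps) ->
        dst (shear al u (snd (TY y) u)) (shear al u v) <= k * K * (dy + eps)).
      { intros v Hv. eapply Rle_trans; [apply shear_dst|]. rewrite Rminus_diag, Rabs_R0. fold k.
        rewrite Rplus_0_l, Rmult_assoc. apply Rmult_le_compat_l; lra. }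
      destruct (Rle_lt_dec u 0) as [h|h].
      * exists (shear al u (Ym u)). split; [apply GYm; lra|]. apply Hd, cl1. lra.
      * exists (shear al u (Yp u)). split; [apply GYp; lra|]. apply Hd, cl2. lra.
    + specialize (cl2 a). assert (Rabs (snd (TY y) a - Yp a) <= K * (dy + eps)) by (apply cl2; lra).
      rewrite Rmult_assoc. nra.
    + unfold dy in *. clear dy. intros y' Hy'. destruct (HTY y' Hy') as [y1' [y2' [y3' [y4' y5']]]].
      assert (Hcl' : Rabs (snd (TY y') (- a) - Ym (- a)) <= r) by (rewrite y2'; exact Hy').
      destruct (Rle_lt_dec y y') as [h|h].
      * pose proof (Hcontr eps (Fe eps) (snd (TY y)) (snd (TY y'))) as hc.
        rewrite y2, y2' in hc.
        assert (hc' : 0 <= snd (TY y') a - snd (TY y) a <= Lc * (y' - y)) by (apply hc; auto; lra).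
        rewrite !Rabs_left1 by lra. lra.
      * pose proof (Hcontr eps (Fe eps) (snd (TY y')) (snd (TY y))) as hc.
        rewrite y2, y2' in hc.
        assert (hc' : 0 <= snd (TY y) a - snd (TY y') a <= Lc * (y - y')) by (apply hc; auto; lra).
        rewrite !Rabs_right by lra. lra.
Qed.

(** * The return map and its fixed point *)

(** In one variable the intermediate value theorem replaces iteration. If |y - y0| = 2 e with e = |P
    y0 - y0|, then |P y - y0| <= e + (1/2) 2 e = 2 e, so y - P y changes sign between y0 - 2 e and
    y0 + 2 e. Clamping makes [P] continuous on the whole line. *)
Lemma contraction_fixed_point (P : R -> R) (y0 r : R) :
  0 < r ->
  (forall y y', Rabs (y - y0) <= r -> Rabs (y' - y0) <= r ->
     Rabs (P y - P y') <= / 2 * Rabs (y - y')) ->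
  Rabs (P y0 - y0) <= r / 2 ->
  exists y, Rabs (y - y0) <= 2 * Rabs (P y0 - y0) /\ P y = y.
Proof.
  intros Hr HP H0. set (e := Rabs (P y0 - y0)) in *.
  assert (He : 0 <= e) by apply Rabs_pos.
  set (cl := fun y => Rmax (y0 - r) (Rmin (y0 + r) y)).
  assert (Hcl : forall y, Rabs (cl y - y0) <= r).
  { intros y. unfold cl. apply Rabs_le. split.
    - pose proof (Rmax_l (y0 - r) (Rmin (y0 + r) y)). lra.
    - assert (Rmax (y0 - r) (Rmin (y0 + r) y) <= y0 + r); [|lra].
      apply Rmax_lub; [lra|apply Rmin_l]. }
  assert (Hcl2 : forall y y', Rabs (cl y - cl y') <= Rabs (y - y')).
  { intros y y'. unfold cl, Rmin. destruct (Rle_dec (y0 + r) y), (Rle_dec (y0 + r) y'); unfold Rmax;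
    repeat match goal with |- context [Rle_dec ?x ?y] => destruct (Rle_dec x y) end;
    unfold Rabs;
    repeat match goal with |- context [Rcase_abs ?x] => destruct (Rcase_abs x) end; lra. }
  assert (Hcl3 : forall y, Rabs (y - y0) <= r -> cl y = y).
  { intros y Hy. apply Rabs_le_between in Hy. unfold cl. rewrite Rmin_right, Rmax_right; lra. }
  set (f := fun y => y - P (cl y)).
  assert (Hf : forall y, continuity_pt f y).
  { intros y. apply continuity_pt_filterlim.
    apply (lipR_continuous 2 f). intros s t. unfold f.
    replace (t - P (cl t) - (s - P (cl s))) with ((t - s) - (P (cl t) - P (cl s))) by ring.
    unfold Rminus at 1. eapply Rle_trans; [apply Rabs_triang|]. rewrite Rabs_Ropp.
    pose proof (HP (cl t) (cl s) (Hcl t) (Hcl s)). pose proof (Hcl2 t s).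
    pose proof (Rabs_pos (t - s)). lra. }
  assert (Hlow : f (y0 - 2 * e) <= 0 <= f (y0 + 2 * e)).
  { assert (A : forall y, Rabs (y - y0) = 2 * e -> Rabs (P y - y0) <= 2 * e /\ cl y = y).
    { intros y Hy. assert (Rabs (y - y0) <= r) by lra. split; [|apply Hcl3; auto].
      assert (h : Rabs (P y - P y0) <= / 2 * Rabs (y - y0)).
      { apply HP; auto. rewrite Rminus_diag, Rabs_R0. lra. }
      replace (P y - y0) with ((P y - P y0) + (P y0 - y0)) by ring.
      eapply Rle_trans; [apply Rabs_triang|]. fold e. lra. }
    destruct (A (y0 - 2 * e)) as [A1 A2].
    { replace (y0 - 2 * e - y0) with (- (2 * e)) by ring. rewrite Rabs_Ropp, Rabs_right; lra. }
    destruct (A (y0 + 2 * e)) as [A3 A4].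
    { replace (y0 + 2 * e - y0) with (2 * e) by ring. rewrite Rabs_right; lra. }
    unfold f. rewrite A2, A4. apply Rabs_le_between in A1, A3. lra. }
  destruct (intermediate_value f (y0 - 2 * e) (y0 + 2 * e) 0) as [y [Hy Hy']]; auto.
  { lra. }
  assert (Hyr : Rabs (y - y0) <= 2 * e) by (apply Rabs_le; lra).
  exists y. split; [exact Hyr|]. unfold f in Hy'. rewrite Hcl3 in Hy' by lra. lra.
Qed.

Lemma period_shift (g : R -> pt) (T : R) :
  (forall t, g (t + T) = g t) -> forall n t, g (t + INR n * T) = g t.
Proof.
  intros H n. induction n as [|n IH]; intros t.
  - simpl. f_equal. ring.
  - rewrite S_INR. replace (t + (INR n + 1) * T) with (t + INR n * T + T) by ring.
    rewrite H. apply IH.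
Qed.

Lemma period_reduce (g : R -> pt) (T : R) :
  0 < T -> (forall t, g (t + T) = g t) -> forall t, exists s, 0 <= s < T /\ g s = g t.
Proof.
  intros HT H t.
  destruct (archimed (t / T)) as [A1 A2]. set (z := (up (t / T) - 1)%Z).
  assert (Hz : IZR z <= t / T < IZR z + 1) by (unfold z; rewrite minus_IZR; lra).
  assert (Hs : 0 <= t - IZR z * T < T).
  { destruct Hz as [h1 h2]. apply Rle_div_r in h1; [|lra]. apply Rlt_div_l in h2; [|lra]. lra. }
  exists (t - IZR z * T). split; [exact Hs|].
  destruct (Z_le_gt_dec 0 z) as [h|h].
  - rewrite <- (period_shift g T H (Z.to_nat z) (t - IZR z * T)).
    f_equal. rewrite INR_IZR_INZ, Z2Nat.id by auto. ring.
  - rewrite <- (period_shift g T H (Z.to_nat (- z)) t).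
    f_equal. rewrite INR_IZR_INZ, Z2Nat.id by lia. rewrite opp_IZR. ring.
Qed.

Lemma period_ahead (g : R -> pt) (T b : R) :
  0 < T -> (forall t, g (t + T) = g t) -> forall t, exists s, b <= s /\ g s = g t.
Proof.
  intros HT H t. destruct (INR_unbounded ((b - t) / T)) as [n Hn].
  exists (t + INR n * T). split.
  - apply Rlt_div_l in Hn; auto. lra.
  - apply period_shift, H.
Qed.

(* Any other periodic orbit near this one meets the section, hence accumulates
   at the fixed point, hence contains it. *)
Lemma limit_cycle_of_return (D N : set2) (X G : pt -> pt) (L : R) (phi : R -> pt -> pt)
    (S : R -> pt) (kS y0 r tmin Th beta ys : R) (TT P : R -> R) :
  0 <= L -> lip2 L G -> is_flow G phi ->
  (forall z, N z -> D z /\ exists rho, 0 < rho /\ forall w, dst w z < rho -> G w = X w) ->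
  0 <= kS -> (forall y y', dst (S y) (S y') <= kS * Rabs (y - y')) ->
  0 < tmin ->
  (forall y, Rabs (y - y0) <= r -> tmin <= TT y /\ phi (TT y) (S y) = S (P y) /\
     Rabs (P y - y0) <= r /\ forall s, 0 <= s <= TT y -> N (phi s (S y))) ->
  (forall y y', Rabs (y - y0) <= r -> Rabs (y' - y0) <= r ->
     Rabs (P y - P y') <= / 2 * Rabs (y - y')) ->
  Rabs (ys - y0) <= r -> P ys = ys -> X (S ys) <> (0, 0) ->
  0 < beta ->
  (forall z, dst z (S ys) < beta -> exists h y, Rabs h <= Th /\ Rabs (y - y0) <= r /\
     phi h z = S y) ->
  limit_cycle D X (fun q => exists t, phi t (S ys) = q).
Proof.
  intros HL HG Hf HN HkS HS Htm HR HP Hys Hfix Hnz Hbeta Hhit.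
  assert (Hadd : forall s t z, phi (t + s) z = phi s (phi t z)).
  { intros. apply (flow_plus G L); auto. }
  assert (Hloc : forall z, N z -> loc_lip X z).
  { intros z Hz. destruct (HN z Hz) as [_ [rho [Hr Ha]]]. exists rho, L. split; [auto|split; [auto|]].
    intros u v Hu Hv. rewrite <- !Ha by auto. apply HG. }
  assert (HGX : forall z, N z -> G z = X z).
  { intros z Hz. destruct (HN z Hz) as [_ [rho [Hr Ha]]]. apply Ha. rewrite dst_refl; auto. }
  (* Each return takes at least [tmin], so induction on the number of returns reaches every time:
     forward orbits from the section never leave [N]. *)
  assert (Hinv : forall n y t, Rabs (y - y0) <= r -> 0 <= t -> t <= INR n * tmin -> N (phi t (S y))).
  { induction n as [|n IH]; intros y t Hy Ht0 Ht.
    - destruct (HR y Hy) as [h1 [_ [_ h2]]]. apply h2. simpl in Ht. lra.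
    - destruct (HR y Hy) as [h1 [h2 [h3 h4]]].
      destruct (Rle_lt_dec t (TT y)) as [h|h]; [apply h4; lra|].
      replace t with (TT y + (t - TT y)) by ring. rewrite Hadd, h2.
      apply IH; auto; [lra|]. rewrite S_INR in Ht. lra. }
  assert (Hinv' : forall y t, Rabs (y - y0) <= r -> 0 <= t -> N (phi t (S y))).
  { intros y t Hy Ht. destruct (INR_unbounded (t / tmin)) as [n Hn].
    apply (Hinv n); auto. apply Rlt_div_l in Hn; lra. }
  (* An orbit of [X] that meets a forward orbit of the section follows it from then on: that orbit
     stays in [N], where [G] and [X] agree and uniqueness holds. *)
  assert (Hfollow : forall (x : R -> pt) (s0 y t0 s : R),
    (forall t, velocity x t (X (x t))) -> Rabs (y - y0) <= r -> 0 <= t0 -> 0 <= s ->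
    x s0 = phi t0 (S y) -> x (s0 + s) = phi (t0 + s) (S y)).
  { intros x s0 y t0 s Hx Hy Ht0 Hs E.
    symmetry. apply (ode_unique_forward X (fun s => phi (t0 + s) (S y)) (fun s => x (s0 + s)) 0 s Hs).
    - intros u Hu. rewrite <- HGX by (apply Hinv'; auto; lra).
      apply (velocity_shift (fun t => phi t (S y))). apply Hf.
    - intros u Hu. apply velocity_shift. apply Hx.
    - intros u Hu. apply Hloc, Hinv'; auto; lra.
    - rewrite !Rplus_0_r. auto. }
  set (zs := S ys) in *. set (Ts := TT ys).
  assert (HTs : tmin <= Ts) by (apply HR; auto).
  assert (Hper : forall t, phi (t + Ts) zs = phi t zs).
  { intros t. rewrite Rplus_comm, Hadd. destruct (HR ys Hys) as [_ [h _]].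
    fold zs Ts in h. rewrite h, Hfix. reflexivity. }
  assert (HNz : forall t, N (phi t zs)).
  { intros t. destruct (period_ahead (fun t => phi t zs) Ts 0) with (t := t) as [s [Hs E]]; auto; [lra|].
    rewrite <- E. apply Hinv'; auto. }
  assert (HPO : periodic_orbit D X (fun q => exists t, phi t zs = q)).
  { exists (fun t => phi t zs), Ts. split; [lra|split; [|split; [exact Hper|split]]].
    - intros t. split; [apply HN, HNz|]. rewrite <- HGX by auto. apply Hf.
    - apply NNPP. intros Hn.
      assert (Hc : forall t, phi t zs = phi 0 zs).
      { intros t. apply NNPP. intros h. apply Hn. exists t. exact h. }
      apply Hnz. rewrite <- (proj1 (Hf zs)) at 1. rewrite <- HGX by apply HNz.
      apply (velocity_unique (fun _ => phi 0 zs) 0).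
      + apply (velocity_ext (fun t => phi t zs) _ 0 _ 1); [lra|intros; apply Hc|apply Hf].
      + apply velocity_const.
    - intros q. tauto. }
  split; [exact HPO|].
  set (Th' := Rmax Th 0).
  (* The neighbourhood is a ball around the fixed point pushed forward by times at least [Th]. A
     point of the ball meets the section at a time h with |h| <= Th, possibly before 0 or after it,
     so the pushed point is always on the forward orbit of a section point. *)
  exists (fun z => exists t, Th' <= t /\ dst (phi (- t) z) zs < beta). split; [|split].
  - apply dst_open. intros z [t [Ht Hz]].
    set (E := exp (L * Rabs (- t))). assert (HE : 0 < E) by apply exp_pos.
    exists ((beta - dst (phi (- t) z) zs) / E). split; [apply Rdiv_lt_0_compat; lra|].
    intros w Hw. exists t. split; [auto|].
    pose proof (flow_lipschitz G L phi (- t) w z HL HG Hf) as h. fold E in h.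
    apply Rlt_div_r in Hw; auto.
    pose proof (dst_triangle (phi (- t) w) (phi (- t) z) zs). lra.
  - intros q [s Hs].
    destruct (period_ahead (fun t => phi t zs) Ts Th') with (t := s) as [t [Ht E]]; auto; [lra|].
    exists t. split; [auto|]. rewrite <- Hs, <- E, <- Hadd.
    replace (t + - t) with 0 by ring. rewrite (proj1 (Hf zs)), dst_refl. auto.
  - intros G' [g [T [HT [Hg [Hgp [_ Hg']]]]]] [z' [Hz' [t [Ht Hzb]]]].
    apply Hg' in Hz'. destruct Hz' as [s0 Es0].
    destruct (Hhit _ Hzb) as [h [y [Hh [Hy Ey]]]].
    assert (Hht : h <= t) by (pose proof (Rmax_l Th 0); apply Rabs_le_between in Hh; unfold Th' in Ht; lra).
    assert (Est : g s0 = phi (t - h) (S y)).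
    { rewrite Es0, <- Ey, <- !Hadd. replace (- t + (h + (t - h))) with 0 by ring. symmetry. apply Hf. }
    assert (Vg : forall t, velocity g t (X (g t))) by (intros; apply Hg).
    assert (Hn : forall n, exists yn tn, Rabs (yn - y0) <= r /\ INR n * tmin <= tn /\
       phi tn (S y) = S yn /\ Rabs (yn - ys) <= (/ 2) ^ n * Rabs (y - ys)).
    { induction n as [|n [yn [tn [I1 [I2 [I3 I4]]]]]].
      - exists y, 0. split; [auto|split; [simpl; lra|split; [apply Hf|simpl; lra]]].
      - destruct (HR yn I1) as [r1 [r2 [r3 r4]]].
        exists (P yn), (tn + TT yn). split; [auto|split; [rewrite S_INR; lra|split]].
        + rewrite Hadd, I3. exact r2.
        + rewrite <- Hfix at 1. eapply Rle_trans; [apply HP; auto|]. simpl. lra. }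
    (* Enough returns bring the other periodic orbit within e of the fixed point; periodicity brings
       the time back to [0, T]. *)
    assert (Hclose : forall e, 0 < e -> exists s, 0 <= s <= T /\ dst (g s) zs < e).
    { intros e He.
      assert (Hlim : is_lim_seq (fun n => (kS * Rabs (y - ys)) * (/ 2) ^ n) 0).
      { replace (Finite 0) with (Rbar_mult (kS * Rabs (y - ys)) 0) by (simpl; f_equal; ring).
        apply is_lim_seq_scal_l. apply is_lim_seq_geom. rewrite Rabs_right; lra. }
      apply is_lim_seq_spec in Hlim. destruct (Hlim (mkposreal e He)) as [n1 Hn1]. simpl in Hn1.
      destruct (INR_unbounded ((t - h) / tmin)) as [n2 Hn2]. apply Rlt_div_l in Hn2; [|lra].
      set (n := (n1 + n2)%nat). destruct (Hn n) as [yn [tn [I1 [I2 [I3 I4]]]]].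
      assert (Hn12 : INR n2 <= INR n) by (apply le_INR; unfold n; lia).
      assert (Htn : t - h <= tn).
      { assert (INR n2 * tmin <= INR n * tmin) by (apply Rmult_le_compat_r; lra). lra. }
      assert (Eg : g (s0 + (tn - (t - h))) = S yn).
      { rewrite (Hfollow g s0 y (t - h) (tn - (t - h))); auto; try lra.
        replace (t - h + (tn - (t - h))) with tn by ring. exact I3. }
      destruct (period_reduce g T HT Hgp (s0 + (tn - (t - h)))) as [s [Hs Es]].
      exists s. split; [lra|]. rewrite Es, Eg. eapply Rle_lt_trans; [apply HS|].
      assert (Hle : (n1 <= n)%nat) by (unfold n; lia). specialize (Hn1 n Hle).
      rewrite Rminus_0_r in Hn1. apply Rabs_lt_between in Hn1.
      assert (kS * Rabs (yn - ys) <= kS * ((/ 2) ^ n * Rabs (y - ys))) by (apply Rmult_le_compat_l; auto).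
      lra. }
    (* The distance to the fixed point attains its minimum on [0, T], and the minimum can only be
       0. *)
    assert (Hin : exists t1, g t1 = zs).
    { destruct (continuity_ab_min (fun s => dst (g s) zs) 0 T) as [t1 [Hmin Ht1]].
      - lra.
      - intros s _. apply continuity_pt_filterlim.
        apply (filterlim_locally (fun s => dst (g s) zs)). intros e.
        destruct (velocity_continuous g s _ (Vg s) e (cond_pos e)) as [d [Hd Hd']].
        exists (mkposreal d Hd). intros u Hu.
        change (Rabs (dst (g u) zs - dst (g s) zs) < e).
        specialize (Hd' u Hu).
        pose proof (dst_triangle (g u) (g s) zs). pose proof (dst_triangle (g s) (g u) zs).
        rewrite (dst_sym (g s) (g u)) in *. apply Rabs_def1; lra.
      - exists t1. apply dst_eq0. apply Rnot_lt_le. intros Hlt.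
        destruct (Hclose _ Hlt) as [s [Hs Hs']]. specialize (Hmin s Hs). lra. }
    destruct Hin as [t1 Et1].
    assert (Hgz : forall s, 0 <= s -> g (t1 + s) = phi s zs).
    { intros s Hs. rewrite (Hfollow g t1 ys 0 s); auto; try lra.
      - fold zs. f_equal. ring.
      - fold zs. rewrite Et1. symmetry. apply Hf. }
    intros q. rewrite (Hg' q). split.
    + intros [s Es]. destruct (period_ahead g T t1 HT Hgp s) as [u [Hu Eu]].
      exists (u - t1). rewrite <- Hgz by lra. replace (t1 + (u - t1)) with u by ring. congruence.
    + intros [s Es]. destruct (period_ahead (fun t => phi t zs) Ts 0) with (t := s) as [u [Hu Eu]]; auto; [lra|].
      exists (t1 + u). rewrite Hgz by auto. congruence.
Qed.

(** The Lipschitz bound is required along the two orbits only, so near the section below p the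
    eps-free constant of [Xm] can be used in place of the global one of [G]. *)
Lemma flow_lipschitz_ball (G : pt -> pt) (phi : R -> pt -> pt) (z w : pt) (L t : R) :
  0 <= L -> is_flow G phi ->
  (forall s, Rabs s <= Rabs t -> dst (G (phi s z)) (G (phi s w)) <= L * dst (phi s z) (phi s w)) ->
  dst (phi t z) (phi t w) <= exp (L * Rabs t) * dst z w.
Proof.
  intros HL Hf Hl. destruct (Hf z) as [z0 Hz]. destruct (Hf w) as [w0 Hw].
  destruct (Rle_lt_dec 0 t) as [Ht|Ht].
  - rewrite (Rabs_right t) in * by lra.
    pose proof (gronwall_lipschitz G L (fun t => phi t z) (fun t => phi t w) 0 t HL Ht) as g.
    cbv beta in g. rewrite z0, w0, Rminus_0_r in g. apply g; [intros u _; auto|intros u _; auto|].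
    intros u Hu. apply Hl. rewrite Rabs_right; lra.
  - rewrite (Rabs_left t) in * by lra.
    set (G' := fun z => (- fst (G z), - snd (G z))).
    pose proof (gronwall_lipschitz G' L (fun s => phi (0 - s) z) (fun s => phi (0 - s) w) 0 (- t) HL) as g.
    cbv beta in g. replace (0 - - t) with t in g by ring. rewrite !Rminus_0_r in g.
    rewrite z0, w0 in g. apply g; [lra| | |].
    + intros u _. apply (velocity_reverse (fun t => phi t z)). apply Hz.
    + intros u _. apply (velocity_reverse (fun t => phi t w)). apply Hw.
    + intros u Hu. eapply Rle_trans; [|apply Hl; rewrite Rabs_left1; lra].
      right. unfold G', dst; simpl. f_equal. ring.
Qed.

(** * First return to the section u = -a *)

Section Return.
Context {Z : filippov} (TZ : tame Z) {ell : R} {Phi : R -> R} (T : transition ell Phi).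
Context {Gamma : set2} {kap0 B : R} {G : R -> pt -> pt} {phi : R -> R -> pt -> pt}.
Context (HC : completed Z Phi Gamma kap0 B G phi).

(** Near this point of Gamma, below the strip, the regularization is [Xm] for all small eps, and u
    increases at rate at least c / 2. So the section is reached at a unique small time [h z],
    positive or negative, and projecting along the flow is Lipschitz with an eps-free constant. *)
Lemma section_hit (al a yb c : R) :
  Gamma (shear al (- a) yb) -> yb < 0 -> 0 < c -> c <= ul al (Xm Z (shear al (- a) yb)) ->
  exists rho Ch, 0 < rho <= kap0 /\ 1 <= Ch /\ forall eps, 0 < eps < rho ->
    exists h : pt -> R, forall z, dst z (shear al (- a) yb) <= rho ->
      Rabs (h z) <= Ch * dst z (shear al (- a) yb) /\
      phi eps (h z) z = shear al (- a) (snd (phi eps (h z) z)) /\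
      (forall s, Rabs s <= Rabs (h z) ->
         dst (phi eps s z) (shear al (- a) yb) <= Ch * dst z (shear al (- a) yb)) /\
      regularization Z Phi eps z <> (0, 0) /\
      (ul al z = - a -> h z = 0) /\
      forall w, dst w (shear al (- a) yb) <= rho ->
        dst (phi eps (h z) z) (phi eps (h w) w) <= Ch * dst z w.
Proof.
  intros HG Hyb Hc Hul. set (zb := shear al (- a) yb) in *.
  pose proof (cp_kap HC) as Hk0. pose proof (cp_B HC) as HB.
  assert (Hdz : dom Z zb) by (apply (cp_dom HC zb zb); auto; rewrite dst_refl; auto).
  destruct (tm_m TZ zb Hdz) as [r1 [L [B1 [Hr1 [HL [HB1 [LM _]]]]]]]; [simpl; lra|].
  pose proof (Rabs_pos al) as Hal.
  set (k := 1 + Rabs al). assert (Hk : 1 <= k) by (unfold k; lra).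
  assert (HkL : 0 <= k * L) by (apply Rmult_le_pos; lra).
  set (rho := Rmin (Rmin r1 kap0) (Rmin (- yb / 2) (c / 2 / (k * L + 1)))).
  assert (q1 : rho <= r1) by le_min.
  assert (q2 : rho <= kap0) by le_min.
  assert (q3 : rho <= - yb / 2) by le_min.
  assert (q4 : rho * (k * L + 1) <= c / 2).
  { apply Rle_div_r; [lra|]. le_min. }
  assert (Hrho : 0 < rho).
  { unfold rho. repeat apply Rmin_glb_lt; try lra. apply Rdiv_lt_0_compat; lra. }
  set (c' := c / 2) in *. assert (Hc' : 0 < c') by (unfold c'; lra).
  assert (HuX : forall z, dst z zb < rho -> c' <= ul al (Xm Z z)).
  { intros z Hz. pose proof (ul_abs al (Xm Z z) (Xm Z zb)) as h. fold k in h.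
    assert (h1 : dst (Xm Z z) (Xm Z zb) <= L * dst z zb) by (apply LM; [lra|rewrite dst_refl; lra]).
    pose proof (dst_nonneg z zb).
    assert (k * dst (Xm Z z) (Xm Z zb) <= k * (L * dst z zb)) by (apply Rmult_le_compat_l; lra).
    assert (k * L * dst z zb <= k * L * rho) by (apply Rmult_le_compat_l; lra).
    apply Rabs_le_between in h. unfold c' in *. lra. }
  set (th := rho / (4 * (B + 1))).
  assert (Hth0 : 0 < th) by (unfold th; apply Rdiv_lt_0_compat; lra).
  assert (HBth : B * th <= rho / 4).
  { assert (th * (4 * (B + 1)) = rho) by (unfold th; field; lra). nra. }
  set (E := exp (L * th)). assert (HE : 1 <= E) by (apply exp_nonneg_ge1; apply Rmult_le_pos; lra).
  set (m := B * k / c'). assert (Hm : 0 <= m) by (unfold m; apply Rdiv_le_0_compat; auto; nra).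
  assert (Hkc : 0 < k / c') by (apply Rdiv_lt_0_compat; lra).
  (* k / c' bounds the hitting time by the distance, and E the spreading of two orbits over that
     time. 1 + m, with m = B k / c', accounts for the drift during the hitting time and for the
     difference of two hitting times. *)
  set (Ch := k / c' + E * (1 + m)).
  assert (HCh : 1 + m <= Ch) by (unfold Ch; nra).
  assert (HCh1 : k / c' <= Ch) by (unfold Ch; nra).
  assert (HCh2 : E * (1 + m) <= Ch) by (unfold Ch; lra).
  set (rh := Rmin (rho / 4) (c' * th / k)).
  assert (e1 : rh <= rho / 4) by le_min.
  assert (e2 : rh * k <= c' * th) by (apply Rle_div_r; [lra|le_min]).
  assert (Hrh : 0 < rh).
  { unfold rh. apply Rmin_glb_lt; [lra|]. apply Rdiv_lt_0_compat; [|lra]. nra. }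
  exists rh, Ch. split; [lra|split; [lra|]]. intros eps He.
  assert (Hek : 0 < eps < kap0) by lra.
  pose proof (cp_bdd HC eps Hek) as Hbd.
  pose proof (cp_flow HC eps Hek) as Hf.
  assert (HW : forall z, dst z zb < rho -> regularization Z Phi eps z = Xm Z z).
  { intros z Hz. apply (reg_low TZ T); [lra|apply (cp_dom HC z zb); auto; lra|].
    pose proof (dst_snd z zb) as h. simpl in h. apply Rabs_le_between in h. lra. }
  assert (HGX : forall z, dst z zb < rho -> G eps z = Xm Z z).
  { intros z Hz. rewrite (cp_agree HC eps Hek z zb) by (auto; lra). auto. }
  assert (Hspeed : forall z t, dst (phi eps t z) z <= B * Rabs t).
  { intros z t. pose proof (flow_speed (G eps) B (phi eps) 0 t z HB Hbd Hf) as h.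
    rewrite (proj1 (Hf z)), Rminus_0_r in h. exact h. }
  assert (Hstay : forall z t, dst z zb <= rh -> Rabs t <= th -> dst (phi eps t z) zb < rho).
  { intros z t Hz Ht. specialize (Hspeed z t).
    assert (B * Rabs t <= B * th) by (apply Rmult_le_compat_l; lra).
    pose proof (dst_triangle (phi eps t z) z zb). lra. }
  assert (Hmono : forall z s t, dst z zb <= rh -> - th <= s -> s <= t -> t <= th ->
    ul al (phi eps s z) + c' * (t - s) <= ul al (phi eps t z)).
  { intros z s t Hz h1 h2 h3.
    apply (derive_ge_increase (fun t => ul al (phi eps t z)) (fun t => ul al (G eps (phi eps t z)))); auto.
    - intros x Hx. apply ul_derive with (z := fun t => phi eps t z). apply Hf.
    - intros x Hx. assert (hx : dst (phi eps x z) zb < rho) by (apply Hstay; auto; apply Rabs_le; lra).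
      rewrite HGX by auto. auto. }
  assert (Hulzb : ul al zb = - a) by (unfold ul, zb, shear; simpl; ring).
  assert (Hulz : forall z, Rabs (ul al z + a) <= k * dst z zb).
  { intros z. pose proof (ul_abs al z zb) as h. rewrite Hulzb in h. fold k in h.
    replace (ul al z + a) with (ul al z - - a) by ring. exact h. }
  assert (Hex : forall z, exists h, dst z zb <= rh -> Rabs h <= k / c' * dst z zb /\ ul al (phi eps h z) = - a).
  { intros z. destruct (classic (dst z zb <= rh)) as [Hz|Hz].
    2: { exists 0. intros; tauto. }
    pose proof (dst_nonneg z zb) as Hd0.
    set (tt := k / c' * dst z zb).
    assert (Htt0 : 0 <= tt) by (unfold tt; apply Rmult_le_pos; lra).
    assert (Ect : c' * tt = k * dst z zb) by (unfold tt; field; lra).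
    assert (Htt : tt <= th).
    { apply Rmult_le_reg_l with c'; auto. rewrite Ect.
      assert (k * dst z zb <= k * rh) by (apply Rmult_le_compat_l; lra). lra. }
    specialize (Hulz z). apply Rabs_le_between in Hulz.
    pose proof (Hmono z (- tt) 0 Hz) as m1. pose proof (Hmono z 0 tt Hz) as m2.
    rewrite (proj1 (Hf z)) in m1, m2.
    assert (m1' : ul al (phi eps (- tt) z) + c' * (0 - - tt) <= ul al z) by (apply m1; lra).
    assert (m2' : ul al z + c' * (tt - 0) <= ul al (phi eps tt z)) by (apply m2; lra).
    destruct (intermediate_value (fun t => ul al (phi eps t z)) (- tt) tt (- a)) as [h [Hh Eh]].
    - lra.
    - intros x Hx. apply (is_derive_continuity_pt _ _ (ul al (G eps (phi eps x z)))).
      apply ul_derive with (z := fun t => phi eps t z). apply Hf.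
    - lra.
    - exists h. intros _. split; [apply Rabs_le; lra|exact Eh]. }
  destruct (functional_choice _ Hex) as [h Hh].
  exists h. intros z Hz. destruct (Hh z Hz) as [h1 h2].
  pose proof (dst_nonneg z zb) as Hd0.
  assert (Hhth : forall z, dst z zb <= rh -> Rabs (h z) <= th).
  { intros z' Hz'. destruct (Hh z' Hz') as [h3 _]. eapply Rle_trans; [exact h3|].
    apply Rmult_le_reg_l with c'; auto. replace (c' * (k / c' * dst z' zb)) with (k * dst z' zb) by (field; lra).
    assert (k * dst z' zb <= k * rh) by (apply Rmult_le_compat_l; lra). lra. }
  split; [|split; [|split; [|split; [|split]]]].
  - eapply Rle_trans; [exact h1|]. apply Rmult_le_compat_r; auto.
  - rewrite <- h2. symmetry. apply shear_ul.
  - intros s Hs. pose proof (dst_triangle (phi eps s z) z zb). specialize (Hspeed z s).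
    assert (B * Rabs s <= B * (k / c' * dst z zb)) by (apply Rmult_le_compat_l; lra).
    replace (B * (k / c' * dst z zb)) with (m * dst z zb) in H0 by (unfold m; field; lra).
    assert ((1 + m) * dst z zb <= Ch * dst z zb) by (apply Rmult_le_compat_r; auto). lra.
  - rewrite HW by lra. intros E0. assert (hz : dst z zb < rho) by lra.
    specialize (HuX z hz). rewrite E0 in HuX. unfold ul in HuX; simpl in HuX. lra.
  - intros Eu. pose proof (Hhth z Hz) as hz. apply Rabs_le_between in hz.
    destruct (Rtotal_order (h z) 0) as [h3|[h3|h3]]; auto; exfalso.
    + pose proof (Hmono z (h z) 0 Hz) as m1. rewrite (proj1 (Hf z)) in m1.
      assert (ul al (phi eps (h z) z) + c' * (0 - h z) <= ul al z) by (apply m1; lra).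
      assert (0 < c' * (0 - h z)) by (apply Rmult_lt_0_compat; lra). lra.
    + pose proof (Hmono z 0 (h z) Hz) as m1. rewrite (proj1 (Hf z)) in m1.
      assert (ul al z + c' * (h z - 0) <= ul al (phi eps (h z) z)) by (apply m1; lra).
      assert (0 < c' * (h z - 0)) by (apply Rmult_lt_0_compat; lra). lra.
  - intros w Hw. destruct (Hh w Hw) as [w1 w2].
    pose proof (Hhth z Hz) as hz. pose proof (Hhth w Hw) as hw.
    assert (A1 : dst (phi eps (h z) z) (phi eps (h z) w) <= E * dst z w).
    { eapply Rle_trans; [apply (flow_lipschitz_ball (G eps) (phi eps) z w L (h z) HL Hf)|].
      - intros s Hs. rewrite !HGX by (apply Hstay; auto; lra). apply LM.
        + assert (dst (phi eps s z) zb < rho) by (apply Hstay; auto; lra). lra.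
        + assert (dst (phi eps s w) zb < rho) by (apply Hstay; auto; lra). lra.
      - apply Rmult_le_compat_r; [apply dst_nonneg|]. apply exp_le. apply Rmult_le_compat_l; lra. }
    pose proof (dst_nonneg z w) as Hd.
    assert (A2 : c' * Rabs (h z - h w) <= k * (E * dst z w)).
    { assert (A3 : Rabs (ul al (phi eps (h z) w) - ul al (phi eps (h w) w)) <= k * (E * dst z w)).
      { rewrite w2, <- h2, Rabs_minus_sym. eapply Rle_trans; [apply ul_abs|]. fold k.
        apply Rmult_le_compat_l; lra. }
      eapply Rle_trans; [|exact A3]. apply Rabs_le_between in hz, hw.
      destruct (Rle_lt_dec (h z) (h w)) as [hh|hh].
      - pose proof (Hmono w (h z) (h w) Hw) as m1.
        assert (m1' : ul al (phi eps (h z) w) + c' * (h w - h z) <= ul al (phi eps (h w) w)) by (apply m1; lra).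
        assert (0 <= c' * (h w - h z)) by (apply Rmult_le_pos; lra).
        rewrite !Rabs_left1 by lra. lra.
      - pose proof (Hmono w (h w) (h z) Hw) as m1.
        assert (m1' : ul al (phi eps (h w) w) + c' * (h z - h w) <= ul al (phi eps (h z) w)) by (apply m1; lra).
        assert (0 <= c' * (h z - h w)) by (apply Rmult_le_pos; lra).
        rewrite !Rabs_right by lra. lra. }
    pose proof (flow_speed (G eps) B (phi eps) (h w) (h z) w HB Hbd Hf) as A4.
    assert (A5 : B * Rabs (h z - h w) <= m * (E * dst z w)).
    { replace (m * (E * dst z w)) with (B * (k * (E * dst z w) / c')) by (unfold m; field; lra).
      apply Rmult_le_compat_l; auto. apply Rle_div_r; auto. lra. }
    pose proof (dst_triangle (phi eps (h z) z) (phi eps (h z) w) (phi eps (h w) w)).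
    assert (E * (1 + m) * dst z w <= Ch * dst z w) by (apply Rmult_le_compat_r; auto). lra.
Qed.

(** The map is the passage near p, followed by the transit along [g] and the projection along the
    flow back to the section. The first clause fixes one radius [r0] on which it contracts; the
    second, for arbitrary [kap], shows that on smaller radii the whole orbit stays close to Gamma,
    and serves both for the existence of a fixed point and for convergence. *)
Lemma return_map (al a yb ya c : R) (xp : R -> pt) (ta : R) (g : R -> pt) (ta' tb' : R) :
  gate Z Gamma kap0 phi al a yb ya c xp ta ->
  ta' < tb' -> g ta' = shear al a ya -> g tb' = shear al (- a) yb ->
  (forall t, ta' <= t <= tb' -> Gamma (g t)) ->
  transit kap0 phi g ta' tb' ->
  exists r0 tmin, 0 < r0 <= kap0 /\ 0 < tmin /\ exists TT P : R -> R -> R,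
    (forall eps, 0 < eps < r0 -> forall y, Rabs (y - yb) <= r0 ->
       tmin <= TT eps y /\
       phi eps (TT eps y) (shear al (- a) y) = shear al (- a) (P eps y) /\
       forall y', Rabs (y' - yb) <= r0 -> Rabs (P eps y - P eps y') <= / 2 * Rabs (y - y')) /\
    (forall kap, 0 < kap -> exists rk, 0 < rk /\ forall eps, 0 < eps < rk -> eps < r0 ->
       forall y, Rabs (y - yb) <= rk -> Rabs (y - yb) <= r0 ->
         (forall s, 0 <= s <= TT eps y -> exists q, Gamma q /\
            dst (phi eps s (shear al (- a) y)) q <= kap) /\
         Rabs (P eps y - yb) <= kap).
Proof.
  intros GT Htab Ega Egb HGg [C [HC1 Htr]].
  destruct GT as [Hc [HGzb [Hyb Hulb]] HGza _ _ _ _ _ [Kc [HKc Hct]]].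
  destruct (section_hit al a yb c HGzb Hyb Hc Hulb) as [rh [Ch [Hrh [HCh Hhit]]]].
  set (zb := shear al (- a) yb) in *. set (za := shear al a ya) in *.
  pose proof (Rabs_pos al) as Hal.
  set (k := 1 + Rabs al). assert (Hk : 1 <= k) by (unfold k; lra).
  set (T0 := tb' - ta'). assert (HT0 : 0 < T0) by (unfold T0; lra).
  assert (Hprod : 0 < Ch * C * k) by (repeat apply Rmult_lt_0_compat; lra).
  (* The other Lipschitz constants are known by now, so the contraction at p can be chosen to make
     the product 1/2. *)
  set (Lc := / (2 * (Ch * C * k))).
  assert (HLc : 0 < Lc) by (unfold Lc; apply Rinv_0_lt_compat; lra).
  destruct (Hct Lc HLc) as [rg [Hrg Hgate]].
  (* The transit must end where [section_hit] applies, and the correction time, which may be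
     negative, must not exceed T0 / 2, so that the return time is at least T0 / 2. *)
  set (kap1 := Rmin rh (T0 / (2 * Ch))).
  assert (k1 : kap1 <= rh) by le_min.
  assert (k2 : kap1 * (2 * Ch) <= T0) by (apply Rle_div_r; [lra|le_min]).
  assert (Hkap1 : 0 < kap1).
  { unfold kap1. apply Rmin_glb_lt; [lra|]. apply Rdiv_lt_0_compat; lra. }
  destruct (Htr kap1 Hkap1) as [rt [Hrt Htr1]].
  assert (HkK : 0 < 2 * k * Kc) by (repeat apply Rmult_lt_0_compat; lra).
  (* The last bound puts the exit point of the gate, at distance at most 2 k Kc r0 from Gamma's
     point [za], within the radius [rt] of the transit. *)
  set (r0 := Rmin (Rmin rg rh) (Rmin rt (rt / (2 * k * Kc)))).
  assert (p1 : r0 <= rg) by le_min.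
  assert (p2 : r0 <= rh) by le_min.
  assert (p3 : r0 <= rt) by le_min.
  assert (p4 : r0 * (2 * k * Kc) <= rt).
  { apply Rle_div_r; [lra|]. le_min. }
  assert (Hr0 : 0 < r0).
  { unfold r0. repeat apply Rmin_glb_lt; try lra. apply Rdiv_lt_0_compat; lra. }
  assert (Hgc : forall eps, exists TQ : (R -> R) * (R -> R), 0 < eps < rg ->
    forall y, Rabs (y - yb) <= rg ->
        0 < fst TQ y /\
        phi eps (fst TQ y) (shear al (- a) y) = shear al a (snd TQ y) /\
        (forall s, 0 <= s <= fst TQ y -> exists q, Gamma q /\
           dst (phi eps s (shear al (- a) y)) q <= Kc * (Rabs (y - yb) + eps)) /\
        Rabs (snd TQ y - ya) <= Kc * (Rabs (y - yb) + eps) /\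
        forall y', Rabs (y' - yb) <= rg -> Rabs (snd TQ y - snd TQ y') <= Lc * Rabs (y - y')).
  { intros eps. destruct (classic (0 < eps < rg)) as [he|he].
    - destruct (Hgate eps he) as [T1 [Q1 H1]]. exists (T1, Q1). auto.
    - exists (fun _ => 0, fun _ => 0). intros; tauto. }
  destruct (functional_choice _ Hgc) as [TQ HTQ].
  assert (Hhc : forall eps, exists h : pt -> R, 0 < eps < rh -> forall z, dst z zb <= rh ->
      Rabs (h z) <= Ch * dst z zb /\
      phi eps (h z) z = shear al (- a) (snd (phi eps (h z) z)) /\
      (forall s, Rabs s <= Rabs (h z) -> dst (phi eps s z) zb <= Ch * dst z zb) /\
      forall w, dst w zb <= rh -> dst (phi eps (h z) z) (phi eps (h w) w) <= Ch * dst z w).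
  { intros eps. destruct (classic (0 < eps < rh)) as [he|he].
    - destruct (Hhit eps he) as [h1 H1]. exists h1. intros _ z Hz.
      destruct (H1 z Hz) as [A1 [A2 [A3 [_ [_ A4]]]]]. auto.
    - exists (fun _ => 0). intros; tauto. }
  destruct (functional_choice _ Hhc) as [hf Hhf].
  set (z1 := fun eps y => shear al a (snd (TQ eps) y)).
  set (z2 := fun eps y => phi eps T0 (z1 eps y)).
  set (TT := fun eps y => fst (TQ eps) y + T0 + hf eps (z2 eps y)).
  set (P := fun eps y => snd (phi eps (hf eps (z2 eps y)) (z2 eps y))).
  assert (Hz1 : forall eps y rr, 0 < eps < rg -> eps <= rr -> Rabs (y - yb) <= rg -> Rabs (y - yb) <= rr ->
    dst (z1 eps y) za <= rr * (2 * k * Kc)).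
  { intros eps y rr he her hy hyr. destruct (HTQ eps he y hy) as [_ [_ [_ [A1 _]]]].
    unfold z1, za. eapply Rle_trans; [apply shear_dst|]. fold k. rewrite Rminus_diag, Rabs_R0, Rplus_0_l.
    assert (Kc * (Rabs (y - yb) + eps) <= Kc * (2 * rr)) by (apply Rmult_le_compat_l; lra).
    replace (rr * (2 * k * Kc)) with (k * (Kc * (2 * rr))) by ring.
    apply Rmult_le_compat_l; lra. }
  assert (Hz2 : forall eps y, 0 < eps < r0 -> Rabs (y - yb) <= r0 -> dst (z2 eps y) zb <= kap1).
  { intros eps y he hy. destruct (Htr1 eps) as [A1 _]; [lra|].
    unfold z2. rewrite <- Egb. replace tb' with (ta' + T0) by (unfold T0; ring).
    apply A1; [|unfold T0 in *; lra]. rewrite Ega.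
    eapply Rle_trans; [apply (Hz1 eps y r0)|]; lra. }
  assert (Hplus : forall eps s t z, 0 < eps < r0 -> phi eps (t + s) z = phi eps s (phi eps t z)).
  { intros eps s t z he. assert (he' : 0 < eps < kap0) by lra.
    destruct (cp_lip HC eps he') as [L [HL HG]].
    apply (flow_plus (G eps) L); auto; [lra|]. apply (cp_flow HC); auto. }
  exists r0, (T0 / 2). split; [lra|split; [lra|]]. exists TT, P. split.
  - intros eps he y hy.
    destruct (HTQ eps) with (y := y) as [y1 [y2 [y3 [y4 y5]]]]; try lra.
    pose proof (Hz2 eps y he hy) as hz2.
    destruct (Hhf eps) with (z := z2 eps y) as [h1 [h2 [h3 h4]]]; try lra.
    assert (Hhb : Ch * dst (z2 eps y) zb <= Ch * kap1) by (apply Rmult_le_compat_l; lra).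
    split; [|split].
    + unfold TT. apply Rabs_le_between in h1. lra.
    + unfold TT. rewrite !Hplus by auto. rewrite y2. fold (z1 eps y). fold (z2 eps y). exact h2.
    + intros y' hy'. pose proof (Hz2 eps y' he hy') as hz2'.
      assert (A1 : dst (z2 eps y) (z2 eps y') <= C * dst (z1 eps y) (z1 eps y')).
      { destruct (Htr1 eps) as [_ A1]; [lra|]. unfold z2, T0. apply A1; rewrite Ega.
        - eapply Rle_trans; [apply (Hz1 eps y r0)|]; lra.
        - eapply Rle_trans; [apply (Hz1 eps y' r0)|]; lra. }
      assert (A2 : dst (z1 eps y) (z1 eps y') <= k * (Lc * Rabs (y - y'))).
      { unfold z1. eapply Rle_trans; [apply shear_dst|]. fold k.
        rewrite Rminus_diag, Rabs_R0, Rplus_0_l. apply Rmult_le_compat_l; [lra|]. apply y5. lra. }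
      assert (A3 : dst (phi eps (hf eps (z2 eps y)) (z2 eps y))
                       (phi eps (hf eps (z2 eps y')) (z2 eps y')) <= Ch * dst (z2 eps y) (z2 eps y')).
      { apply h4. lra. }
      pose proof (dst_snd (phi eps (hf eps (z2 eps y)) (z2 eps y))
                       (phi eps (hf eps (z2 eps y')) (z2 eps y'))) as A4.
      unfold P. eapply Rle_trans; [exact A4|]. eapply Rle_trans; [exact A3|].
      apply Rle_trans with (Ch * (C * (k * (Lc * Rabs (y - y'))))).
      * apply Rmult_le_compat_l; [lra|]. eapply Rle_trans; [exact A1|]. apply Rmult_le_compat_l; lra.
      * right. unfold Lc. field. lra.
  - intros kap Hkap.
    (* The choices above are repeated at scale [kap], for the same maps [TT] and [P]. *)
    set (kap2 := Rmin kap1 (kap / Ch)).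
    assert (m1 : kap2 <= kap1) by le_min.
    assert (m2 : kap2 * Ch <= kap) by (apply Rle_div_r; [lra|le_min]).
    assert (Hkap2 : 0 < kap2).
    { unfold kap2. apply Rmin_glb_lt; [lra|]. apply Rdiv_lt_0_compat; lra. }
    assert (m3 : kap2 <= kap) by nra.
    destruct (Htr kap2 Hkap2) as [rt2 [Hrt2 Htr2]].
    set (rk := Rmin (Rmin rt2 (rt2 / (2 * k * Kc))) (kap / (2 * Kc))).
    assert (n1 : rk <= rt2) by le_min.
    assert (n2 : rk * (2 * k * Kc) <= rt2).
    { apply Rle_div_r; [lra|]. le_min. }
    assert (n3 : rk * (2 * Kc) <= kap) by (apply Rle_div_r; [lra|le_min]).
    assert (Hrk : 0 < rk).
    { unfold rk. repeat apply Rmin_glb_lt; try lra; apply Rdiv_lt_0_compat; lra. }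
    exists rk. split; [auto|]. intros eps he he0 y hy hy0.
    assert (he' : 0 < eps < r0) by lra.
    destruct (HTQ eps) with (y := y) as [y1 [y2 [y3 [y4 y5]]]]; try lra.
    assert (hz1 : dst (z1 eps y) (g ta') <= rt2).
    { rewrite Ega. eapply Rle_trans; [apply (Hz1 eps y rk)|]; lra. }
    destruct (Htr2 eps) as [A1 _]; [lra|]. specialize (A1 _ hz1).
    assert (hz2 : dst (z2 eps y) zb <= kap2).
    { unfold z2. rewrite <- Egb. replace tb' with (ta' + T0) by (unfold T0; ring).
      apply A1. unfold T0 in *; lra. }
    destruct (Hhf eps) with (z := z2 eps y) as [h1 [h2 [h3 h4]]]; try lra.
    assert (Hhb : Ch * dst (z2 eps y) zb <= Ch * kap2) by (apply Rmult_le_compat_l; lra).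
    split.
    + intros s Hs.
      destruct (Rle_lt_dec s (fst (TQ eps) y)) as [c1|c1].
      * destruct (y3 s) as [q [Gq Dq]]; [lra|]. exists q. split; [auto|].
        eapply Rle_trans; [exact Dq|].
        assert (Kc * (Rabs (y - yb) + eps) <= Kc * (2 * rk)) by (apply Rmult_le_compat_l; lra). lra.
      * destruct (Rle_lt_dec s (fst (TQ eps) y + T0)) as [c2|c2].
        -- set (s' := s - fst (TQ eps) y).
           replace s with (fst (TQ eps) y + s') by (unfold s'; ring).
           rewrite Hplus, y2 by auto. fold (z1 eps y).
           exists (g (ta' + s')). split; [apply HGg; unfold s', T0 in *; lra|].
           eapply Rle_trans; [apply A1; unfold s', T0 in *; lra|]. lra.
        -- set (s' := s - fst (TQ eps) y - T0).
           replace s with (fst (TQ eps) y + T0 + s') by (unfold s'; ring).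
           rewrite !Hplus, y2 by auto. fold (z1 eps y). fold (z2 eps y).
           exists zb. split; [exact HGzb|]. eapply Rle_trans; [apply h3|lra].
           unfold TT in Hs. rewrite !Rabs_right; unfold s'; lra.
    + pose proof (h3 (hf eps (z2 eps y)) (Rle_refl _)) as A4.
      pose proof (dst_snd (phi eps (hf eps (z2 eps y)) (z2 eps y)) zb) as A5. simpl in A5.
      unfold P. lra.
Qed.

End Return.

(** * The polycycle as a closed curve and the order of its arcs *)

Lemma curve_neighbourhood (c : R -> pt) (a b : R) (U : set2) :
  a <= b -> (forall s, continuous c s) -> open U -> (forall s, a <= s <= b -> U (c s)) ->
  exists kap, 0 < kap /\ forall z s, a <= s <= b -> dst z (c s) < kap -> U z.
Proof.
  intros Hab Hc HU HcU.
  apply (interval_induction (fun t => exists kap, 0 < kap /\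
    forall z s, a <= s <= t -> dst z (c s) < kap -> U z) a b Hab).
  - destruct (open_dst U (c a) HU) as [r [Hr H]]; [apply HcU; lra|].
    exists r. split; [auto|]. intros z s Hs Hz. replace s with a in Hz by lra. auto.
  - intros s Hs. destruct (open_dst U (c s) HU (HcU s Hs)) as [r [Hr H]].
    assert (Hr2 : 0 < r / 2) by lra.
    destruct (continuous_dst c s _ (Hc s) Hr2) as [d [Hd Hd']].
    exists d. split; [auto|]. intros s1 s2 h1 h2 h3 h4 [kap [Hk HP]].
    exists (Rmin kap (r / 2)). split; [apply Rmin_glb_lt; auto|].
    intros z t Ht Hz. pose proof (Rmin_l kap (r / 2)). pose proof (Rmin_r kap (r / 2)).
    destruct (Rle_lt_dec t s1) as [h|h].
    + apply (HP z t); lra.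
    + apply H. assert (dst (c t) (c s) < r / 2) by (apply Hd'; apply Rabs_def1; lra).
      pose proof (dst_triangle z (c t) (c s)). lra.
Qed.

(* x2 is only known to solve the equation where it lies in the upper half
   plane; following x1, it never leaves it. *)
Lemma unique_in_upper_half (W : pt -> pt) (x1 x2 : R -> pt) (S : R) :
  0 <= S ->
  (forall s, 0 <= s <= S -> velocity x1 s (W (x1 s)) /\ 0 < snd (x1 s) /\ loc_lip W (x1 s)) ->
  (forall s, 0 <= s <= S -> continuous x2 s /\ (0 < snd (x2 s) -> velocity x2 s (W (x2 s)))) ->
  x1 0 = x2 0 -> x1 S = x2 S.
Proof.
  intros HS H1 H2 E0.
  apply (interval_induction (fun s => x1 s = x2 s) 0 S HS E0).
  intros s Hs. destruct (H1 s Hs) as [V1 [Y1 _]]. destruct (H2 s Hs) as [C2 _].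
  assert (He : 0 < snd (x1 s) / 4) by lra.
  destruct (velocity_continuous x1 s _ V1 _ He) as [d1 [Hd1 C1]].
  destruct (continuous_dst x2 s _ C2 He) as [d2 [Hd2 C2']].
  exists (Rmin d1 d2). split; [apply Rmin_glb_lt; auto|].
  intros s1 s2 h1 h2 h3 h4 E.
  pose proof (Rmin_l d1 d2). pose proof (Rmin_r d1 d2).
  assert (A1 : forall t, s1 <= t <= s2 -> dst (x1 t) (x1 s) < snd (x1 s) / 4).
  { intros t Ht. apply C1. apply Rabs_def1; lra. }
  assert (A2 : forall t, s1 <= t <= s2 -> dst (x2 t) (x2 s) < snd (x1 s) / 4).
  { intros t Ht. apply C2'. apply Rabs_def1; lra. }
  assert (A3 : dst (x2 s) (x1 s) < snd (x1 s) / 2).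
  { pose proof (dst_triangle (x2 s) (x2 s1) (x1 s)) as h5.
    rewrite (dst_sym (x2 s) (x2 s1)) in h5. rewrite <- E in h5 at 2.
    assert (dst (x1 s1) (x1 s) < snd (x1 s) / 4) by (apply A1; lra).
    assert (dst (x2 s1) (x2 s) < snd (x1 s) / 4) by (apply A2; lra). lra. }
  assert (A4 : forall t, s1 <= t <= s2 -> 0 < snd (x2 t)).
  { intros t Ht. specialize (A2 t Ht). pose proof (dst_triangle (x2 t) (x2 s) (x1 s)).
    pose proof (dst_snd (x2 t) (x1 s)) as h. apply Rabs_le_between in h. lra. }
  apply (ode_unique_forward W x1 x2 s1 s2); auto; [lra| | |].
  - intros t Ht. apply H1. lra.
  - intros t Ht. apply H2; [lra|]. apply A4; auto.
  - intros t Ht. apply H1. lra.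
Qed.

Lemma loc_lip_opp (W : pt -> pt) (q : pt) :
  loc_lip W q -> loc_lip (fun z => (- fst (W z), - snd (W z))) q.
Proof.
  intros [rho [L [A [C D]]]]. exists rho, L. split; [auto|split; [auto|]]. intros z w Hz Hw.
  eapply Rle_trans; [|apply D; eauto]. right. unfold dst; simpl. f_equal. ring.
Qed.

Lemma nice_loc_lip (X : pt -> pt) (q : pt) : nice_at X q -> loc_lip X q.
Proof. intros [rho [L [B [h1 [h2 [h3 [h4 h5]]]]]]]. exists rho, L. auto. Qed.

Lemma continuous_reverse (g : R -> pt) (t0 s : R) :
  continuous g (t0 - s) -> continuous (fun s => g (t0 - s)) s.
Proof.
  intros H. apply (continuous_comp (fun s => t0 - s) g); [|exact H].
  apply (ex_derive_continuous (fun s => t0 - s)). auto_derive. auto.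
Qed.

Section Polycycle.
Context {Z : filippov} (TZ : tame Z).

(* Backwards from za, the regular orbit follows the arc xp of Xp down to
   p = (0, 0), which is not on the orbit; so it has not met Sigma- yet. *)
Lemma arcs_ordered (g : R -> pt) (a b : Rbar) (xp : R -> pt) (ta t1 t2 : R) :
  regular_orbit Z g a b -> dom Z (0, 0) -> Xph Z (0, 0) = 0 ->
  Rbar_lt a t1 -> Rbar_lt t1 b -> Rbar_lt a t2 -> Rbar_lt t2 b ->
  0 < ta -> xp 0 = (0, 0) -> xp ta = g t1 ->
  (forall t, 0 <= t <= ta -> velocity xp t (Xp Z (xp t)) /\ dom Z (xp t)) ->
  (forall t, 0 < t <= ta -> 0 < snd (xp t)) ->
  snd (g t2) < 0 -> t1 < t2.
Proof.
  intros Hg Dp Hp a1 b1 a2 b2 Hta x0 xta Vx Ux Hneg.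
  apply Rnot_le_lt. intros Hle.
  assert (Hin : forall t, t2 <= t <= t1 -> Rbar_lt a t /\ Rbar_lt t b).
  { intros t Ht. split.
    - apply (Rbar_lt_le_trans _ t2); simpl; auto; lra.
    - apply (Rbar_le_lt_trans _ t1); simpl; auto; lra. }
  assert (Heq : forall S, 0 <= S -> S < ta -> S <= t1 - t2 -> xp (ta - S) = g (t1 - S)).
  { intros S HS HSta HSt.
    set (W := fun z => (- fst (Xp Z z), - snd (Xp Z z))).
    apply (unique_in_upper_half W (fun s => xp (ta - s)) (fun s => g (t1 - s)) S HS).
    - intros s Hs. split; [apply velocity_reverse, Vx; lra|split; [apply Ux; lra|]].
      apply loc_lip_opp, nice_loc_lip, (tm_p TZ); [apply Vx; lra|]. left; apply Ux; lra.
    - intros s Hs. destruct (Hin (t1 - s)) as [i1 i2]; [lra|].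
      destruct (Hg (t1 - s) i1 i2) as [g1 [g2 [g3 _]]]. split.
      + apply continuous_reverse. exact g2.
      + intros Hy. apply velocity_reverse. apply g3. split; [auto|]. rewrite (tm_h TZ); auto.
    - rewrite !Rminus_0_r. exact xta. }
  destruct (Rlt_le_dec (t1 - t2) ta) as [h|h].
  - assert (E : xp (ta - (t1 - t2)) = g (t1 - (t1 - t2))) by (apply Heq; lra).
    replace (t1 - (t1 - t2)) with t2 in E by ring.
    assert (0 < snd (xp (ta - (t1 - t2)))) by (apply Ux; lra). rewrite E in H. lra.
  (* The two arcs agree only for backward times smaller than [ta], so the value at p is reached by
     continuity. It contradicts the fact that a regular orbit meets Sigma in crossing points, while
     [Xp] is tangent at p. *)
  - assert (E : g (t1 - ta) = (0, 0)).
    { apply dst_eq0. apply Rnot_lt_le. intros Hgap.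
      destruct (Hin (t1 - ta)) as [i1 i2]; [lra|].
      destruct (Hg (t1 - ta) i1 i2) as [_ [Cg _]].
      set (gap := dst (g (t1 - ta)) (0, 0)) in *. assert (He : 0 < gap / 2) by lra.
      destruct (continuous_dst g (t1 - ta) _ Cg He) as [d1 [Hd1 C1]].
      destruct (Vx 0) as [Vx0 _]; [lra|].
      destruct (velocity_continuous xp 0 _ Vx0 _ He) as [d2 [Hd2 C2]]. rewrite x0 in C2.
      set (e := Rmin (Rmin (d1 / 2) (d2 / 2)) (ta / 2)).
      assert (f1 : e <= d1 / 2) by le_min.
      assert (f2 : e <= d2 / 2) by le_min.
      assert (f3 : e <= ta / 2) by le_min.
      assert (f0 : 0 < e) by (unfold e; repeat apply Rmin_glb_lt; lra).
      assert (Ee : xp (ta - (ta - e)) = g (t1 - (ta - e))) by (apply Heq; lra).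
      assert (A1 : dst (g (t1 - (ta - e))) (g (t1 - ta)) < gap / 2).
      { apply C1. replace (t1 - (ta - e) - (t1 - ta)) with e by ring. rewrite Rabs_right; lra. }
      assert (A2 : dst (xp (ta - (ta - e))) (0, 0) < gap / 2).
      { apply C2. replace (ta - (ta - e) - 0) with e by ring. rewrite Rabs_right; lra. }
      rewrite Ee in A2.
      pose proof (dst_triangle (g (t1 - ta)) (g (t1 - (ta - e))) (0, 0)) as A3.
      rewrite (dst_sym (g (t1 - ta)) (g (t1 - (ta - e)))) in A3. unfold gap in *. lra. }
    destruct (Hin (t1 - ta)) as [i1 i2]; [lra|].
    destruct (Hg (t1 - ta) i1 i2) as [_ [_ [_ [_ HS]]]].
    rewrite E in HS. destruct HS as [[_ Hc] _].
    { split; [auto|]. rewrite (tm_h TZ); auto. }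
    rewrite Hp in Hc. lra.
Qed.

(** With a single singularity the parametrization has period 1, so Gamma is the image of [0, 1] and
    one regular orbit [g] covers all of it except possibly p. *)
Lemma polycycle_curve (p : pt) (Gamma : set2) :
  sigma_polycycle Z (p :: nil) Gamma ->
  exists (c g : R -> pt) (a b : Rbar),
    (forall s, continuous c s) /\ (forall s, Gamma (c s)) /\
    (forall q, Gamma q <-> exists s, 0 <= s <= 1 /\ c s = q) /\
    regular_orbit Z g a b /\
    (forall t : R, Rbar_lt a t -> Rbar_lt t b -> Gamma (g t)) /\
    (forall q, Gamma q -> q = p \/ exists t : R, Rbar_lt a t /\ Rbar_lt t b /\ g t = q) /\
    Gamma p.
Proof.
  intros [_ [_ [[c [Hc [Hper [_ [Hc0 HG]]]]] _]]].
  change (INR (length (p :: nil))) with 1 in Hper.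
  destruct (Hc0 0%nat) as [E0 [g [a [b [_ [Hg [theta [_ [Ht1 Ht2]]]]]]]]]; [simpl; lia|].
  simpl in E0, Ht1, Ht2.
  exists c, g, a, b. split; [exact Hc|split; [intros s; apply HG; exists s; reflexivity|]].
  assert (Hred : forall q, Gamma q -> exists s, 0 <= s < 1 /\ c s = q).
  { intros q Hq. apply HG in Hq. destruct Hq as [s Es].
    destruct (period_reduce c 1 Rlt_0_1 Hper s) as [s' [Hs' Es']]. exists s'. split; [auto|congruence]. }
  split; [|split; [exact Hg|split; [|split]]].
  - intros q. split.
    + intros Hq. destruct (Hred q Hq) as [s [Hs Es]]. exists s. split; [lra|auto].
    + intros [s [_ Es]]. apply HG. exists s. exact Es.
  - intros t Ha Hb. destruct (Ht2 t Ha Hb) as [s [Hs Es]]. apply HG. exists s.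
    destruct (Ht1 s Hs) as [_ [_ E]]. rewrite E, Es. reflexivity.
  - intros q Hq. destruct (Hred q Hq) as [s [Hs Es]].
    destruct (Req_dec s 0) as [->|Hne]; [left; congruence|].
    right. exists (theta s). destruct (Ht1 s) as [h1 [h2 h3]]; [lra|].
    split; [auto|split; [auto|congruence]].
  - apply HG. exists 0. exact E0.
Qed.

(** The first piece of the trajectory cannot lie in Sigma-, because [Xm] points upwards near p while
    the piece starts at height 0, and it cannot slide, because it does not meet Sigma again before
    time t. So it follows [Xp] in Sigma+. *)
Lemma departing_arc (x : R -> pt) (t : R) :
  dom Z (0, 0) -> 0 < snd (Xm Z (0, 0)) -> 0 < t -> trajectory Z x 0 t -> x 0 = (0, 0) ->
  (forall s, 0 < s < t -> ~ Sigma Z (x s)) ->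
  exists s1, 0 < s1 /\ continuous x 0 /\
    forall s, 0 < s < s1 -> velocity x s (Xp Z (x s)) /\ 0 < snd (x s).
Proof.
  intros Dp Hm Ht [Hcd [N [s [s0 [sN Hs]]]]] x0 Hns.
  assert (Cx : continuous x 0) by (apply Hcd; lra).
  assert (HN : (0 < N)%nat) by (destruct N; [exfalso; lra|lia]).
  assert (Hle : forall j, (j <= N - 1)%nat -> s 1%nat <= s (S j)).
  { induction j as [|j IH]; intros Hj; [lra|].
    destruct (Hs (S j)) as [h _]; [lia|]. assert (s 1%nat <= s (S j)) by (apply IH; lia). lra. }
  assert (Hs1 : s 1%nat <= t).
  { rewrite <- sN. replace N with (S (N - 1)) by lia. apply Hle. lia. }
  destruct (Hs 0%nat HN) as [h01 Hf]. rewrite s0 in h01, Hf. set (s1 := s 1%nat) in *.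
  exists s1. split; [auto|split; [exact Cx|]].
  destruct Hf as [Hf|[Hf|Hf]].
  - intros u Hu. destruct (Hf u Hu) as [[hd hh] hv]. split; [auto|].
    rewrite (tm_h TZ) in hh; auto.
  - exfalso.
    destruct (tm_m TZ (0, 0) Dp) as [r [L [B [Hr [HL [_ [LM _]]]]]]]; [simpl; lra|].
    set (m2 := snd (Xm Z (0, 0))) in *.
    set (e := Rmin r (m2 / (2 * (L + 1)))).
    assert (e1 : e <= r) by le_min.
    assert (e2 : e * (2 * (L + 1)) <= m2) by (apply Rle_div_r; [lra|le_min]).
    assert (He : 0 < e) by (unfold e; apply Rmin_glb_lt; auto; apply Rdiv_lt_0_compat; lra).
    destruct (continuous_dst x 0 _ Cx He) as [d [Hd Hd']].
    set (u := Rmin (d / 2) (s1 / 2)).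
    assert (u1 : u <= d / 2) by le_min. assert (u2 : u <= s1 / 2) by le_min.
    assert (u0 : 0 < u) by (unfold u; apply Rmin_glb_lt; lra).
    assert (h : snd (x 0) + 0 * (u - 0) <= snd (x u)).
    { apply (derive_ge_increase_open (fun v => snd (x v)) (fun v => snd (Xm Z (x v)))).
      - lra.
      - intros v Hv. apply continuous_snd_pt. apply Hcd. lra.
      - intros v Hv. apply (Hf v). lra.
      - intros v Hv.
        assert (hv : dst (x v) (x 0) < e) by (apply Hd'; rewrite Rminus_0_r, Rabs_right; lra).
        rewrite x0 in hv.
        assert (h1 : dst (Xm Z (x v)) (Xm Z (0, 0)) <= L * dst (x v) (0, 0)).
        { apply LM; [lra|rewrite dst_refl; auto]. }
        pose proof (dst_snd (Xm Z (x v)) (Xm Z (0, 0))) as h2. fold m2 in h2.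
        apply Rabs_le_between in h2.
        assert (L * dst (x v) (0, 0) <= L * e) by (apply Rmult_le_compat_l; lra). lra. }
    rewrite x0 in h. simpl in h.
    destruct (Hf u) as [[hd hh] _]; [lra|]. rewrite (tm_h TZ) in hh; auto. lra.
  - exfalso. apply (Hns (s1 / 2)); [lra|]. apply (Hf (s1 / 2)). lra.
Qed.

End Polycycle.

Theorem theoremB
  (k : nat) (hk : (1 <= k)%nat)
  (Z : filippov)
  (hZ : filippov_class Z (2 * k))
  (hy : forall q, dom Z q -> h Z q = snd q)
  (p : pt) (hp : p = (0, 0))
  (Gamma : set2)
  (hGamma : polycycle_type_b Z k p Gamma)
  (b1 : fst (Xp Z p) > 0)
  (m : nat) (q : nat -> pt)
  (q_first : q 0%nat = p)
  (q_last : q (S m) = p)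
  (b2_transversal : forall i, (1 <= i <= m)%nat -> Sigma_c Z (q i))
  (b2_flow : forall i, (i <= m)%nat ->
     exists (t : R) (g : R -> pt),
       0 < t /\ trajectory Z g 0 t /\ g 0 = q i /\ g t = q (S i) /\
       (forall s, 0 < s < t -> ~ Sigma Z (g s)))
  (b2_Gamma : forall z, (Gamma z /\ Sigma Z z) <->
     (z = p \/ exists i, (1 <= i <= m)%nat /\ z = q i))
  (b3 : subset (union (W_pf Z delta_s p) (W_t Z delta_u p)) Gamma)
  (b3_sign : Xmh Z p > 0)
  (n : nat) (hn : (n >= 2 * k - 1)%nat)
  (Phi : R -> R) (hPhi : C_ST (n - 1) Phi) :
  exists (eps0 : R) (Geps : R -> set2),
    0 < eps0 /\
    (forall eps, 0 < eps < eps0 ->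
       limit_cycle (dom Z) (regularization Z Phi eps) (Geps eps)) /\
    converges_to Geps Gamma.
Proof.
  subst p.
  pose proof (filippov_tame Z k hk hZ hy) as TZ.
  destruct hPhi as [hPhi _].
  destruct (monotonic_transition_facts _ _ hPhi) as [ell T].
  destruct hGamma as [hpoly [[[Dp _] [hvis _]] _]].
  assert (Xph0 : Xph Z (0, 0) = 0) by (apply (hvis 1%nat); lia).
  assert (Xp0 : snd (Xp Z (0, 0)) = 0) by (unfold Xph in Xph0; rewrite (lie_h TZ) in Xph0; auto).
  assert (Xm0 : 0 < snd (Xm Z (0, 0))) by (unfold Xmh in b3_sign; rewrite (lie_h TZ) in b3_sign; auto).
  destruct (polycycle_curve _ _ hpoly) as [c [g [ga [gb [Hc [HcG' [HcG [Hg [HgG [HGg Gp]]]]]]]]]].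
  assert (HdG : forall z, Gamma z -> dom Z z).
  { intros z Hz. destruct (HGg z Hz) as [->|[t [h1 [h2 <-]]]]; [exact Dp|]. exact (proj1 (Hg t h1 h2)). }
  (* The arc that leaves p tells on which side of Sigma the orbit of [Xp] through p starts. *)
  destruct (b2_flow 0%nat) as [t0 [x0 [Ht0 [Htr0 [Ex0 [_ Hns0]]]]]]; [lia|].
  rewrite q_first in Ex0.
  destruct (departing_arc TZ x0 t0 Dp Xm0 Ht0 Htr0 Ex0 Hns0) as [s1 [Hs1 [Cx0 Hx0]]].
  assert (HCF : exists kap0 B G phi, completed Z Phi Gamma kap0 B G phi).
  { destruct (complete_extension TZ T c 0 1) as [kap0 [B [Hk0 [HB [Hd He]]]]]; auto; [lra|].
    (* Extension and flow are chosen for all eps at once; outside (0, kap0) the pair is a dummy. *)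
    assert (Hch : forall eps, exists GF : (pt -> pt) * (R -> pt -> pt), 0 < eps < kap0 ->
      (exists L, 0 < L /\ lip2 L (fst GF)) /\ bounded2 B (fst GF) /\ is_flow (fst GF) (snd GF) /\
      forall z s, 0 <= s <= 1 -> dst z (c s) < kap0 -> fst GF z = regularization Z Phi eps z).
    { intros eps. destruct (classic (0 < eps < kap0)) as [he|he].
      - destruct (He eps he) as [L [G [HL [HG [Hb Ha]]]]].
        destruct (flow_exists G L B HL HB HG Hb) as [phi Hphi].
        exists (G, phi). intros _. split; [exists L; auto|auto].
      - exists (fun z => z, fun _ z => z). intros; tauto. }
    destruct (functional_choice _ Hch) as [GF HGF].
    exists kap0, B, (fun eps => fst (GF eps)), (fun eps => snd (GF eps)).
    constructor; auto.
    - intros z w Hw Hz. apply HcG in Hw. destruct Hw as [s [Hs <-]]. apply (Hd z s); auto.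
    - intros eps he. apply (HGF eps he).
    - intros eps he. apply (HGF eps he).
    - intros eps he z w Hw Hz. apply HcG in Hw. destruct Hw as [s [Hs <-]].
      destruct (HGF eps he) as [_ [_ [_ h4]]]. apply (h4 z s); auto.
    - intros eps he. apply (HGF eps he). }
  destruct HCF as [kap0 [B [G [phi HC]]]].
  pose proof (cp_kap HC) as Hk0.
  destruct (gate_exists Z TZ ell Phi T Gamma kap0 B G phi HC x0 s1) as
    [al [a [yb [ya [c1 [xp [ta GT]]]]]]]; auto.
  { intros z Hz. apply b3. left. exact Hz. }
  { intros z Hz. apply b3. right. exact Hz. }
  pose proof GT as GT'.
  destruct GT' as [Hc1 [HGzb [Hyb Hulb]] HGza Hta xp0 xpa Vxp Uxp _].
  assert (Hya : 0 < ya).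
  { assert (h : 0 < snd (xp ta)) by (apply Uxp; lra). rewrite xpa in h. exact h. }
  (* The two ends of the gate have nonzero ordinate, so they differ from p and lie on the regular
     orbit. *)
  destruct (HGg _ HGza) as [E|[ta' [ha1 [ha2 Ega]]]].
  { unfold shear in E. injection E as _ E. lra. }
  destruct (HGg _ HGzb) as [E|[tb' [hb1 [hb2 Egb]]]].
  { unfold shear in E. injection E as _ E. lra. }
  (* The orbit runs from the exit of the gate to its entrance, not the other way round; only then
     does the transit close up with the gate into a return map. *)
  assert (Htab : ta' < tb').
  { apply (arcs_ordered TZ g ga gb xp ta ta' tb'); auto.
    - congruence.
    - rewrite Egb. exact Hyb. }
  assert (Hin : forall t, ta' <= t <= tb' -> Rbar_lt ga t /\ Rbar_lt t gb).
  { intros t Ht. split.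
    - apply (Rbar_lt_le_trans _ ta'); simpl; auto; lra.
    - apply (Rbar_le_lt_trans _ tb'); simpl; auto; lra. }
  assert (Htr : transit kap0 phi g ta' tb').
  { apply (transit_all TZ T HC Hg HgG); auto. lra. }
  destruct (return_map TZ T HC al a yb ya c1 xp ta g ta' tb' GT Htab Ega Egb) as
    [r0 [tmin [Hr0 [Htmin [TT [P [HP Hnear]]]]]]]; auto.
  { intros t Ht. destruct (Hin t Ht). apply HgG; auto. }
  destruct (section_hit TZ T HC al a yb c1 HGzb Hyb Hc1 Hulb) as [rh [Ch [Hrh [HCh Hhit]]]].
  set (Sy := fun y => shear al (- a) y).
  set (kS := 1 + Rabs al). pose proof (Rabs_pos al) as Hal.
  assert (HSy : forall y y', dst (Sy y) (Sy y') <= kS * Rabs (y - y')).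
  { intros y y'. eapply Rle_trans; [apply shear_dst|]. rewrite Rminus_diag, Rabs_R0. unfold kS. lra. }
  assert (Hk02 : 0 < kap0 / 2) by lra.
  destruct (Hnear _ Hk02) as [rk1 [Hrk1 Hnear1]].
  assert (HkS : 1 <= kS) by (unfold kS; lra).
  (* Within [r0] the return map contracts. Within [rk1] the returning orbits stay within kap0 / 2 of
     Gamma, where [G] is the regularization. The last bound keeps the section points in the range of
     [section_hit]. *)
  set (r := Rmin (Rmin r0 rk1) (rh / kS)).
  assert (q1 : r <= r0) by le_min.
  assert (q2 : r <= rk1) by le_min.
  assert (q3 : r * kS <= rh) by (apply Rle_div_r; [lra|le_min]).
  assert (Hr : 0 < r).
  { unfold r. repeat apply Rmin_glb_lt; try lra. apply Rdiv_lt_0_compat; lra. }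
  assert (Hr4 : 0 < r / 4) by lra.
  (* With |P yb - yb| <= r / 4 the fixed point is within r / 2 of [yb], which leaves room for a
     neighbourhood of it. *)
  destruct (Hnear _ Hr4) as [rk2 [Hrk2 Hnear2]].
  set (eps0 := Rmin (Rmin r0 rk1) (Rmin rk2 rh)).
  assert (e1 : eps0 <= r0) by le_min.
  assert (e2 : eps0 <= rk1) by le_min.
  assert (e3 : eps0 <= rk2) by le_min.
  assert (e4 : eps0 <= rh) by le_min.
  assert (He0 : 0 < eps0) by (unfold eps0; repeat apply Rmin_glb_lt; lra).
  assert (Ryb : forall rr, 0 <= rr -> Rabs (yb - yb) <= rr).
  { intros rr h. rewrite Rminus_diag, Rabs_R0. exact h. }
  assert (HPyb : forall eps, 0 < eps < eps0 -> Rabs (P eps yb - yb) <= r / 4).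
  { intros eps he. apply (Hnear2 eps); [lra|lra|apply Ryb; lra|apply Ryb; lra]. }
  (* The fixed point is selected as a function of eps on the whole line, with the dummy value 0
     outside (0, eps0), because the family of cycles must be a total function of eps. *)
  assert (Hfix : forall eps, exists ys, 0 < eps < eps0 ->
    Rabs (ys - yb) <= 2 * Rabs (P eps yb - yb) /\ P eps ys = ys).
  { intros eps. destruct (classic (0 < eps < eps0)) as [he|he].
    2: { exists 0. intros; tauto. }
    destruct (contraction_fixed_point (P eps) yb r) as [ys Hys]; auto.
    - intros y y' hy1 hy2. destruct (HP eps) with (y := y) as [_ [_ h]]; try lra. apply h. lra.
    - specialize (HPyb eps he). lra.
    - exists ys. auto. }
  destruct (functional_choice _ Hfix) as [ysf Hysf].
  exists eps0, (fun eps z => exists t, phi eps t (Sy (ysf eps)) = z).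
  split; [exact He0|split].
  - intros eps he. destruct (Hysf eps he) as [Hys1 Hys2]. specialize (HPyb eps he).
    set (ys := ysf eps) in *.
    assert (Hek : 0 < eps < kap0) by lra.
    destruct (cp_lip HC eps Hek) as [L [HL HG]].
    assert (Hzs : dst (Sy ys) (Sy yb) <= rh / 2).
    { eapply Rle_trans; [apply HSy|].
      assert (kS * Rabs (ys - yb) <= kS * (r / 2)) by (apply Rmult_le_compat_l; lra). lra. }
    destruct (Hhit eps) as [h Hh]; [lra|].
    (* The first bound keeps points near the fixed point in the range of [section_hit]. The second
       makes them hit the section within r / 2 of [ys], hence within r of [yb]. *)
    set (beta := Rmin (rh / 2) (r / (2 * Ch))).
    assert (b1' : beta <= rh / 2) by le_min.
    assert (b2' : beta * (2 * Ch) <= r) by (apply Rle_div_r; [lra|le_min]).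
    assert (Hbeta : 0 < beta).
    { unfold beta. apply Rmin_glb_lt; [lra|]. apply Rdiv_lt_0_compat; lra. }
    apply (limit_cycle_of_return (dom Z)
      (fun z => exists w, Gamma w /\ dst z w <= kap0 / 2)
      (regularization Z Phi eps) (G eps) L (phi eps) Sy kS yb r tmin (Ch * rh) beta ys (TT eps) (P eps));
      auto; try lra.
    + apply (cp_flow HC); auto.
    + intros z [w [Gw Dw]]. split; [apply (cp_dom HC z w); auto; lra|].
      exists (kap0 / 2). split; [lra|]. intros z' Hz'.
      apply (cp_agree HC eps Hek z' w Gw).
      pose proof (dst_triangle z' z w). lra.
    + intros y hy1. destruct (HP eps) with (y := y) as [h1 [h2 h3]]; try lra.
      split; [exact h1|split; [exact h2|split]].
      * assert (A : Rabs (P eps y - P eps yb) <= / 2 * Rabs (y - yb)) by (apply h3, Ryb; lra).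
        replace (P eps y - yb) with ((P eps y - P eps yb) + (P eps yb - yb)) by ring.
        eapply Rle_trans; [apply Rabs_triang|]. lra.
      * apply (Hnear1 eps); lra.
    + intros y y' hy1 hy2. destruct (HP eps) with (y := y) as [_ [_ h3]]; try lra. apply h3. lra.
    + apply (Hh (Sy ys)). change (dst (Sy ys) (Sy yb) <= rh). lra.
    + intros z Hz.
      assert (Hz1 : dst z (Sy yb) <= rh) by (pose proof (dst_triangle z (Sy ys) (Sy yb)); lra).
      assert (Hz2 : dst (Sy ys) (Sy yb) <= rh) by lra.
      destruct (Hh z Hz1) as [A1 [A2 [_ [_ [_ A3]]]]].
      specialize (A3 (Sy ys) Hz2).
      destruct (Hh (Sy ys) Hz2) as [_ [_ [_ [_ [A4 _]]]]].
      rewrite A4 in A3 by (unfold ul, Sy, shear; simpl; ring).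
      rewrite (proj1 (cp_flow HC eps Hek (Sy ys))) in A3.
      exists (h z), (snd (phi eps (h z) z)). split; [|split; [|exact A2]].
      * eapply Rle_trans; [exact A1|]. apply Rmult_le_compat_l; [lra|exact Hz1].
      * pose proof (dst_snd (phi eps (h z) z) (Sy ys)) as A5. simpl in A5.
        assert (Ch * dst z (Sy ys) <= Ch * beta) by (apply Rmult_le_compat_l; lra).
        replace (snd (phi eps (h z) z) - yb) with ((snd (phi eps (h z) z) - ys) + (ys - yb)) by ring.
        eapply Rle_trans; [apply Rabs_triang|]. lra.
  - intros U HU HGU.
    destruct (curve_neighbourhood c 0 1 U) as [kap [Hkap HkU]]; auto; [lra|].
    assert (Hkap2 : 0 < kap / 2) by lra.
    (* An orbit started within [rk3] of [yb] stays within kap / 2 of Gamma. The fixed point is that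
       close once |P yb - yb| <= rk3 / 2, which determines [rk4]. *)
    destruct (Hnear _ Hkap2) as [rk3 [Hrk3 Hnear3]].
    assert (Hrk32 : 0 < rk3 / 2) by lra.
    destruct (Hnear _ Hrk32) as [rk4 [Hrk4 Hnear4]].
    exists (Rmin eps0 (Rmin rk3 rk4)). split; [apply Rmin_glb_lt; [exact He0|apply Rmin_glb_lt; auto]|].
    intros eps he z [t Et].
    pose proof (Rmin_l eps0 (Rmin rk3 rk4)). pose proof (Rmin_r eps0 (Rmin rk3 rk4)).
    pose proof (Rmin_l rk3 rk4). pose proof (Rmin_r rk3 rk4).
    assert (he' : 0 < eps < eps0) by lra.
    destruct (Hysf eps he') as [Hys1 Hys2]. specialize (HPyb eps he').
    set (ys := ysf eps) in *.
    assert (Hys3 : Rabs (ys - yb) <= rk3).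
    { assert (Rabs (P eps yb - yb) <= rk3 / 2); [|lra].
      apply (Hnear4 eps); [lra|lra|apply Ryb; lra|apply Ryb; lra]. }
    destruct (HP eps) with (y := ys) as [h1 [h2 _]]; try lra.
    assert (Hek : 0 < eps < kap0) by lra.
    destruct (cp_lip HC eps Hek) as [L [HL HG]].
    (* Periodicity reduces an arbitrary time to the first return, the only range where closeness to
       Gamma is known. *)
    assert (Hper : forall u, phi eps (u + TT eps ys) (Sy ys) = phi eps u (Sy ys)).
    { intros u. rewrite Rplus_comm.
      rewrite (flow_plus (G eps) L (phi eps)); auto; [|lra|apply (cp_flow HC); auto].
      unfold Sy at 1. rewrite h2, Hys2. reflexivity. }
    assert (HTT : 0 < TT eps ys) by lra.
    destruct (period_reduce (fun t => phi eps t (Sy ys)) _ HTT Hper t) as [s [Hs Es]].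
    destruct (Hnear3 eps) with (y := ys) as [h3 _]; try lra.
    destruct (h3 s) as [w [Gw Dw]]; [lra|].
    apply HcG in Gw. destruct Gw as [v [Hv <-]].
    apply (HkU z v Hv). rewrite <- Et, <- Es.
    change (dst (phi eps s (shear al (- a) ys)) (c v) < kap). lra.
Qed.
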